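(* Let $m\ge 2$, let $G_1,\dots,G_m$ be compact abelian groups with respective dual groups $\Gamma_1,\dots,\Gamma_m$, and let $p_1,\dots,p_m\in[1,2)$. For $1\le j\le m$, let $\Lambda_j\subset\Gamma_j$ be a $p_j$-Sidon and $\Lambda(2)$-set. Then $\Lambda_1\times\cdots\times\Lambda_m$ is a $p$-Sidon set in $\Gamma_1\times\cdots\times\Gamma_m$ for $$\frac1p=\frac 12+\frac{1}{2R},\qquad R=\sum_{k=1}^m \frac{p_k}{2-p_k}.$$ Moreover, this value of $p$ is optimal: for all $m\ge2$ and $p_1,\dots,p_m\in[1,2)$, with $p$ defined by $\frac1p=\frac12+\frac1{2R}$ where $R=\sum_{k=1}^m\frac{p_k}{2-p_k}$, and for every $p'\in[1,p)$, there exist compact abelian groups $G_1,\dots,G_m$ with dual groups $\Gamma_1,\dots,\Gamma_m$ and sets $\Lambda_j\subset\Gamma_j$ ($1\le j\le m$), each $\Lambda_j$ being both $p_j$-Sidon and a $\Lambda(2)$-set, such that $\Lambda_1\times\cdots\times\Lambda_m$ is not $p'$-Sidon.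
   Context: Let $G$ be a compact abelian group with dual group $\Gamma$. A subset $\Lambda\subset\Gamma$ is $p$-Sidon ($1\le p<2$) if there is $\kappa>0$ such that each $f\in\mathcal C(G)$ with $\hat f$ supported on $\Lambda$ satisfies $\|\hat f\|_{\ell_p}\le\kappa\|f\|_\infty$. A subset $\Lambda\subset\Gamma$ is a $\Lambda(2)$-set if for one $q\in[1,2)$ (equivalently, for all $q\in[1,2)$) there is $\kappa>0$ such that $\|f\|_{L^2(G)}\le\kappa\|f\|_{L^q(G)}$ for all $f\in\mathcal C(G)$ with $\hat f$ supported on $\Lambda$. The group $\Gamma_1\times\cdots\times\Gamma_m$ is identified with the dual group of $G_1\times\cdots\times G_m$. *)

(* Defs.v *)
From HB Require Import structures.
From mathcomp Require Import all_boot all_order all_algebra.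
From mathcomp Require Import complex.
From mathcomp Require Import all_classical all_reals all_analysis.

Set Implicit Arguments.
Unset Strict Implicit.
Unset Printing Implicit Defensive.

Import Order.TTheory GRing.Theory Num.Theory.
Import numFieldNormedType.Exports.

Local Open Scope classical_set_scope.
Local Open Scope ring_scope.
Local Open Scope complex_scope.

Import Normc.

HB.mixin Record isCompactHausdorff T & Topological T := {
  compact_setT : compact [set: T];
  hausdorff_setT : hausdorff_space T }.

#[short(type="compactAbGroupType")]
HB.structure Definition CompactAbGroup :=
  {T of TopologicalZmodule T & isCompactHausdorff T}.

(* The library puts the product topology on [prod_topology G] but no group
   structure on a dependent product; both are needed for G_1 x ... x G_m. *)
Section product_group_zmodule.
Context {I : eqType} (G : I -> topologicalZmodType).
Local Notation P := (prod_topology G).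

Let zero : P := fun=> 0.
Let opp (x : P) : P := fun i => - x i.
Let add (x y : P) : P := fun i => x i + y i.

Let addA : associative add.
Proof.
by move=> x y z; apply: functional_extensionality_dep => i; exact: addrA.
Qed.

Let addC : commutative add.
Proof.
by move=> x y; apply: functional_extensionality_dep => i; exact: addrC.
Qed.

Let add0 : left_id zero add.
Proof. by move=> x; apply: functional_extensionality_dep => i; exact: add0r. Qed.

Let addN : left_inverse zero opp add.
Proof. by move=> x; apply: functional_extensionality_dep => i; exact: addNr. Qed.

HB.instance Definition _ := GRing.isZmodule.Build P addA addC add0 addN.

Let sub_cont : continuous (fun x : P * P => x.1 - x.2).
Proof.
move=> x; apply/cvg_sup => i; move: x.
apply: (@continuous_comp_initial _ _ _ (fun f : P => f i)
  (fun x : P * P => x.1 - x.2)) => x.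
have pi : continuous (fun f : P => f i) by exact: (@proj_continuous I G i).
apply: (@continuous_comp _ _ _ (fun x : P * P => (x.1 i, x.2 i))
  (fun y : G i * G i => y.1 - y.2)); last exact: sub_continuous.
apply: cvg_pair => /=.
  by apply: (@continuous_comp _ _ _ fst (fun f : P => f i));
    [exact: cvg_fst|exact: pi].
by apply: (@continuous_comp _ _ _ snd (fun f : P => f i));
  [exact: cvg_snd|exact: pi].
Qed.

HB.instance Definition _ :=
  PreTopologicalNmodule_isTopologicalZmodule.Build P sub_cont.

End product_group_zmodule.

Section product_group_compact.
Context {I : eqType} (G : I -> compactAbGroupType).
Local Notation P := (prod_topology G).

Let compactP : compact [set: P].
Proof.
have := @tychonoff I G (fun i => setT) (fun i => @compact_setT (G i)).
by congr (compact _); rewrite -subTset.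
Qed.

Let hausdorffP : hausdorff_space P.
Proof. by apply: hausdorff_product => i; exact: hausdorff_setT. Qed.

HB.instance Definition _ := isCompactHausdorff.Build P compactP hausdorffP.

End product_group_compact.

(* Carrier of the Borel sigma-algebra: an alias, because a [measurableType] must
   be pointed (here by 0) and a topological group is not declared pointed. *)
Definition borel (G : compactAbGroupType) : Type := G.

HB.instance Definition _ (G : compactAbGroupType) := Choice.on (borel G).
HB.instance Definition _ (G : compactAbGroupType) :=
  isPointed.Build (borel G) (0 : G).
HB.instance Definition _ (G : compactAbGroupType) :=
  Measurable.copy (borel G) (g_sigma_algebraType (@open G : set (set (borel G)))).

Section harmonic_analysis.
Context {R : realType} {G : compactAbGroupType}.
Implicit Types (mu : probability (borel G) R) (L : set (G -> R[i])).

(* By Haar's theorem exactly one [mu] satisfies this. The library does not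
   construct it, so the notions below take it as a parameter. *)
Definition is_haar mu : Prop :=
  (forall (a : G) (A : set (borel G)), measurable A ->
     mu [set a + x | x in (A : set G)] = mu A) /\
  (forall A : set (borel G), measurable A ->
     mu A = ereal_inf [set mu U | U in [set U : set G | open U /\ A `<=` U]] /\
     mu A = ereal_sup [set mu K | K in [set K : set G | compact K /\ K `<=` A]]).

(* The continuous characters of [G], as a set of functions; only the underlying
   set of the dual group matters below. *)
Definition dual : set (G -> R[i]) :=
  [set g | [/\ continuous (g : G -> R[i]^o),
               forall x y, g (x + y) = g x * g y
             & forall x, normc (g x) = 1]].

Definition fourier mu (f g : G -> R[i]) : R[i] :=
  (\int[mu]_x complex.Re (f x * (g x)^*)) +i*
  (\int[mu]_x complex.Im (f x * (g x)^*)).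

Definition spectrum_in mu L (f : G -> R[i]) : Prop :=
  forall g, dual g -> ~ L g -> fourier mu f g = 0.

Definition sup_norm (f : G -> R[i]) : R := sup (range (fun x => normc (f x))).

Definition fourier_lp_norm mu (p : R) (f : G -> R[i]) : \bar R :=
  ((\esum_(g in dual) (normc (fourier mu f g) `^ p)%:E) `^ p^-1)%E.

(* The exponent is meant to range over [1, 2[. *)
Definition sidon mu (p : R) L : Prop :=
  exists2 k : R, 0 < k &
    forall f : G -> R[i], continuous (f : G -> R[i]^o) -> spectrum_in mu L f ->
      (fourier_lp_norm mu p f <= (k * sup_norm f)%:E)%E.

Definition Lp_norm mu (q : R) (f : G -> R[i]) : \bar R :=
  ('N[mu]_(q%:E)[EFin \o (@normc R \o f)])%E.

Definition Lambda2 mu L : Prop :=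
  exists2 q : R, 1 <= q < 2 & exists2 k : R, 0 < k &
    forall f : G -> R[i], continuous (f : G -> R[i]^o) -> spectrum_in mu L f ->
      (Lp_norm mu 2 f <= k%:E * Lp_norm mu q f)%E.

End harmonic_analysis.

Arguments dual R G : clear implicits.

(* The identification of the product of the dual groups with the dual group of
   the product: (g_j)_j acts as x |-> \prod_j g_j (x_j). *)
Definition prod_char {R : realType} {I : finType} {G : I -> compactAbGroupType}
    (g : forall j, G j -> R[i]) : prod_topology G -> R[i] :=
  fun x => \prod_j g j (x j).

Definition prod_spectrum {R : realType} {I : finType}
    {G : I -> compactAbGroupType} (L : forall j, set (G j -> R[i])) :
    set (prod_topology G -> R[i]) :=
  [set prod_char g | g in [set g | forall j, L j (g j)]].

(* Main.v *)
(** The sets Lambda_j are Lambda(2) and p_j-Sidon, so for [f] bounded by 1 with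
    spectrum in their product the L^2 masses [b_k(g)] of the spectral projections
    of [f] onto the k-th frequency [g] satisfy [sum_g b_k(g)^(p_k/2) <= C]: on
    each section the l^(p_k) norm of the coefficients is bounded by Sidonicity in
    the k-th variable, and the L^2 norm of a coefficient in the remaining variables
    is controlled by its L^1 norm by Lambda(2).  Since [sum |f^(chi)|^2] over the
    [chi] with k-th component [g] is at most [b_k(g)], weighted AM-GM
    [b^s <= s sum_j w_j b b_j^(t_j-1) + (1-s) prod_j b_j^(v_j)] for
    [b = |f^(chi)|^2] and [s = r/2] bounds [sum |f^(chi)|^r].  That frequency slices of [f]
    outside Lambda_k vanish is the uniqueness theorem for Fourier series, proved
    through eigenfunctions of convolution operators (Peter-Weyl).

    For optimality, take Rademacher functions [r_n] on the Cantor group and, on its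
    d-th power, the characters [prod_j r_(code(w|S_j))(x_j)] for words [w] of length
    [d] and windows [S_j] of [q] cyclically consecutive positions.  The
    same AM-GM argument, with Finner's inequality in place of a product of sums,
    makes them [2d/(d+q)]-Sidon, where [d/q] approximates [p_k/(2-p_k)] from
    below.  With letters taken from an alphabet of [M] elements, a product of such
    sets has [M^D] words, [D] the sum of the [d]'s, but its characters only
    depend on [D M^q] signs, so by random signs some polynomial of [M^D] terms
    has sup norm of order [M^((D+q)/2)]. *)
From HB Require Import structures.
From mathcomp Require Import all_boot all_order all_algebra.
From mathcomp Require Import complex.
From mathcomp Require Import all_classical all_reals all_analysis.
From mathcomp Require Import measurable_realfun zify ring lra.
Require Import Defs.
Set Implicit Arguments.
Unset Strict Implicit.
Unset Printing Implicit Defensive.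
Import Order.TTheory GRing.Theory Num.Theory.
Import numFieldNormedType.Exports.
Local Open Scope classical_set_scope.
Local Open Scope ring_scope.
Local Open Scope complex_scope.
Import Normc.
Local Notation "z ^*" := (Num.conj z) : complex_scope.

(** * Continuous functions and their integrals *)

(** The exponent comes out of the AM-GM step. Its product term splits into the sums already under
    control as soon as [v_j = t_j = p_j/2]. The relation [w_j (1 - t_j) s = v_j (1 - s)] then makes
    [w_j] proportional to [p_j/(2 - p_j)], and [sum_j w_j = 1] forces [s/(1 - s) = R], that is
    [r = 2s = 2R/(R + 1)]. A factor enters only through [p_j/(2 - p_j)], which is [d/q] for a
    fractional set; with one [q] common to all factors these ratios add up to [D/q], so the product
    of fractional sets reaches the same exponent up to rounding. The obstacle is measure-theoretic.
    The groups are arbitrary, and the Borel sets of a product of compact groups may exceed the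
    product of the Borel sigma-algebras, so [nu] is not at hand as a product measure. Iterated
    integrals are therefore taken of continuous functions only: Fubini is proved by approximating
    integrals uniformly by finite sums, and [nu] is tied to the measures [mu j] through translation
    invariance. *)

Section cts.
Context {R : realType} {T : topologicalType}.
Implicit Types (f g : T -> R) (F H : T -> R[i]).

(** Continuity is sealed in records so that [cts] meets a fixed head symbol, and so that the
    topology [R[i]^o] on the codomain is chosen once. *)
Record ct f : Prop := Ct { ct_continuous : continuous f }.
Record cct F : Prop := Cct { cct_continuous : continuous (F : T -> R[i]^o) }.

Lemma ct_at f x : ct f -> {for x, continuous f}.
Proof. by case=> h; exact: h. Qed.
Lemma ct_cst c : ct (fun=> c).
Proof. by split=> x; exact: cvg_cst. Qed.
Lemma ctD f g : ct f -> ct g -> ct (fun x => f x + g x).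
Proof. move=> [cf] [cg]; split=> x; apply: cvgD; [exact: cf|exact: cg]. Qed.
Lemma ctN f : ct f -> ct (fun x => - f x).
Proof. move=> [cf]; split=> x; apply: cvgN; exact: cf. Qed.
Lemma ctM f g : ct f -> ct g -> ct (fun x => f x * g x).
Proof. move=> [cf] [cg]; split=> x; apply: cvgM; [exact: cf|exact: cg]. Qed.
Lemma ctX f n : ct f -> ct (fun x => f x ^+ n).
Proof.
move=> cf; elim: n => [|n IH]; first exact: ct_cst.
by under eq_fun do rewrite exprS; exact: ctM.
Qed.
Lemma ct_norm f : ct f -> ct (fun x => `|f x|).
Proof. move=> [cf]; split=> x; apply: cvg_norm; exact: cf. Qed.
Lemma ct_sqrt f : ct f -> ct (fun x => Num.sqrt (f x)).
Proof. move=> [cf]; split=> x; apply: continuous_comp; [exact: cf|exact: sqrt_continuous]. Qed.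
Lemma ct_sum (I : Type) (s : seq I) (P : pred I) (h : I -> T -> R) :
  (forall i, ct (h i)) -> ct (fun x => \sum_(i <- s | P i) h i x).
Proof.
move=> ch; elim: s => [|i s IH].
  by under eq_fun do rewrite big_nil; exact: ct_cst.
under eq_fun do rewrite big_cons; case: (P i) => //.
exact: ctD.
Qed.

Lemma normcN (z : R[i]) : normc (- z) = normc z.
Proof. by case: z => a b; rewrite /normc /= !sqrrN. Qed.

Lemma cctP F : cct F <-> (forall x (e : R), 0 < e -> \forall y \near x, normc (F x - F y) < e).
Proof.
split=> [[h] x|h].
  move=> e e0; have := h x => /cvgrPdist_lt /(_ e%:C).
  rewrite ltcR => /(_ e0); apply: filterS => y.
  by rewrite -[`|_|]/((normc _)%:C) ltcR.
split=> x; apply/cvgrPdist_lt => e e0.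
(* A positive element of [R[i]] is real, so complex radii reduce to real ones. *)
have eE : e = (complex.Re e)%:C by rewrite RRe_real// gtr0_real.
have e1 : 0 < complex.Re e by rewrite -ltcR -eE.
apply: filterS (h x _ e1) => y ye.
by rewrite eE -[`|_|]/((normc _)%:C) ltcR.
Qed.

Lemma normc_Re (z : R[i]) : `|complex.Re z| <= normc z.
Proof.
case: z => a b /=; rewrite -sqrtr_sqr ler_wsqrtr// lerDl sqr_ge0//.
Qed.
Lemma normc_Im (z : R[i]) : `|complex.Im z| <= normc z.
Proof.
case: z => a b /=; rewrite -sqrtr_sqr ler_wsqrtr// lerDr sqr_ge0//.
Qed.
Lemma normcD (z w : R[i]) : normc (z + w) <= normc z + normc w.
Proof. exact: le_normcD. Qed.
Lemma normc_ge0 (z : R[i]) : 0 <= normc z.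
Proof. by case: z => a b; rewrite /normc sqrtr_ge0. Qed.
Lemma normc_le (z : R[i]) : normc z <= `|complex.Re z| + `|complex.Im z|.
Proof.
case: z => a b /=; rewrite -(@ler_pXn2r _ 2)// ?nnegrE ?sqrtr_ge0// ?addr_ge0//.
rewrite sqr_sqrtr ?addr_ge0 ?sqr_ge0// sqrrD !real_normK ?num_real//.
by rewrite addrAC lerDl mulrn_wge0// mulr_ge0.
Qed.
Lemma normcB_le (z w : R[i]) : `|normc z - normc w| <= normc (z - w).
Proof.
rewrite ler_norml; apply/andP; split.
  rewrite lerNl opprB lerBlDr -(normcN (z - w)) opprB.
  by apply: le_trans (normcD _ _); rewrite subrK.
by rewrite lerBlDr; apply: le_trans (normcD _ _); rewrite subrK.
Qed.

Lemma cct_Re F : cct F -> ct (fun x => complex.Re (F x)).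
Proof.
move=> /cctP h; split=> x; apply/cvgrPdist_lt => e e0.
apply: filterS (h x e e0) => y; apply: le_lt_trans.
by apply: le_trans (normc_Re _); case: (F x) (F y) => a b [c d].
Qed.
Lemma cct_Im F : cct F -> ct (fun x => complex.Im (F x)).
Proof.
move=> /cctP h; split=> x; apply/cvgrPdist_lt => e e0.
apply: filterS (h x e e0) => y; apply: le_lt_trans.
by apply: le_trans (normc_Im _); case: (F x) (F y) => a b [c d].
Qed.
Lemma cct_normc F : cct F -> ct (fun x => normc (F x)).
Proof.
move=> /cctP h; split=> x; apply/cvgrPdist_lt => e e0.
by apply: filterS (h x e e0) => y; apply: le_lt_trans; exact: normcB_le.
Qed.
Lemma cct_ReIm F : ct (fun x => complex.Re (F x)) -> ct (fun x => complex.Im (F x)) -> cct F.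
Proof.
move=> h1 h2; apply/cctP => x e e0.
have e2 : 0 < e / 2 by rewrite divr_gt0.
have /cvgrPdist_lt /(_ _ e2) H1 := @ct_at _ x h1.
have /cvgrPdist_lt /(_ _ e2) H2 := @ct_at _ x h2.
apply: filterS2 H1 H2 => y H1 H2.
apply: le_lt_trans (normc_le _) _; rewrite [e]splitr ltrD//.
  by case: (F x) (F y) H1 => a b [c d].
by case: (F x) (F y) H2 => a b [c d].
Qed.

Lemma cct_cst c : cct (fun=> c).
Proof. by split=> x; exact: cvg_cst. Qed.
Lemma cctD F H : cct F -> cct H -> cct (fun x => F x + H x).
Proof. move=> [cf] [cg]; split=> x; apply: (@cvgD _ R[i]^o); [exact: cf|exact: cg]. Qed.
Lemma cctN F : cct F -> cct (fun x => - F x).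
Proof. move=> [cf]; split=> x; apply: (@cvgN _ R[i]^o); exact: cf. Qed.
Lemma cctM F H : cct F -> cct H -> cct (fun x => F x * H x).
Proof. move=> [cf] [cg]; split=> x; apply: (@cvgM R[i]); [exact: cf|exact: cg]. Qed.
Lemma cctJ F : cct F -> cct (fun x => (F x)^*).
Proof.
move=> /cctP h; apply/cctP => x e e0; apply: filterS (h x e e0) => y.
rewrite -[(F x)^*]/(conjc (F x)) -[(F y)^*]/(conjc (F y)).
by case: (F x) (F y) => a b [c d]; rewrite /= -opprD sqrrN.
Qed.
Lemma cct_real f : ct f -> cct (fun x => (f x)%:C).
Proof. by move=> h; apply: cct_ReIm => //=; exact: ct_cst. Qed.
Lemma cct_sum (I : Type) (s : seq I) (P : pred I) (h : I -> T -> R[i]) :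
  (forall i, cct (h i)) -> cct (fun x => \sum_(i <- s | P i) h i x).
Proof.
move=> ch; elim: s => [|i s IH].
  rewrite (_ : (fun x => _) = fun=> 0); first exact: cct_cst.
  by apply/funext => x; rewrite big_nil.
rewrite (_ : (fun x => _) = fun x => if P i then h i x + \sum_(j <- s | P j) h j x else \sum_(j <- s | P j) h j x).
  by case: (P i); [apply: (cctD (ch i) IH)|exact: IH].
by apply/funext => x; rewrite big_cons.
Qed.
Lemma cct_prod (I : Type) (s : seq I) (P : pred I) (h : I -> T -> R[i]) :
  (forall i, cct (h i)) -> cct (fun x => \prod_(i <- s | P i) h i x).
Proof.
move=> ch; elim: s => [|i s IH].
  rewrite (_ : (fun x => _) = fun=> 1); first exact: cct_cst.
  by apply/funext => x; rewrite big_nil.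
rewrite (_ : (fun x => _) = fun x => if P i then h i x * \prod_(j <- s | P j) h j x else \prod_(j <- s | P j) h j x).
  by case: (P i); [apply: (cctM (ch i) IH)|exact: IH].
by apply/funext => x; rewrite big_cons.
Qed.

End cts.

Lemma ct_comp {R : realType} (S T : topologicalType) (u : S -> T) (f : T -> R) :
  continuous u -> ct f -> ct (fun x => f (u x)).
Proof. move=> cu [cf]; split=> x; apply: continuous_comp; [exact: cu|exact: cf]. Qed.
Lemma cct_comp {R : realType} (S T : topologicalType) (u : S -> T) (f : T -> R[i]) :
  continuous u -> cct f -> cct (fun x => f (u x)).
Proof. move=> cu [cf]; split=> x; apply: (@continuous_comp _ _ R[i]^o); [exact: cu|exact: cf]. Qed.

(** The second-order patterns read the operands off under the binder, where plain unification would
    have to guess them. *)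
Ltac cts :=
  repeat first [lazymatch goal with
  | |- ct (fun x => @GRing.add _ (@?f x) (@?g x)) => refine (@ctD _ _ f g _ _)
  | |- ct (fun x => @GRing.opp _ (@?f x)) => refine (@ctN _ _ f _)
  | |- ct (fun x => @GRing.mul _ (@?f x) (@?g x)) => refine (@ctM _ _ f g _ _)
  | |- ct (fun x => @GRing.exp _ (@?f x) ?n) => refine (@ctX _ _ f n _)
  | |- ct (fun x => @Num.norm _ _ (@?f x)) => refine (@ct_norm _ _ f _)
  | |- ct (fun x => Num.sqrt (@?f x)) => refine (@ct_sqrt _ _ f _)
  | |- ct (fun x => complex.Re (@?f x)) => refine (@cct_Re _ _ f _)
  | |- ct (fun x => complex.Im (@?f x)) => refine (@cct_Im _ _ f _)
  | |- ct (fun x => normc (@?f x)) => refine (@cct_normc _ _ f _)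
  | |- cct (fun x => @GRing.add _ (@?f x) (@?g x)) => refine (@cctD _ _ f g _ _)
  | |- cct (fun x => @GRing.opp _ (@?f x)) => refine (@cctN _ _ f _)
  | |- cct (fun x => @GRing.mul _ (@?f x) (@?g x)) => refine (@cctM _ _ f g _ _)
  | |- cct (fun x => @Num.conj _ (@?f x)) => refine (@cctJ _ _ f _)
  | |- cct (fun x => real_complex _ (@?f x)) => refine (@cct_real _ _ f _)
  | |- ct _ => first [assumption | refine (@ct_cst _ _ _) | multimatch goal with H : forall i, ct _ |- _ => exact: H end]
  | |- cct _ => first [assumption | refine (@cct_cst _ _ _) | multimatch goal with H : forall i, cct _ |- _ => exact: H end]
  end].

Section real_integral.
Context {R : realType} {X : compactAbGroupType}.
Variable mu : probability (borel X) R.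
Implicit Types f g : X -> R.

Lemma ct_bounded f : ct f -> exists M, forall x, `|f x| <= M.
Proof.
move=> [cf]; have cpt : compact (range f).
  apply: continuous_compact; last exact: compact_setT.
  exact: continuous_subspaceT.
have [M [_ /(_ (M + 1)) h]] := @compact_bounded R R^o (range f) cpt.
 exists (M + 1) => x; apply: h; first by rewrite ltrDl.
by exists x.
Qed.

Lemma open_measurable_borel (A : set X) : open A -> measurable (A : set (borel X)).
Proof. by move=> oA; exact: sub_gen_smallest. Qed.

Lemma ct_measurable f : ct f -> measurable_fun [set: borel X] (f : borel X -> R).
Proof.
move=> [cf]; apply: (measurability _ (RGenOInfty.measurableE R)) => //.
move=> _ [_ [a ->] <-]; rewrite setTI; apply: open_measurable_borel.
by move/continuousP : cf; apply; exact: interval_open.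
Qed.

Lemma bounded_integrable (f : borel X -> R) M :
  measurable_fun [set: borel X] f -> (forall x, `|f x| <= M) ->
  mu.-integrable setT (EFin \o f).
Proof.
move=> mf bf; apply: measurable_bounded_integrable => //.
  by rewrite (@le_lt_trans _ _ 1%E) ?ltry// probability_le1.
exists M; split; first exact: num_real.
by move=> N MN x _; exact: le_trans (bf x) (ltW MN).
Qed.

Lemma ct_integrable f : ct f -> mu.-integrable [set: borel X] (EFin \o f).
Proof.
move=> cf; have [M bM] := ct_bounded cf.
exact: bounded_integrable (ct_measurable cf) bM.
Qed.

Lemma rI_cst (c : R) : \int[mu]_x c = c.
Proof.
rewrite Rintegral_cst// -[RHS]mulr1; congr (_ * _).
by transitivity (@fine R 1%E) => //; congr fine; exact: (probability_setT mu).
Qed.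
Lemma rID f g : ct f -> ct g -> \int[mu]_x (f x + g x) = \int[mu]_x f x + \int[mu]_x g x.
Proof. by move=> cf cg; rewrite RintegralD//; exact: ct_integrable. Qed.
Lemma rIZ c f : ct f -> \int[mu]_x (c * f x) = c * \int[mu]_x f x.
Proof. by move=> cf; rewrite RintegralZl//; exact: ct_integrable. Qed.
Lemma rIN f : ct f -> \int[mu]_x (- f x) = - \int[mu]_x f x.
Proof.
move=> cf; rewrite -mulN1r -rIZ//; apply: eq_Rintegral => x _.
by rewrite mulN1r.
Qed.
Lemma rIB f g : ct f -> ct g -> \int[mu]_x (f x - g x) = \int[mu]_x f x - \int[mu]_x g x.
Proof. by move=> cf cg; rewrite RintegralB//; exact: ct_integrable. Qed.
Lemma rI_le f g : ct f -> ct g -> (forall x, f x <= g x) ->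
  \int[mu]_x f x <= \int[mu]_x g x.
Proof.
by move=> cf cg fg; apply: le_Rintegral => //; exact: ct_integrable.
Qed.
Lemma rI_ge0 f : (forall x, 0 <= f x) -> 0 <= \int[mu]_x f x.
Proof. by move=> h; apply: Rintegral_ge0 => x _. Qed.
Lemma rI_norm f : ct f -> `|\int[mu]_x f x| <= \int[mu]_x `|f x|.
Proof. by move=> cf; apply: le_normr_Rintegral => //; exact: ct_integrable. Qed.
Lemma rI_sum (I : Type) (s : seq I) (P : pred I) (h : I -> X -> R) :
  (forall i, ct (h i)) ->
  \int[mu]_x (\sum_(i <- s | P i) h i x) = \sum_(i <- s | P i) \int[mu]_x h i x.
Proof.
move=> ch; elim: s => [|i s IH].
  rewrite big_nil; under eq_Rintegral do rewrite big_nil.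
  exact: rI_cst.
rewrite big_cons; under eq_Rintegral do rewrite big_cons.
case: (P i) => //; rewrite -IH rID//; exact: ct_sum.
Qed.
Lemma rI_bound f M : ct f -> (forall x, `|f x| <= M) -> `|\int[mu]_x f x| <= M.
Proof.
move=> cf fM; apply: le_trans (rI_norm cf) _; rewrite -[leRHS]rI_cst.
by apply: rI_le => //; cts.
Qed.

End real_integral.

(** * Compactness, quadrature and Fubini for continuous functions *)

Lemma finite_cover (X : compactAbGroupType) (I : eqType) (U : I -> X -> Prop) :
  (forall y, exists x, \forall z \near (y : X), U x z) ->
  exists s : seq I, forall y, exists2 x, x \in s & U x y.
Proof.
move=> hU; have /compact_near_coveringP h := @compact_setT X.
(* Finite lists directed by inclusion. Compactness in its near-covering form, taken along this
   filter, yields one list that serves all [y]. *)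
pose F := [set P : set (seq I) | exists s0 : seq I, forall s, {subset s0 <= s} -> P s].
have FF : Filter F.
  constructor; first by exists [::].
    move=> P Q [s hs] [t ht]; exists (s ++ t) => u su; split.
      by apply: hs => x xs; apply: su; rewrite mem_cat xs.
    by apply: ht => x xs; apply: su; rewrite mem_cat xs orbT.
  by move=> P Q PQ [s hs]; exists s => t /hs /PQ.
have := h _ F (fun s y => exists2 x, x \in s & U x y) FF.
case=> [y _|s0 /(_ s0) hs].
  have [x hx] := hU y; exists (U x, [set s : seq I | x \in s]) => /=.
    by split=> //; exists [:: x] => s; apply; rewrite inE.
  by move=> [z s] /= [Uz xs]; exists x.
by exists s0 => y; apply: hs.
Qed.

Section quadrature.
Context {R : realType} {X : compactAbGroupType}.
Variable mu : probability (borel X) R.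

(** The tube lemma: compactness of [X] makes the neighbourhood of [x0] uniform in [y]. *)
Lemma near_equicontinuous (T : topologicalType) (F : T * X -> R) (x0 : T) (e : R) :
  ct F -> 0 < e -> \forall x \near x0, forall y, `|F (x, y) - F (x0, y)| <= e.
Proof.
move=> cF e0.
have /compact_near_coveringP h := @compact_setT X.
have := h T (nbhs x0) (fun x y => `|F (x, y) - F (x0, y)| <= e) _ _.
move=> /(_ _ _)/wrap[].
- move=> y0 _; have e2 : 0 < e / 2 by rewrite divr_gt0.
  have /cvgrPdist_lt /(_ _ e2) H1 := @ct_at _ _ _ (x0, y0) cF.
  have H2 : \forall y' \near y0 & x' \near x0, `|F (x0, y0) - F (x', y')| < e / 2.
    by case: H1 => -[A B] /= [hA hB] AB; exists (B, A) => //= -[y x] /= [By Ax]; exact: (AB (x, y)).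
  have H3 : \forall y' \near y0 & x' \near x0, `|F (x0, y0) - F (x0, y')| < e / 2.
    case: H1 => -[A B] /= [hA hB] AB; exists (B, setT) => /=.
      by split => //; exact: filterT.
    by move=> -[y x] /= [By _]; apply: (AB (x0, y)); split => //=; exact: nbhs_singleton.
  apply: filterS2 H2 H3 => -[y x] /= H2 H3.
  rewrite (splitr e); apply: le_trans (ler_distD (F (x0, y0)) _ _) _.
  by rewrite lerD// ?ltW// distrC.
by apply: filterS => x hx y; exact: hx.
Qed.

Lemma ct_rI (T : topologicalType) (F : T * X -> R) :
  ct F -> ct (fun x => \int[mu]_y F (x, y)).
Proof.
move=> cF; split=> x0; apply/cvgrPdist_le => e e0.
apply: filterS (near_equicontinuous x0 cF e0) => x hx.
have cx x' : ct (fun y => F (x', y)).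
  apply: (@ct_comp _ _ _ (fun y => (x', y))) => // y.
  by apply: cvg_pair => /=; [exact: cvg_cst|exact: cvg_id].
rewrite -rIB//; apply: rI_bound; first by apply: ctD => //; exact: ctN.
by move=> y; rewrite distrC.
Qed.

(** The cover is made disjoint along the list: the node [x] receives the mass of the part of [B]
    inside [U x], and the induction goes on with the rest of [B]. The weights depend on the cover
    alone, so one list serves every [g j]. *)
Lemma quadrature_cover (J : Type) (g : J -> X -> R) (e : R) (U : X -> set X) (s : seq X) :
  (forall j, ct (g j)) -> (forall x, open (U x)) ->
  (forall x y, U x y -> forall j, `|g j y - g j x| <= e) ->
  forall B : set (borel X), measurable B -> (forall y, B y -> exists2 x, x \in s & U x y) ->
  exists l : seq (R * X), [/\ forall p, p \in l -> 0 <= p.1,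
    \sum_(p <- l) p.1 = fine (mu B)
    & forall j, `|\int[mu]_(y in B) g j y - \sum_(p <- l) p.1 * g j p.2| <= e * fine (mu B)].
Proof.
move=> cg oU hU; elim: s => [|x s IH] B mB Bs.
  have -> : B = set0 by apply/seteqP; split => // y /Bs[].
  exists [::]; split => //; first by rewrite big_nil measure0.
  by move=> j; rewrite Rintegral_set0 big_nil subrr normr0 measure0 mulr0.
have mU : measurable (U x : set (borel X)) by exact: open_measurable_borel.
have mBU : measurable (B `&` U x : set (borel X)) by exact: measurableI.
have mBD : measurable (B `\` U x : set (borel X)) by exact: measurableD.
have fin A : measurable A -> mu A \is a fin_num by move=> mA; exact: fin_num_measure.
have muB : fine (mu B) = fine (mu (B `&` U x)) + fine (mu (B `\` U x)).
  rewrite -fineD ?fin//; congr fine.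
  by rewrite -measureU// ?setUIDK// setDE setICA -setIA setICr !setI0.
have [y [By nUy]|l [l0 l1 l2]] := IH _ mBD.
  have [z] := Bs _ By; rewrite inE => /orP[/eqP->//|zs Uz]; by exists z.
exists ((fine (mu (B `&` U x)), x) :: l); split.
- by move=> p; rewrite inE => /orP[/eqP->|/l0//] /=; rewrite fine_ge0.
- by rewrite big_cons l1 muB.
move=> j; rewrite big_cons /=.
have ig := ct_integrable mu (cg j).
have iB A : measurable A -> mu.-integrable A (EFin \o g j).
  by move=> mA; apply: (integrableS measurableT).
have -> : \int[mu]_(y in B) g j y =
    \int[mu]_(y in B `&` U x) g j y + \int[mu]_(y in B `\` U x) g j y.
  rewrite -Rintegral_setU ?setUIDK//; first exact: iB.
  by apply/disj_setPLR => z [_ Uz] [].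
rewrite muB mulrDr opprD addrACA; apply: le_trans (ler_normD _ _) _.
rewrite lerD//.
have ic : mu.-integrable (B `&` U x) (EFin \o (fun=> g j x)).
  by apply: (integrableS measurableT) => //; apply: ct_integrable; exact: ct_cst.
have -> : fine (mu (B `&` U x)) * g j x = \int[mu]_(y in B `&` U x) g j x.
  by rewrite Rintegral_cst// mulrC.
rewrite -RintegralB//; last exact: iB.
have iD : mu.-integrable (B `&` U x) (EFin \o (fun y => g j y - g j x)).
  apply: (integrableS measurableT) => //; apply: ct_integrable.
  by apply: ctD => //; exact: ct_cst.
apply: le_trans (le_normr_Rintegral _ iD) _ => //.
rewrite -Rintegral_cst//; apply: le_Rintegral => //.
- apply: (integrableS measurableT) => //; apply: ct_integrable.
  by apply: ct_norm; apply: ctD => //; exact: ct_cst.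
- by apply: (integrableS measurableT) => //; apply: ct_integrable; exact: ct_cst.
- by move=> y [_ /hU]; apply.
Qed.

(** The point is the uniformity in [j]: a whole equicontinuous family is integrated with the same
    nodes and weights. *)
Lemma quadrature (J : Type) (g : J -> X -> R) (e : R) :
  (forall j, ct (g j)) ->
  (forall x, \forall y \near x, forall j, `|g j y - g j x| <= e) ->
  exists l : seq (R * X), [/\ forall p, p \in l -> 0 <= p.1, \sum_(p <- l) p.1 = 1
    & forall j, `|\int[mu]_y g j y - \sum_(p <- l) p.1 * g j p.2| <= e].
Proof.
move=> cg eg.
pose U x := [set y | forall j, `|g j y - g j x| <= e]^°.
have [y|s cov] := @finite_cover X X U.
  by exists y; have := open_interior [set z | forall j, `|g j z - g j y| <= e];
    rewrite openE; apply; exact: eg.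
have [y _|l [l0 l1 l2]] := quadrature_cover (s := s) cg (fun x => @open_interior _ _)
    (fun x y (h : U x y) => interior_subset h) (B := setT) (@measurableT _ _).
  exact: cov.
have mu1 : fine (mu [set: borel X]) = 1.
  by transitivity (@fine R 1%E) => //; congr fine; exact: (probability_setT mu).
by exists l; split => //; rewrite ?l1// => j; rewrite -[leRHS]mulr1 -mu1; exact: l2.
Qed.

End quadrature.

(** A finite sum commutes with the integral in [y], and putting it in place of [mu] costs at most
    [e / 2] in each of the two iterated integrals. *)
Lemma fubini_ct {R : realType} {X Y : compactAbGroupType} (mu : probability (borel X) R)
    (nu : probability (borel Y) R) (F : X * Y -> R) : ct F ->
  \int[mu]_x \int[nu]_y F (x, y) = \int[nu]_y \int[mu]_x F (x, y).
Proof.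
move=> cF; apply/eqP; rewrite -subr_eq0 -normr_le0; apply/ler_addgt0Pl => e e0.
rewrite addr0; have e2 : 0 < e / 2 by rewrite divr_gt0.
have cx x' : ct (fun y => F (x', y)).
  apply: (@ct_comp _ _ _ (fun y => (x', y))) => // y.
  by apply: cvg_pair => /=; [exact: cvg_cst|exact: cvg_id].
have cy y' : ct (fun x => F (x, y')).
  apply: (@ct_comp _ _ _ (fun x => (x, y'))) => // x.
  by apply: cvg_pair => /=; [exact: cvg_id|exact: cvg_cst].
have cF' : ct (fun p : Y * X => F (p.2, p.1)).
  apply: (@ct_comp _ _ _ (fun p : Y * X => (p.2, p.1))) => // p.
  by apply: cvg_pair => /=; [exact: cvg_snd|exact: cvg_fst].
(* The index [None] adds the partial integral to the family of sections, so that both iterated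
   integrals share their nodes. *)
pose g (j : option Y) x := if j is Some y then F (x, y) else \int[nu]_y F (x, y).
have [||l [l0 l1 l2]] := quadrature (g := g) mu (e := e / 2).
- by move=> [y|]; [exact: cy|exact: ct_rI].
- move=> x; apply: filterS (near_equicontinuous x cF e2) => x' hx [y|]/=; first exact: hx.
  by rewrite -rIB//; apply: rI_bound => //; apply: ctD => //; exact: ctN.
have := l2 None; rewrite /g => h1.
set S := \sum_(p <- l) _ in h1.
have ES : S = \int[nu]_y (\sum_(p <- l) p.1 * F (p.2, y)).
  rewrite rI_sum => [|p]; last by apply: ctM => //; exact: ct_cst.
  by apply: eq_bigr => p _; rewrite rIZ.
rewrite (splitr e); apply: le_trans (ler_distD S _ _) _.
rewrite lerD// distrC ES -rIB; last 2 first.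
- exact: (@ct_rI _ _ mu _ _ cF').
- by apply: ct_sum => p; apply: ctM => //; exact: ct_cst.
apply: rI_bound; last by move=> y; exact: (l2 (Some y)).
apply: ctD; first exact: (@ct_rI _ _ mu _ _ cF').
by apply: ctN; apply: ct_sum => p; apply: ctM => //; exact: ct_cst.
Qed.

Section haar.
Context {R : realType} {X : compactAbGroupType}.
Variable mu : probability (borel X) R.
Hypothesis haar : is_haar mu.

Lemma translation_continuous (a : X) : continuous (fun x : X => a + x).
Proof.
move=> x; apply: (@continuous_comp _ _ _ (fun x => (a, x)) (fun p : X * X => p.1 + p.2)).
  by apply: cvg_pair => /=; [exact: cvg_cst|exact: cvg_id].
exact: add_continuous.
Qed.

Lemma continuous_measurable_borel (Y : compactAbGroupType) (u : X -> Y) :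
  continuous u -> measurable_fun [set: borel X] (u : borel X -> borel Y).
Proof.
move=> cu; apply: (measurability (@open Y : set (set (borel Y)))) => //.
move=> _ [A oA <-]; rewrite setTI; apply: open_measurable_borel.
by move/continuousP : cu; apply.
Qed.

Lemma rI_translate (a : X) (f : X -> R) : ct f -> \int[mu]_x f (a + x) = \int[mu]_x f x.
Proof.
move=> cf; have mT := continuous_measurable_borel (@translation_continuous a).
have cT : ct (fun x => f (a + x)) by apply: ct_comp => //; exact: translation_continuous.
pose u : borel X -> borel X := fun x : X => (a + x : X).
congr fine; transitivity (\int[pushforward mu u]_x (f x)%:E)%E.
  rewrite integral_pushforward//.
  - by apply/measurable_EFinP; exact: ct_measurable.
  - exact: (ct_integrable mu cT).
apply: eq_measure_integral => A mA _; rewrite /= /pushforward.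
(* [is_haar] speaks of images; the preimage of [A] under translation by [a] is its image under
   translation by [- a]. *)
case: haar => /(_ (- a) A mA) <- _; congr (mu _).
apply/seteqP; split => [x Ax|_ [x Ax <-]].
  by exists (u x) => //; rewrite /u addrA addNr add0r.
by rewrite /preimage /u/= addrA subrr add0r.
Qed.

(** Haar measure has full support: if [f a > 0], finitely many translates of [f] add up to a
    function that stays above [f a / 2], although each of them has integral 0. *)
Lemma rI_eq0 (f : X -> R) : ct f -> (forall x, 0 <= f x) -> \int[mu]_x f x = 0 ->
  forall x, f x = 0.
Proof.
move=> cf f0 If a; apply/eqP/negPn/negP => fa.
have {fa} fa : 0 < f a by rewrite lt_neqAle eq_sym fa f0.
pose V x := [set y | f a / 2 < f (x + y)].
have cV x : ct (fun y => f (x + y)) by apply: ct_comp => //; exact: translation_continuous.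
have [y|D' cov] := @finite_cover X X V.
  exists (a - y); apply: (@ct_at _ _ _ y (cV (a - y)) [set t | f a / 2 < t]).
  apply: open_nbhs_nbhs; split; first exact: open_gt.
  by rewrite /= subrK ltr_pdivrMr// mulr_natr mulr2n ltrDl.
have : \int[mu]_y (\sum_(x <- D') f (x + y)) = 0.
  by rewrite rI_sum// big1// => x _; rewrite rI_translate.
have : \int[mu]_y (f a / 2) <= \int[mu]_y (\sum_(x <- D') f (x + y)).
  apply: rI_le; [exact: ct_cst|exact: ct_sum|move=> y].
  have [x xD Vy] := cov y.
  rewrite (big_rem x)//= -[leLHS]addr0 lerD ?sumr_ge0// ltW//.
by rewrite rI_cst => /[swap] ->; apply/negP; rewrite -ltNge divr_gt0.
Qed.

End haar.

(** The family may be infinite, so minimality replaces induction. Let [U] be a nonzero common stable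
    subspace of least rank. The part of [U] in an eigenspace of [A b] is stable by commutation,
    hence is all of [U] once it is nonzero; every row of [U] is thus an eigenvector of every
    [A b]. *)
Lemma common_eigenvector_family {C : numClosedFieldType} (T : Type) n (A : T -> 'M[C]_n) :
  (0 < n)%N -> (forall a b, A a *m A b = A b *m A a) ->
  exists2 v : 'rV_n, v != 0 & forall a, exists c, v *m A a = c *: v.
Proof.
move=> n0 cA.
pose Q r := `[< exists U : 'M[C]_n, [/\ U != 0, forall a, stablemx U (A a) & \rank U = r] >].
have exQ : exists r, Q r.
  exists n; apply/asboolP; exists 1%:M; split; rewrite ?mxrank1//.
    by rewrite -mxrank_eq0 mxrank1 -lt0n.
  by move=> a; rewrite submx1.
case: (ex_minnP exQ) => r /asboolP[U [U0 sU rU]] rmin.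
have [i Ui] : exists i, row i U != 0.
  apply/existsP; apply: contraNT U0; rewrite negb_exists => /forallP h.
  by apply/eqP/row_matrixP => i; rewrite row0; apply/eqP; move: (h i); rewrite negbK.
exists (row i U) => // b.
have rU0 : (0 < \rank U)%N by rewrite lt0n mxrank_eq0.
have [v0 v00] := @common_eigenvector C _ [:: restrictmx U (A b)] rU0
  (fun X Y (hX : X \in [:: _]) (hY : Y \in [:: _]) =>
    ltac:(by move: hX hY; rewrite !inE => /eqP-> /eqP->)).
rewrite /= andbT stablemx_restrict// => /eigenvectorP[c hv].
exists c; pose W := (U :&: eigenspace (A b) c)%MS.
have W0 : W != 0.
  rewrite -mxrank_eq0 -lt0n; apply: (@leq_trans (\rank (v0 *m row_base U))).
    by rewrite lt0n mxrank_eq0 mulmx_free_eq0 ?row_base_free.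
  apply: mxrankS; rewrite sub_capmx hv andbT.
  by rewrite (submx_trans (submxMl _ _)) ?eq_row_base.
have sW a : stablemx W (A a).
  rewrite sub_capmx (submx_trans (submxMr _ (capmxSl _ _)) (sU a)) /=.
  apply: submx_trans (submxMr _ (capmxSr _ _)) _.
  by apply: comm_mx_stable_eigenspace; exact: cA.
have WU : (U <= W)%MS.
  have := rmin (\rank W); have -> : Q (\rank W) by apply/asboolP; exists W.
  move=> /(_ isT); rewrite -rU => rk.
  by rewrite -(geq_leqif (mxrank_leqif_sup (capmxSl U (eigenspace (A b) c)))).
have : (row i U <= eigenspace (A b) c)%MS.
  by rewrite (submx_trans (row_sub _ _)) ?(submx_trans WU) ?capmxSr.
by move/eigenspaceP.
Qed.

Section complex_lemmas.
Context {R : realType}.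
Implicit Types z w : R[i].

Lemma ReB z w : complex.Re (z - w) = complex.Re z - complex.Re w.
Proof. by case: z w => a b [c d]. Qed.
Lemma ImB z w : complex.Im (z - w) = complex.Im z - complex.Im w.
Proof. by case: z w => a b [c d]. Qed.
Lemma ReD z w : complex.Re (z + w) = complex.Re z + complex.Re w.
Proof. by case: z w => a b [c d]. Qed.
Lemma ImD z w : complex.Im (z + w) = complex.Im z + complex.Im w.
Proof. by case: z w => a b [c d]. Qed.
Lemma complexDE (a b c d : R) : a +i* b + (c +i* d) = (a + c) +i* (b + d).
Proof. by []. Qed.
Lemma complexME (a b c d : R) : (a +i* b) * (c +i* d) = (a * c - b * d) +i* (a * d + b * c).
Proof. by []. Qed.
Lemma normc_conj z : normc z^* = normc z.
Proof. by rewrite -[z^*]/(conjc z); case: z => a b; rewrite /= sqrrN. Qed.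
Lemma normcR (x : R) : normc x%:C = `|x|.
Proof. by rewrite /= expr0n/= addr0 sqrtr_sqr. Qed.
Lemma mulcJ z : z * z^* = (normc z ^+ 2)%:C.
Proof.
by rewrite -sqr_normc (rmorphXn (real_complex R)).
Qed.
Lemma Re_mulJc z : complex.Re (z^* * z) = normc z ^+ 2.
Proof. by rewrite mulrC mulcJ. Qed.
Lemma normc_eq0 z : (normc z == 0) = (z == 0).
Proof. by apply/eqP/eqP => [/eq0_normc//|->]; exact: normc0. Qed.
Lemma normc_prod (I : Type) (s : seq I) (P : pred I) (h : I -> R[i]) :
  normc (\prod_(i <- s | P i) h i) = \prod_(i <- s | P i) normc (h i).
Proof.
elim: s => [|i s IH]; first by rewrite !big_nil normc1.
by rewrite !big_cons; case: (P i) => //; rewrite normcM IH.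
Qed.
Lemma mulcJ1 z : normc z = 1 -> z * z^* = 1.
Proof. by rewrite mulcJ => ->; rewrite expr1n. Qed.
Lemma conjCR (t : R) : (t%:C)^* = t%:C.
Proof. exact: conjc_real. Qed.
Lemma conjcM z w : (z * w)^* = z^* * w^*. Proof. exact: (rmorphM (@Num.conj R[i])). Qed.
Lemma conjc_sum (I : Type) (s : seq I) (P : pred I) (h : I -> R[i]) :
  (\sum_(i <- s | P i) h i)^* = \sum_(i <- s | P i) (h i)^*.
Proof. exact: (rmorph_sum (@Num.conj R[i])). Qed.
End complex_lemmas.

Definition cI {R : realType} {X : compactAbGroupType} (mu : probability (borel X) R)
  (F : X -> R[i]) : R[i] :=
  (\int[mu]_x complex.Re (F x)) +i* (\int[mu]_x complex.Im (F x)).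

Section complex_integral.
Context {R : realType} {X : compactAbGroupType}.
Variable mu : probability (borel X) R.
Implicit Types F H : X -> R[i].

Lemma eq_cI F H : F =1 H -> cI mu F = cI mu H.
Proof. by move=> FH; congr cI; apply/funext. Qed.

Lemma cID F H : cct F -> cct H -> cI mu (fun x => F x + H x) = cI mu F + cI mu H.
Proof.
move=> cF cH; rewrite /cI complexDE -!rID; cts.
by congr (_ +i* _); apply: eq_Rintegral => x _; rewrite ?ReD ?ImD.
Qed.

Lemma cIZ c F : cct F -> cI mu (fun x => c * F x) = c * cI mu F.
Proof.
move=> cF; rewrite /cI; case: c => a b; rewrite complexME.
rewrite -!rIZ; cts; rewrite -rIB; cts; rewrite -rID; cts.
by congr (_ +i* _); apply: eq_Rintegral => x _; case: (F x) => u v; rewrite complexME.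
Qed.

Lemma cI_real (f : X -> R) : cI mu (fun x => (f x)%:C) = (\int[mu]_x f x)%:C.
Proof. by rewrite /cI /= rI_cst. Qed.

Lemma cI_cst c : cI mu (fun=> c) = c.
Proof. by case: c => a b; rewrite /cI /= !rI_cst. Qed.

Lemma cIN F : cct F -> cI mu (fun x => - F x) = - cI mu F.
Proof.
by move=> cF; rewrite -mulN1r -(cIZ _ cF); apply: eq_cI => x; rewrite mulN1r.
Qed.

Lemma cIB F H : cct F -> cct H -> cI mu (fun x => F x - H x) = cI mu F - cI mu H.
Proof. by move=> cF cH; rewrite (cID cF (cctN cH)) (cIN cH). Qed.

Lemma cIJ F : cct F -> cI mu (fun x => (F x)^*) = (cI mu F)^*.
Proof.
move=> cF; rewrite -[RHS]/(conjc (cI mu F)) /cI /= -(rIN mu (cct_Im cF)).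
by congr (_ +i* _); apply: eq_Rintegral => x _; rewrite -[(F x)^*]/(conjc (F x)); case: (F x).
Qed.

Lemma cI_sum (I : Type) (s : seq I) (P : pred I) (h : I -> X -> R[i]) :
  (forall i, cct (h i)) ->
  cI mu (fun x => \sum_(i <- s | P i) h i x) = \sum_(i <- s | P i) cI mu (h i).
Proof.
move=> ch; elim: s => [|i s IH].
  rewrite big_nil -[RHS]cI_cst; apply: eq_cI => x; by rewrite big_nil.
rewrite big_cons -IH; case: (boolP (P i)) => Pi.
  rewrite -(cID (ch i) (@cct_sum _ _ _ s P h ch)).
  by apply: eq_cI => x; rewrite big_cons Pi.
by apply: eq_cI => x; rewrite big_cons (negbTE Pi).
Qed.

(** The factor [z^*] turns the integral [z] onto the positive real axis, where comparing real parts
    suffices. *)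
Lemma normc_cI F : cct F -> normc (cI mu F) <= \int[mu]_x normc (F x).
Proof.
move=> cF; set z := cI mu F.
have [->|z0] := eqVneq z 0; first by rewrite normc0 rI_ge0// => x; exact: normc_ge0.
have nz : 0 < normc z by rewrite lt_neqAle eq_sym normc_eq0 z0 normc_ge0.
have : complex.Re (cI mu (fun x => z^* * F x)) <= \int[mu]_x normc (z^* * F x).
  rewrite /cI/=; apply: rI_le; cts.
  by move=> x; apply: le_trans (ler_norm _) (normc_Re _).
have -> : cI mu (fun x => z^* * F x) = z^* * z := cIZ z^* cF.
rewrite Re_mulJc.
under eq_Rintegral do rewrite normcM normc_conj.
rewrite rIZ; cts.
by rewrite expr2 ler_pM2l.
Qed.

Lemma normc_cI_bound F M : cct F -> (forall x, normc (F x) <= M) -> normc (cI mu F) <= M.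
Proof.
move=> cF h; apply: le_trans (normc_cI cF) _; rewrite -[leRHS](rI_cst mu).
by apply: rI_le; cts.
Qed.

Lemma cct_cI (T : topologicalType) (F : T * X -> R[i]) :
  cct F -> cct (fun x => cI mu (fun y => F (x, y))).
Proof.
move=> cF; apply: cct_ReIm => /=.
  by apply: (@ct_rI _ _ mu _ (fun p => complex.Re (F p))); cts.
by apply: (@ct_rI _ _ mu _ (fun p => complex.Im (F p))); cts.
Qed.

Lemma cct_bounded F : cct F -> exists M, forall x, normc (F x) <= M.
Proof.
move=> /cct_normc /ct_bounded [M hM]; exists M => x.
by apply: le_trans (hM x); exact: ler_norm.
Qed.

Lemma near_equicontinuous_c (T : topologicalType) (F : T * X -> R[i]) (x0 : T) (e : R) :
  cct F -> 0 < e -> \forall x \near x0, forall y, normc (F (x, y) - F (x0, y)) <= e.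
Proof.
move=> cF e0; have e2 : 0 < e / 2 by rewrite divr_gt0.
have H1 := near_equicontinuous x0 (cct_Re cF) e2.
have H2 := near_equicontinuous x0 (cct_Im cF) e2.
apply: filterS2 H1 H2 => x H1 H2 y; apply: le_trans (normc_le _) _.
rewrite (splitr e) lerD//.
  by move: (H1 y); case: (F _) (F _) => a b [c d].
by move: (H2 y); case: (F _) (F _) => a b [c d].
Qed.

Hypothesis haar : is_haar mu.

Lemma cI_translate (a : X) F : cct F -> cI mu (fun x => F (a + x)) = cI mu F.
Proof.
move=> cF; rewrite /cI.
rewrite (rI_translate haar a (cct_Re cF)).
by rewrite (rI_translate haar a (cct_Im cF)).
Qed.

End complex_integral.

Lemma fubini_cct {R : realType} {X Y : compactAbGroupType} (mu : probability (borel X) R)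
    (nu : probability (borel Y) R) (F : X * Y -> R[i]) : cct F ->
  cI mu (fun x => cI nu (fun y => F (x, y))) = cI nu (fun y => cI mu (fun x => F (x, y))).
Proof.
move=> cF; rewrite /cI/=.
rewrite (fubini_ct mu nu (cct_Re cF)).
by rewrite (fubini_ct mu nu (cct_Im cF)).
Qed.

(** * Inner products of continuous functions: Bessel and Cauchy-Schwarz *)

Section inner_product.
Context {R : realType} {X : compactAbGroupType}.
Variable mu : probability (borel X) R.
Implicit Types F H : X -> R[i].

Definition ip F H : R[i] := cI mu (fun x => F x * (H x)^*).
Definition N2 F : R := \int[mu]_x (normc (F x) ^+ 2).

Lemma ipxx F : ip F F = (N2 F)%:C.
Proof. by rewrite -cI_real; apply: eq_cI => x; rewrite mulcJ. Qed.
Lemma N2_ge0 F : 0 <= N2 F.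
Proof. by apply: rI_ge0 => x; rewrite sqr_ge0. Qed.
Lemma ipC F H : cct F -> cct H -> ip H F = (ip F H)^*.
Proof.
move=> cF cH; apply: (etrans _ (cIJ mu (cctM cF (cctJ cH)))).
by apply: eq_cI => x /=; rewrite conjcM conjCK mulrC.
Qed.
Lemma ipDl F1 F2 H : cct F1 -> cct F2 -> cct H ->
  ip (fun x => F1 x + F2 x) H = ip F1 H + ip F2 H.
Proof.
move=> c1 c2 cH; apply: (etrans _ (cID mu (cctM c1 (cctJ cH)) (cctM c2 (cctJ cH)))).
by apply: eq_cI => x /=; rewrite mulrDl.
Qed.
Lemma ipZl c F H : cct F -> cct H -> ip (fun x => c * F x) H = c * ip F H.
Proof.
move=> cF cH; apply: (etrans _ (cIZ mu c (cctM cF (cctJ cH)))).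
by apply: eq_cI => x /=; rewrite mulrA.
Qed.
Lemma ip_suml (I : Type) (s : seq I) (h : I -> X -> R[i]) H :
  (forall i, cct (h i)) -> cct H ->
  ip (fun x => \sum_(i <- s) h i x) H = \sum_(i <- s) ip (h i) H.
Proof.
move=> ch cH; apply: (etrans _ (@cI_sum _ _ mu I s predT _ (fun i => cctM (ch i) (cctJ cH)))).
by apply: eq_cI => x /=; rewrite mulr_suml.
Qed.
Lemma ipZr c F H : cct F -> cct H -> ip F (fun x => c * H x) = c^* * ip F H.
Proof.
move=> cF cH; apply: (etrans _ (cIZ mu c^* (cctM cF (cctJ cH)))).
by apply: eq_cI => x /=; rewrite conjcM mulrCA.
Qed.
Lemma ip_sumr (I : Type) (s : seq I) (h : I -> X -> R[i]) F :
  (forall i, cct (h i)) -> cct F ->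
  ip F (fun x => \sum_(i <- s) h i x) = \sum_(i <- s) ip F (h i).
Proof.
move=> ch cH; apply: (etrans _ (@cI_sum _ _ mu I s predT _ (fun i => cctM cH (cctJ (ch i))))).
by apply: eq_cI => x /=; rewrite conjc_sum mulr_sumr.
Qed.
Lemma N2B F H : cct F -> cct H ->
  N2 (fun x => F x - H x) = N2 F - 2 * complex.Re (ip F H) + N2 H.
Proof.
move=> cF cH; rewrite /N2 /ip /cI /= -rIZ; cts.
rewrite -rIB; cts; rewrite -rID; cts.
apply: eq_Rintegral => x _; case: (F x) (H x) => a b [c d] /=.
by rewrite !sqr_sqrtr ?addr_ge0 ?sqr_ge0//; ring.
Qed.
Lemma N2Z c F : cct F -> N2 (fun x => c * F x) = normc c ^+ 2 * N2 F.
Proof.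
move=> cF; rewrite /N2 -rIZ; cts.
by apply: eq_Rintegral => x _; rewrite normcM exprMn.
Qed.

Lemma bessel (I : eqType) (e : I -> X -> R[i]) (s : seq I) F :
  uniq s -> (forall i, i \in s -> cct (e i)) -> cct F ->
  {in s &, forall i j, ip (e i) (e j) = (i == j)%:R} ->
  \sum_(i <- s) normc (ip F (e i)) ^+ 2 <= N2 F.
Proof.
move=> us ce0 cF oe.
(* The summation lemmas ask for continuity at every index, hence the value 0 outside [s]. *)
pose e' i := if i \in s then e i else fun=> 0.
have ce i : cct (e' i) by rewrite /e'; case: ifP => [/ce0//|_]; exact: cct_cst.
have ee i : i \in s -> e' i = e i by rewrite /e' => ->.
pose c i := ip F (e i).
pose S x := \sum_(i <- s) c i * e' i x.
have cS : cct S by apply: cct_sum => i; cts.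
have FS : ip F S = (\sum_(i <- s) normc (c i) ^+ 2)%:C.
  rewrite ip_sumr; [|by move=> i; cts|by []].
  rewrite (rmorph_sum (real_complex R)) big_seq [RHS]big_seq; apply: eq_bigr => i si.
  by rewrite ipZr// ee// mulrC -/(c i) mulcJ.
have SS : ip S S = (\sum_(i <- s) normc (c i) ^+ 2)%:C.
  rewrite ip_suml; [|by move=> i; cts|by []].
  rewrite (rmorph_sum (real_complex R)) big_seq [RHS]big_seq; apply: eq_bigr => i si.
  rewrite ipZl// ip_sumr//; last by move=> j; cts.
  rewrite (bigD1_seq i)//= big_seq_cond big1 => [|j /andP[js ji]].
    by rewrite addr0 ipZr// ee// oe// eqxx mulr1 mulcJ.
  by rewrite ipZr// !ee// oe// eq_sym (negbTE ji) mulr0.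
have := N2_ge0 (fun x => F x - S x); rewrite N2B// FS/=.
have := SS; rewrite ipxx => -[->].
by rewrite -/c; lra.
Qed.

Lemma cauchy_schwarz F H : cct F -> cct H -> normc (ip F H) ^+ 2 <= N2 F * N2 H.
Proof.
move=> cF cH.
(* Positivity of the squared norm of [F - t <F,H> H]. It is used at [t = 1 / N2 H], or at a large
   [t] when [N2 H = 0]. *)
have key t : 2 * t * normc (ip F H) ^+ 2 <= N2 F + t ^+ 2 * normc (ip F H) ^+ 2 * N2 H.
  have := N2_ge0 (fun x => F x - (t%:C * ip F H) * H x).
  rewrite N2B; cts; rewrite N2Z// ipZr// conjcM -mulrA.
  rewrite [_^* * ip F H]mulrC mulcJ normcM normcR exprMn real_normK ?num_real//.
  by rewrite conjCR -(rmorphM (real_complex R)) /=; lra.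
have [H0|H0] := eqVneq (N2 H) 0.
  rewrite H0 mulr0; move: key; rewrite H0; set a := _ ^+ 2 => key.
  rewrite leNgt; apply/negP => a0.
  have := key ((N2 F + 1) / a); rewrite mulr0 addr0 -mulrA mulfVK ?gt_eqF//.
  by have := N2_ge0 F; lra.
have Hp : 0 < N2 H by rewrite lt_neqAle eq_sym H0 N2_ge0.
have := key (N2 H)^-1; rewrite exprVn.
set a := normc _ ^+ 2 => h.
rewrite -ler_pdivrMr//.
have -> : a / N2 H = 2 * (N2 H)^-1 * a - (N2 H) ^- 2 * a * N2 H by field.
by rewrite lerBlDr.
Qed.

Lemma normc_ip_le F H : cct F -> cct H -> normc (ip F H) <= Num.sqrt (N2 F) * Num.sqrt (N2 H).
Proof.
move=> cF cH; rewrite -sqrtrM ?N2_ge0// -(@ger0_norm _ (normc _)) ?normc_ge0//.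
by rewrite -sqrtr_sqr ler_wsqrtr// cauchy_schwarz.
Qed.

End inner_product.

Lemma normcD3 {R : realType} (a b c : R[i]) :
  normc (a + (b + c)) <= normc a + (normc b + normc c).
Proof. by apply: le_trans (normcD _ _) _; rewrite lerD2l normcD. Qed.

(** An ultrafilter finer than [\oo] gives all pointwise limits at once, in place of a diagonal
    extraction. Equicontinuity passes to the limit, and a finite cover makes the convergence
    uniform. A cluster point only offers closeness for arbitrarily late [n], which is the form of
    the conclusion. *)
Lemma ascoli_cluster {R : realType} {X : compactAbGroupType} (u : nat -> X -> R[i]) (M : R) :
  (forall n x, normc (u n x) <= M) ->
  (forall x0 e, 0 < e -> \forall x \near x0, forall n, normc (u n x - u n x0) <= e) ->
  exists2 g, cct g & forall e N, 0 < e -> exists2 n, (N <= n)%N &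
    forall x, normc (u n x - g x) <= e.
Proof.
move=> uM ue.
have [U [UU noU]] := @ultraFilterLemma nat \oo _.
have UF : ProperFilter U by exact: ultra_proper.
have lim1 (v : nat -> R) : (forall n, `|v n| <= M) ->
    exists l, forall e, 0 < e -> U [set n | `|v n - l| <= e].
  move=> vM; pose F := [set A : set R | U (v @^-1` A)].
  have FF : ProperFilter F.
    split; first by rewrite /F/= preimage_set0; exact: filter_not_empty.
    split; first by rewrite /F/= preimage_setT; exact: filterT.
      by move=> A B FA FB; rewrite /F/= preimage_setI; exact: filterI.
    by move=> A B AB; apply: filterS => n; exact: AB.
  have [|l [_ lF]] := @segment_compact R (- M) M F FF.
    by rewrite /F/=; apply: filterS filterT => n _ /=; rewrite in_itv/= -ler_norml.
  exists l => e e0.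
  have [//|h] := in_ultra_setVsetC [set n | `|v n - l| <= e] UU.
  have FA : U [set n | e < `|v n - l|].
    by apply: filterS h => n hn; rewrite /= ltNge; apply/negP => h'; apply: hn.
  have nl : nbhs l [set t | `|t - l| <= e].
    by apply/nbhs_ballP; exists e => // t; rewrite /ball/= distrC => /ltW.
  have [t [/= t1]] := lF [set t | e < `|t - l|] _ FA nl.
  by rewrite leNgt t1.
have /choice[g hg] : forall x, exists l : R[i], forall e, 0 < e ->
    U [set n | normc (u n x - l) <= e].
  move=> x.
  have [a ha] := lim1 (fun n => complex.Re (u n x)) (fun n => le_trans (normc_Re _) (uM n x)).
  have [b hb] := lim1 (fun n => complex.Im (u n x)) (fun n => le_trans (normc_Im _) (uM n x)).
  exists (a +i* b) => e e0; have e2 : 0 < e / 2 by rewrite divr_gt0.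
  apply: filterS2 (ha _ e2) (hb _ e2) => n h1 h2.
  apply: (le_trans (normc_le (u n x - (a +i* b)))).
  by rewrite ReB ImB (splitr e) lerD.
have ge x0 e : 0 < e -> \forall x \near x0, normc (g x - g x0) <= e.
  move=> e0; apply: filterS (ue x0 e e0) => x hx; apply/ler_addgt0Pl => d d0.
  have d2 : 0 < d / 2 by rewrite divr_gt0.
  have [n [/= h1 h2]] := filter_ex (filterI (hg x _ d2) (hg x0 _ d2)).
  have -> : g x - g x0 = (g x - u n x) + ((u n x - u n x0) + (u n x0 - g x0)) by ring.
  apply: le_trans (normcD3 _ _ _) _; move: h1; rewrite -normcN opprB => h1.
  by have := hx n; lra.
exists g.
  apply/cctP => x e e0; have e2 : 0 < e / 2 by rewrite divr_gt0.
  apply: filterS (ge x _ e2) => y h; rewrite -normcN opprB.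
  by apply: le_lt_trans h _; rewrite ltr_pdivrMr// mulr_natr mulr2n ltrDl.
move=> e N e0; have e3 : 0 < e / 3 by rewrite divr_gt0.
have [x0|s cov] := @finite_cover X X (fun x0 x => (forall n, normc (u n x - u n x0) <= e / 3) /\
    normc (g x - g x0) <= e / 3).
  by exists x0; apply: filterI; [exact: ue|exact: ge].
have Us : U [set n | forall x, x \in s -> normc (u n x - g x) <= e / 3].
  elim: s {cov} => [|x s IH]; first by apply: filterS filterT.
  apply: filterS2 (hg x _ e3) IH => n /= h1 h2 y; rewrite inE => /orP[/eqP->//|]; exact: h2.
have UN : U [set n | (N <= n)%N] by apply: noU; exists N.
have [n [/= h1 h2]] := filter_ex (filterI Us UN).
exists n => // x; have [x0 xs [hu hgx]] := cov x.
have -> : u n x - g x = (u n x - u n x0) + ((u n x0 - g x0) + (g x0 - g x)) by ring.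
apply: le_trans (normcD3 _ _ _) _; have := h1 _ xs; have := hu n.
by move: hgx; rewrite -normcN opprB; lra.
Qed.

(** * Uniqueness of Fourier coefficients *)

Section convolution.
Context {R : realType} {X : compactAbGroupType}.
Variable mu : probability (borel X) R.
Hypothesis haar : is_haar mu.
Implicit Types f g h : X -> R[i].

(** With the kernel [h (y - x)], the value at 0 of the image of a character [g] is the Fourier
    coefficient of [h] at the conjugate of [g], which [convol_character] exploits. *)
Definition convol h f (x : X) : R[i] := cI mu (fun y => h (y - x) * f y).
Definition adj h (z : X) : R[i] := (h (- z))^*.
Local Notation T := convol.

Lemma cct_adj h : cct h -> cct (adj h).
Proof. by move=> ch; apply: cctJ; apply: (cct_comp _ ch); exact: opp_continuous. Qed.
Lemma adjK h : adj (adj h) = h.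
Proof. by apply/funext => x; rewrite /adj conjCK opprK. Qed.

Lemma sub_fst_continuous : continuous (fun p : X * X => p.2 - p.1).
Proof.
move=> p; apply: (@continuous_comp _ _ _ (fun p : X * X => (p.2, p.1)) (fun p : X * X => p.1 - p.2)).
  by apply: cvg_pair => /=; [exact: cvg_snd|exact: cvg_fst].
exact: sub_continuous.
Qed.

Lemma cct_subr h x : cct h -> cct (fun y => h (y - x)).
Proof.
move=> ch; apply: (@cct_comp _ _ _ (fun y => y - x)) => // y.
apply: (@continuous_comp _ _ _ (fun y => (y, x)) (fun p : X * X => p.1 - p.2)).
  by apply: cvg_pair => /=; [exact: cvg_id|exact: cvg_cst].
exact: sub_continuous.
Qed.
Lemma cct_addr h x : cct h -> cct (fun y => h (y + x)).
Proof. by move=> ch; have := cct_subr (- x) ch; rewrite opprK. Qed.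

Lemma cct_kernel h : cct h -> cct (fun p : X * X => h (p.2 - p.1)).
Proof. by move=> ch; apply: (cct_comp sub_fst_continuous ch). Qed.

Lemma cct_convol_body h f : cct h -> cct f -> cct (fun p : X * X => h (p.2 - p.1) * f p.2).
Proof.
move=> ch cf; apply: cctM; first exact: cct_kernel.
by apply: (cct_comp _ cf) => p; exact: cvg_snd.
Qed.

Lemma cct_convol h f : cct h -> cct f -> cct (T h f).
Proof. by move=> ch cf; apply: (cct_cI mu (cct_convol_body ch cf)). Qed.

Lemma convolD h f g x : cct h -> cct f -> cct g -> T h (fun y => f y + g y) x = T h f x + T h g x.
Proof.
move=> ch cf cg; have chx := cct_subr x ch.
apply: (etrans _ (cID mu (cctM chx cf) (cctM chx cg))).
by apply: eq_cI => y; rewrite mulrDr.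
Qed.
Lemma convolZ h c f x : cct h -> cct f -> T h (fun y => c * f y) x = c * T h f x.
Proof.
move=> ch cf; have chx := cct_subr x ch.
apply: (etrans _ (cIZ mu c (cctM chx cf))).
by apply: eq_cI => y; rewrite mulrCA.
Qed.
Lemma convolB h f g x : cct h -> cct f -> cct g -> T h (fun y => f y - g y) x = T h f x - T h g x.
Proof.
move=> ch cf cg; have chx := cct_subr x ch.
apply: (etrans _ (cIB mu (cctM chx cf) (cctM chx cg))).
by apply: eq_cI => y; rewrite mulrBr.
Qed.
(** This commutation is what makes the eigenspaces invariant under translation. *)
Lemma convol_translate h f a x : cct h -> cct f ->
  T h (fun y => f (y + a)) x = T h f (x + a).
Proof.
move=> ch cf.
have := cI_translate haar a (cctM (cct_subr (x + a) ch) cf).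
rewrite -/(T h f (x + a)) => <-; apply: eq_cI => y.
by rewrite [a + y]addrC; congr (h _ * _); rewrite opprD addrACA subrr addr0.
Qed.

Lemma ip_convol h f g : cct h -> cct f -> cct g ->
  ip mu (T h f) g = ip mu f (T (adj h) g).
Proof.
move=> ch cf cg.
pose F (p : X * X) := h (p.2 - p.1) * f p.2 * (g p.1)^*.
have cF : cct F.
  apply: cctM; first exact: cct_convol_body.
  by apply: cctJ; apply: (cct_comp _ cg) => p; exact: cvg_fst.
transitivity (cI mu (fun x => cI mu (fun y => F (x, y)))).
  apply: eq_cI => x; rewrite mulrC.
  apply: (esym (etrans _ (cIZ mu (g x)^* (cctM (cct_subr x ch) cf)))).
  by apply: eq_cI => y; rewrite /F mulrC.
rewrite (fubini_cct mu mu cF); apply: eq_cI => y.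
have cag := cctM (cct_subr y (cct_adj ch)) cg.
rewrite -(cIJ mu cag).
apply: (etrans _ (cIZ mu (f y) (cctJ cag))).
apply: eq_cI => x; rewrite /F /adj conjcM conjCK opprB /=.
by rewrite [h _ * f y]mulrC mulrA.
Qed.

Lemma convol_ip h f x : T h f x = ip mu f (fun y => (h (y - x))^*).
Proof. by apply: eq_cI => y; rewrite conjCK mulrC. Qed.

Lemma N2_le1 f M : cct f -> 0 <= M -> (forall x, normc (f x) <= M) -> N2 mu f <= M ^+ 2.
Proof.
move=> cf M0 fM; rewrite /N2 -[leRHS](rI_cst mu); apply: rI_le; cts.
by move=> x; rewrite ler_pXn2r// nnegrE normc_ge0.
Qed.

Lemma convol_bound h f M x : cct h -> cct f -> 0 <= M -> (forall y, normc (h (y - x)) <= M) ->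
  normc (T h f x) <= M * Num.sqrt (N2 mu f).
Proof.
move=> ch cf M0 hM; have chx := cctJ (cct_subr x ch).
rewrite convol_ip; apply: le_trans (normc_ip_le mu cf chx) _.
rewrite mulrC ler_wpM2r ?sqrtr_ge0// -[leRHS](ger0_norm M0) -sqrtr_sqr ler_wsqrtr//.
by apply: N2_le1 => // y; rewrite normc_conj.
Qed.

(** Together with [convol_bound] this is the compactness of the operator: the L^2 unit ball is sent
    to a bounded equicontinuous set, to which [ascoli_cluster] applies. *)
Lemma convol_equi h f e : cct h -> cct f -> 0 < e -> N2 mu f <= 1 ->
  forall x x0, (forall y, normc (h (y - x) - h (y - x0)) <= e) ->
  normc (T h f x - T h f x0) <= e.
Proof.
move=> ch cf e0 f1 x x0 he.
have c1 := cct_subr x ch; have c2 := cct_subr x0 ch.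
have -> : T h f x - T h f x0 = ip mu f (fun y => (h (y - x) - h (y - x0))^*).
  apply: (etrans (esym (cIB mu (cctM c1 cf) (cctM c2 cf)))).
  by apply: eq_cI => y; rewrite conjCK -mulrBl mulrC.
apply: le_trans (normc_ip_le mu cf (cctJ (cctD c1 (cctN c2)))) _.
rewrite -[leRHS]mul1r ler_pM ?sqrtr_ge0//.
  by rewrite -[leRHS]sqrtr1 ler_wsqrtr.
rewrite -[leRHS](ger0_norm (ltW e0)) -sqrtr_sqr ler_wsqrtr//.
apply: N2_le1 => //; first exact: (cctJ (cctD c1 (cctN c2))).
  exact: ltW.
by move=> y; rewrite normc_conj.
Qed.

End convolution.

Lemma le0_of_small {R : realFieldType} (a C : R) : 0 <= C ->
  (forall e, 0 < e -> a <= C * e) -> a <= 0.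
Proof.
move=> C0 h; apply/ler_addgt0Pl => d d0; rewrite addr0.
have C1 : 0 < C + 1 by rewrite ltr_wpDl.
apply: le_trans (h (d / (C + 1)) _) _; first by rewrite divr_gt0.
by rewrite mulrA ler_pdivrMr// mulrC ler_wpM2l ?ltW// ltrDl.
Qed.

Lemma invn_small {R : realType} (d : R) : 0 < d ->
  exists N, forall n, (N <= n)%N -> n.+1%:R^-1 <= d.
Proof.
move=> d0; exists (Num.truncn d^-1) => n Nn.
rewrite -[d]invrK lef_pV2 ?posrE ?invr_gt0// ltW//.
by apply: lt_le_trans (truncnS_gt _) _; rewrite ler_nat ltnS.
Qed.

Lemma bounded_powers {R : realType} (a B : R) : (forall n, a ^+ n <= B) -> a <= 1.
Proof.
move=> h; rewrite leNgt; apply/negP => a1.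
have bern n : 1 + n%:R * (a - 1) <= a ^+ n.
  elim: n => [|n IH]; first by rewrite mul0r addr0.
  rewrite exprS; apply: (@le_trans _ _ (a * (1 + n%:R * (a - 1)))).
    have : 0 <= n%:R * (a - 1) ^+ 2 by rewrite mulr_ge0// sqr_ge0.
    by rewrite -natr1; lra.
  by rewrite ler_wpM2l//; lra.
have [N hN] := @invn_small R ((a - 1) / (`|B| + 1)) ltac:(by rewrite divr_gt0 ?subr_gt0 ?ltr_wpDl).
have := hN N (leqnn _); rewrite invf_ple ?posrE ?divr_gt0 ?subr_gt0 ?ltr_wpDl//.
rewrite invf_div ler_pdivrMr ?subr_gt0// => h1.
have := le_trans (bern N.+1) (h N.+1); have := ler_norm B; lra.
Qed.

(** The powers of [|g x|] are the values [|g (n x)|], bounded by compactness, so [|g x| <= 1]; the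
    same at [- x] gives equality. *)
Lemma multiplicative_unimodular {R : realType} {X : compactAbGroupType} (g : X -> R[i]) :
  cct g -> (forall x y, g (x + y) = g x * g y) -> g 0 = 1 -> forall x, normc (g x) = 1.
Proof.
move=> cg gM g0; have [B hB] := cct_bounded cg.
have le1 x : normc (g x) <= 1.
  apply: (@bounded_powers _ _ B) => n.
  have -> : normc (g x) ^+ n = normc (g (x *+ n)); last exact: hB.
  elim: n => [|n IH]; first by rewrite mulr0n g0 normc1.
  by rewrite mulrS gM normcM exprS IH.
move=> x; apply/eqP; rewrite eq_le le1/=.
have : normc (g x) * normc (g (- x)) = 1 by rewrite -normcM -gM subrr g0 normc1.
have := le1 (- x); have := normc_ge0 (g x); have := normc_ge0 (g (- x)).
move: (normc (g x)) (normc (g (- x))) => a b b0 a0 b1 ab.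
by rewrite -ab -[leRHS]mulr1 ler_wpM2l.
Qed.

Lemma telescope3 {K : comPzRingType} (a b l u g : K) :
  a - l * g = a - b + (b - l * u + l * (u - g)).
Proof. by ring. Qed.

(** The arithmetic that ends [eigenfun_exists]: [a], [b], [c] stand for [N2 (Ts u)], [N2 u],
    [N2 (f n)], while [v] is the defect [1/(n+1)] of the maximizing sequence and [w] is [e ^+ 2]. *)
Lemma residual_bound {K : realFieldType} (L a b c v w : K) :
  a <= L * b -> L ^+ 2 * c <= L ^+ 2 * 1 -> L * (L - v) <= L * b -> L * v <= L * w ->
  a - 2 * (L * b) + L ^+ 2 * c <= L * w.
Proof. by rewrite !mulrBr => *; lra. Qed.

(** * An eigenfunction for the norm of a convolution operator *)

Section peter_weyl.
Context {R : realType} {X : compactAbGroupType}.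
Variable mu : probability (borel X) R.
Hypothesis haar : is_haar mu.
Variable h : X -> R[i].
Hypothesis ch : cct h.

Local Notation T := (convol mu h).
Local Notation Ts := (convol mu (adj h)).
Local Notation ip := (ip mu).
Local Notation N2 := (N2 mu).

Let ca : cct (adj h). Proof. exact: cct_adj. Qed.

Lemma N2_gt0 f x : cct f -> f x != 0 -> 0 < N2 f.
Proof.
move=> cf fx; rewrite lt_neqAle N2_ge0 andbT eq_sym; apply: contra fx => /eqP N0.
have cf2 : ct (fun x => normc (f x) ^+ 2) by cts.
have /(_ x)/eqP := rI_eq0 haar cf2 (fun x => sqr_ge0 _) N0.
by rewrite sqrf_eq0 normc_eq0.
Qed.

Lemma N2_0 : N2 (fun=> 0) = 0.
Proof.
rewrite /N2; under eq_Rintegral do rewrite normc0 expr0n/=.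
exact: rI_cst.
Qed.

(** [L] is the square of the operator norm on L^2, a supremum over the unit ball; the second clause
    supplies a maximizing sequence. *)
Lemma convol_norm_exists : exists2 L, (forall f, cct f -> N2 (T f) <= L * N2 f) &
  forall e, 0 < e -> exists f, [/\ cct f, N2 f <= 1 & L - e < N2 (T f)].
Proof.
have [M0 hM0] := cct_bounded ch; pose M := `|M0|; have Mge : 0 <= M := normr_ge0 _.
have hM x : normc (h x) <= M := le_trans (hM0 x) (ler_norm _).
pose S := [set t | exists f, [/\ cct f, N2 f <= 1 & t = N2 (T f)]].
have Tb f x : cct f -> normc (T f x) <= M * Num.sqrt (N2 f).
  by move=> cf; apply: (convol_bound mu ch cf (normr_ge0 _)) => y; exact: hM.
have hS : has_sup S.
  split; first by exists (N2 (T (fun=> 0))), (fun=> 0); split => //; [exact: cct_cst|rewrite N2_0].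
  exists (M ^+ 2) => _ [f [cf f1 ->]]; apply: N2_le1 => //; first exact: cct_convol.
  move=> x; apply: le_trans (Tb _ _ cf) _; rewrite -[leRHS]mulr1 ler_wpM2l//.
  by rewrite -[leRHS]sqrtr1 ler_wsqrtr.
exists (sup S).
  move=> f cf; have [N0|N0] := eqVneq (N2 f) 0.
    rewrite N0 mulr0; suff -> : N2 (T f) = 0 by [].
    rewrite -[RHS]N2_0; congr N2; apply/funext => x; apply/eqP; rewrite -normc_eq0 eq_le normc_ge0 andbT.
    by apply: le_trans (Tb _ _ cf) _; rewrite N0 sqrtr0 mulr0.
  have Np : 0 < N2 f by rewrite lt_neqAle eq_sym N0 N2_ge0.
  pose c : R[i] := ((Num.sqrt (N2 f))^-1)%:C.
  have c2 : normc c ^+ 2 = (N2 f)^-1.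
    by rewrite normcR real_normK ?num_real// exprVn sqr_sqrtr ?N2_ge0.
  have : S (N2 (T (fun x => c * f x))).
    exists (fun x => c * f x); split => //; first by cts.
    by rewrite N2Z// c2 mulVf.
  move/(ub_le_sup (proj2 hS)).
  have -> : T (fun x => c * f x) = fun x => c * T f x by apply/funext => x; exact: convolZ.
  by rewrite N2Z ?c2; [rewrite mulrC ler_pdivrMr|exact: cct_convol].
move=> e e0; have [_ [f [cf f1 ->]] ef] := sup_adherent e0 hS.
by exists f.
Qed.

Lemma ip_Ts f g : cct f -> cct g -> ip (Ts f) g = ip f (T g).
Proof. by move=> cf cg; have := ip_convol mu ca cf cg; rewrite adjK. Qed.

(** The square of [N2 (Ts f)] is that of [<T (Ts f), f>], hence at most [L * N2 (Ts f) * N2 f] by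
    Cauchy-Schwarz; one factor cancels. *)
Lemma adj_norm_le L f : (forall f, cct f -> N2 (T f) <= L * N2 f) -> cct f ->
  N2 (Ts f) <= L * N2 f.
Proof.
move=> hL cf; have cTs := cct_convol mu ca cf.
have cTTs := cct_convol mu ch cTs.
have [N0|N0] := eqVneq (N2 (Ts f)) 0.
  rewrite N0; have := hL _ cf; have := N2_ge0 mu (T f); exact: le_trans.
have Np : 0 < N2 (Ts f) by rewrite lt_neqAle eq_sym N0 N2_ge0.
have := cauchy_schwarz mu cTTs cf; rewrite (ip_convol mu ch cTs cf) ipxx normcR ger0_norm ?N2_ge0//.
move=> h1; have := le_trans h1 (ler_wpM2r (N2_ge0 mu f) (hL _ cTs)).
by rewrite expr2 mulrAC ler_pM2r.
Qed.

(* The quantity is positive for [f = h^*] since [T h^* 0] is the squared norm of [h]. *)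
Lemma convol_norm_gt0 L x : (forall f, cct f -> N2 (T f) <= L * N2 f) -> h x != 0 -> 0 < L.
Proof.
move=> hL hx; have cJ : cct (fun y => (h y)^*) by cts.
have T0 : T (fun y => (h y)^*) 0 = (N2 h)%:C.
  by rewrite -ipxx; apply: eq_cI => y; rewrite subr0.
have Nh := N2_gt0 ch hx.
have : 0 < N2 (T (fun y => (h y)^*)).
  apply: (@N2_gt0 _ 0); first exact: cct_convol.
  by rewrite T0 -normc_eq0 normcR normr_eq0 gt_eqF.
move=> /lt_le_trans /(_ (hL _ cJ)); rewrite pmulr_lgt0//.
apply: (@N2_gt0 _ x) => //; by rewrite -normc_eq0 normc_conj normc_eq0.
Qed.

(** [Ts] is the adjoint of [T], so the eigenvalue equation is that of a positive operator, at the
    top of its spectrum when [L] is the squared norm. *)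
Definition eigenfun (L : R) (f : X -> R[i]) := cct f /\ forall x, T (Ts f) x = L%:C * f x.

(** For a maximizing sequence [f n] and [u = T (f n)], expanding the square gives
    [N2 (Ts u - L f n) <= L (L - N2 u)], which tends to 0. Applying [T] turns this into uniform
    smallness of [T (Ts u) - L u], and a cluster point [g] of the [u] is an eigenfunction. *)
Lemma eigenfun_exists L x0 : (forall f, cct f -> N2 (T f) <= L * N2 f) ->
  (forall e, 0 < e -> exists f, [/\ cct f, N2 f <= 1 & L - e < N2 (T f)]) ->
  h x0 != 0 -> exists2 g, eigenfun L g & exists x, g x != 0.
Proof.
move=> hL hs hx0; have L0 := convol_norm_gt0 hL hx0.
have [M0 hM0] := cct_bounded ch; pose M := `|M0|; have Mge : 0 <= M := normr_ge0 _.
have hM x : normc (h x) <= M := le_trans (hM0 x) (ler_norm _).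
have /choice[f hf] : forall n : nat, exists f,
    [/\ cct f, N2 f <= 1 & L - n.+1%:R^-1 < N2 (T f)] by move=> n; apply: hs.
have cf n : cct (f n) by case: (hf n).
have f1 n : N2 (f n) <= 1 by case: (hf n).
have Tf n : L - n.+1%:R^-1 < N2 (T (f n)) by case: (hf n).
have cT n : cct (T (f n)) by exact: cct_convol.
have [|x1 e e0|g cg hg] := @ascoli_cluster R X (fun n => T (f n)) M.
- move=> n x; apply: le_trans (convol_bound mu ch (cf n) (normr_ge0 _) (fun y => hM _)) _.
  by rewrite -[leRHS]mulr1 ler_wpM2l// -[leRHS]sqrtr1 ler_wsqrtr.
- have := near_equicontinuous_c x1 (cct_kernel ch) e0.
  apply: filterS => x hx n; exact: convol_equi.
exists g; last first.
  (* If [g] vanished, [N2 (T (f n))] would be at most [L / 4] for some [n] for which it exceeds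
     [L / 2]. *)
  apply: contrapT => /forallNP g0.
  have [N hN] := @invn_small R (L / 2) ltac:(by rewrite divr_gt0).
  have [|n Nn hn] := hg (Num.sqrt L / 2) N; first by rewrite divr_gt0// sqrtr_gt0.
  have : N2 (T (f n)) <= (Num.sqrt L / 2) ^+ 2.
    have s0 : 0 <= Num.sqrt L / 2 by rewrite divr_ge0// sqrtr_ge0.
    apply: (N2_le1 mu (cT n) s0) => x.
    by have := hn x; have /negP/negPn/eqP -> := g0 x; rewrite subr0.
  have -> : (Num.sqrt L / 2) ^+ 2 = L / 4 by rewrite expr_div_n sqr_sqrtr ?ltW//; field.
  move=> N1; have N3 := hN n Nn; have N4 := Tf n; clear -N1 N3 N4 L0.
  by have := lt_le_trans N4 N1; move: N3; move: (n.+1%:R^-1) => v; lra.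
split => // x; apply/eqP; rewrite -subr_eq0 -normc_eq0 eq_le normc_ge0 andbT.
apply: (@le0_of_small _ _ (M * Num.sqrt L + M * Num.sqrt L + L)).
  by rewrite !addr_ge0 ?mulr_ge0 ?sqrtr_ge0 ?normr_ge0 ?ltW.
move=> e e0; have [N hN] := @invn_small R (e ^+ 2) ltac:(by rewrite exprn_gt0).
have [n Nn hn] := hg e N e0.
set u := T (f n) in hn.
have cu : cct u := cT n.
have cgu : cct (fun y => g y - u y) by cts.
have cTsu := cct_convol mu ca cu.
have cLf : cct (fun y => L%:C * f n y) by cts.
have small F : cct F -> N2 F <= L * e ^+ 2 -> normc (T F x) <= M * Num.sqrt L * e.
  move=> cF NF; apply: le_trans (convol_bound mu ch cF (normr_ge0 _) (fun y => hM _)) _.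
  rewrite -mulrA ler_wpM2l// -[e in leRHS](ger0_norm (ltW e0)) -sqrtr_sqr -sqrtrM; last exact: ltW.
  by rewrite ler_wsqrtr.
have -> : T (Ts g) x - L%:C * g x =
    T (Ts (fun y => g y - u y)) x + (T (fun y => Ts u y - L%:C * f n y) x + L%:C * (u x - g x)).
  have -> : Ts (fun y => g y - u y) = fun y => Ts g y - Ts u y.
    by apply/funext => y; exact: convolB.
  have cTsg := cct_convol mu ca cg.
  rewrite (convolB mu x ch cTsg cTsu) (convolB mu x ch cTsu cLf) (convolZ mu L%:C x ch (cf n)).
  exact: telescope3.
apply: le_trans (normcD3 _ _ _) _; rewrite !mulrDl -addrA; apply: lerD.
  apply: small; first exact: cct_convol.
  apply: le_trans (adj_norm_le hL cgu) _; apply: ler_wpM2l; first exact: ltW.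
  by apply: (N2_le1 mu cgu (ltW e0)) => y; rewrite -normcN opprB.
apply: lerD; last first.
  by rewrite normcM normcR gtr0_norm//; apply: ler_wpM2l => //; exact: ltW.
apply: small; first by apply: cctD => //; exact: cctN.
rewrite N2B// ipZr// N2Z// (ip_Ts cu (cf n)) -/u ipxx conjCR -(rmorphM (real_complex R)) normcR gtr0_norm//=.
have h1 := adj_norm_le hL cu.
have h2 := ler_wpM2l (sqr_ge0 L) (f1 n).
have h3 := ler_wpM2l (ltW L0) (ltW (Tf n)).
have h4 := ler_wpM2l (ltW L0) (hN n Nn).
exact: residual_bound h1 h2 h3 h4.
Qed.

End peter_weyl.

(** * Finite multiplicity and the uniqueness theorem *)

Section peter_weyl2.
Context {R : realType} {X : compactAbGroupType}.
Variable mu : probability (borel X) R.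
Hypothesis haar : is_haar mu.
Variable h : X -> R[i].
Hypothesis ch : cct h.

Local Notation T := (convol mu h).
Local Notation Ts := (convol mu (adj h)).
Local Notation ip := (ip mu).
Local Notation N2 := (N2 mu).

Let ca : cct (adj h). Proof. exact: cct_adj. Qed.

Definition eigen_family (L : R) (k : nat) (e : nat -> X -> R[i]) :=
  (forall i, (i < k)%N -> eigenfun mu h L (e i)) /\
  (forall i j, (i < k)%N -> (j < k)%N -> ip (e i) (e j) = (i == j)%:R).

(** A Hilbert-Schmidt bound. The functions [L^(-1/2) Ts (e i)] are orthonormal, and Bessel's
    inequality for the section of the kernel at [x] reads [sum_i L |e i x|^2 <= M^2]; integrating in
    [x] gives the claim. *)
Lemma eigen_family_bound L M k e : 0 < L -> 0 <= M -> (forall x, normc (h x) <= M) ->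
  eigen_family L k e -> k%:R * L <= M ^+ 2.
Proof.
move=> L0 M0 hM [he oe].
have ce i : (i < k)%N -> cct (e i) by move=> /he[].
pose c : R[i] := ((Num.sqrt L)^-1)%:C.
have cc : c * c^* * L%:C = 1.
  rewrite mulcJ normcR real_normK ?num_real// exprVn sqr_sqrtr ?ltW//.
  by rewrite -(rmorphM (real_complex R)) mulVf ?gt_eqF.
pose e' i x := c * Ts (e i) x.
have cTs i : (i < k)%N -> cct (Ts (e i)) by move=> ik; apply: cct_convol => //; exact: ce.
have pt x : \sum_(i < k) L * normc (e i x) ^+ 2 <= M ^+ 2.
  have ck : cct (fun y => (h (y - x))^*) by apply: cctJ; exact: cct_subr.
  have Nk : N2 (fun y => (h (y - x))^*) <= M ^+ 2.
    by apply: N2_le1 => // y; rewrite normc_conj.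
  apply: le_trans Nk; rewrite -(big_mkord predT (fun i => L * normc (e i x) ^+ 2)).
  have us : uniq (index_iota 0 k) by exact: iota_uniq.
  apply: le_trans (bessel (e := e') us _ ck _); last 2 first.
  - by move=> i; rewrite mem_index_iota leq0n andTb => ik; apply: cctM; [exact: cct_cst|exact: cTs].
  - move=> i j; rewrite !mem_index_iota !leq0n !andTb => ik jk.
    rewrite (ipZl mu c (cTs _ ik) (cctM (cct_cst c) (cTs _ jk))) (ipZr mu c (cTs _ ik) (cTs _ jk)).
    rewrite (ip_Ts mu ch (ce _ ik) (cTs _ jk)).
    have -> : T (Ts (e j)) = fun x => L%:C * e j x by apply/funext => y; case: (he _ jk).
    by rewrite (ipZr mu L%:C (ce _ ik) (ce _ jk)) oe// (conjCR L) !mulrA cc mul1r.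
  rewrite big_seq [leRHS]big_seq; apply: ler_sum => i; rewrite mem_index_iota leq0n andTb => ik.
  have -> : ip (fun y => (h (y - x))^*) (e' i) = (c * (L%:C * e i x))^*.
    apply: (etrans (ipC mu (cctM (cct_cst c) (cTs _ ik)) ck)); congr (_^*).
    apply: (etrans (ipZl mu c (cTs _ ik) ck)); congr (_ * _).
    by rewrite -(convol_ip mu h (Ts (e i)) x); case: (he _ ik) => _ ->.
  rewrite normc_conj.
  rewrite !normcM !normcR !exprMn !real_normK ?num_real// exprVn (sqr_sqrtr (ltW L0)).
  by rewrite [leRHS](_ : _ = L * normc (e i x) ^+ 2)//; field; rewrite gt_eqF.
have NE i : (i < k)%N -> N2 (e i) = 1.
  move=> ik; have := ipxx mu (e i); rewrite oe// eqxx => /(congr1 (@complex.Re R)) /= <-.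
  by [].
pose g (i : 'I_k) x := L * normc (e i x) ^+ 2.
have cg i : ct (g i) by have := ce i (ltn_ord i); rewrite /g => c1; cts.
have : \int[mu]_x (\sum_(i < k) g i x) <= M ^+ 2.
  rewrite -[leRHS](rI_cst mu); apply: rI_le; [exact: ct_sum|exact: ct_cst|exact: pt].
rewrite rI_sum//; under eq_bigr => i _.
  have -> : \int[mu]_x g i x = L.
    have := ce i (ltn_ord i) => c1; rewrite /g rIZ; last by cts.
    by rewrite -/(N2 (e i)) NE// mulr1.
  over.
by rewrite sumr_const card_ord -[L *+ k]mulr_natl.
Qed.

Lemma eigenfunD L f g : eigenfun mu h L f -> eigenfun mu h L g ->
  eigenfun mu h L (fun x => f x + g x).
Proof.
move=> [cf hf] [cg hg]; split; first exact: cctD.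
move=> x; have -> : Ts (fun x => f x + g x) = fun x => Ts f x + Ts g x.
  by apply/funext => y; exact: convolD.
rewrite (convolD mu x ch (cct_convol mu ca cf) (cct_convol mu ca cg)) hf hg.
by rewrite mulrDr.
Qed.

Lemma eigenfunZ L c f : eigenfun mu h L f -> eigenfun mu h L (fun x => c * f x).
Proof.
move=> [cf hf]; split; first by apply: cctM => //; exact: cct_cst.
move=> x; have -> : Ts (fun x => c * f x) = fun x => c * Ts f x.
  by apply/funext => y; exact: convolZ.
by rewrite (convolZ mu c x ch (cct_convol mu ca cf)) hf mulrCA.
Qed.

Lemma eigenfun0 L : eigenfun mu h L (fun=> 0).
Proof.
have c0 : cct (fun _ : X => 0 : R[i]) by exact: cct_cst.
split => // x; have z k y : cct k -> convol mu k (fun=> 0) y = 0.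
  move=> ck; rewrite -[RHS](cI_cst mu); apply: eq_cI => u; exact: mulr0.
have -> : Ts (fun=> 0) = (fun=> 0) by apply/funext => y; exact: z.
by rewrite z// mulr0.
Qed.

Lemma eigenfun_sum L k (f : nat -> X -> R[i]) (c : nat -> R[i]) :
  (forall i, (i < k)%N -> eigenfun mu h L (f i)) ->
  eigenfun mu h L (fun x => \sum_(i < k) c i * f i x).
Proof.
elim: k => [|k IH] hf.
  rewrite (_ : (fun x => _) = fun=> 0); first exact: eigenfun0.
  by apply/funext => x; rewrite big_ord0.
rewrite (_ : (fun x => _) = fun x => \sum_(i < k) c i * f i x + c k * f k x); last first.
  by apply/funext => x; rewrite big_ord_recr.
apply: eigenfunD; last by apply: eigenfunZ; exact: hf.
by apply: IH => i ik; apply: hf; rewrite ltnS ltnW.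
Qed.

Lemma eigenfun_translate L f a : eigenfun mu h L f -> eigenfun mu h L (fun x => f (x + a)).
Proof.
move=> [cf hf]; split; first exact: cct_addr.
move=> x; have -> : Ts (fun x => f (x + a)) = fun x => Ts f (x + a).
  by apply/funext => y; exact: convol_translate.
by rewrite (convol_translate haar a x ch (cct_convol mu ca cf)) hf.
Qed.

Lemma eigen_family_max L x0 : (exists2 g, eigenfun mu h L g & exists x, g x != 0) ->
  0 < L -> h x0 != 0 -> exists k, exists2 e, eigen_family L k.+1 e &
  forall f, eigenfun mu h L f -> forall x, f x = \sum_(i < k.+1) ip f (e i) * e i x.
Proof.
move=> [g hg [xg gx]] L0 hx0.
have [M0 hM0] := cct_bounded ch; pose M := `|M0|; have Mge : 0 <= M := normr_ge0 _.
have hM x : normc (h x) <= M := le_trans (hM0 x) (ler_norm _).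
pose Q k := `[< exists e, eigen_family L k e >].
have ext k e f x : eigen_family L k e -> eigenfun mu h L f ->
    f x != \sum_(i < k) ip f (e i) * e i x -> Q k.+1.
  move=> [he oe] hf fx.
  have ce i : (i < k)%N -> cct (e i) by move=> /he[].
  pose r y := f y + -1 * (\sum_(i < k) ip f (e i) * e i y).
  have hS : eigenfun mu h L (fun y => \sum_(i < k) ip f (e i) * e i y).
    exact: (@eigenfun_sum L k e (fun i => ip f (e i)) he).
  have hr : eigenfun mu h L r by apply: eigenfunD => //; exact: eigenfunZ.
  have cr : cct r by case: hr.
  have cf : cct f by case: hf.
  have cS : cct (fun y => \sum_(i < k) ip f (e i) * e i y) by case: hS.
  have rx : r x != 0 by rewrite /r mulN1r subr_eq0.
  have Nr := N2_gt0 haar cr rx.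
  pose c : R[i] := ((Num.sqrt (N2 r))^-1)%:C.
  have re i : (i < k)%N -> ip r (e i) = 0.
    move=> ik; rewrite (ipDl mu cf (cctM (cct_cst (-1)) cS) (ce _ ik)).
    rewrite (ipZl mu (-1) cS (ce _ ik)).
    pose F (j : 'I_k) y := ip f (e j) * e j y.
    have cF j : cct (F j) by apply: cctM; [exact: cct_cst|exact: ce].
    rewrite (ip_suml mu _ cF (ce _ ik)) (bigD1 (Ordinal ik))//= big1 => [|j ji].
      by rewrite addr0 /F (ipZl mu _ (ce _ ik) (ce _ ik)) oe// eqxx mulr1 mulN1r subrr.
    rewrite /F (ipZl mu _ (ce _ (ltn_ord j)) (ce _ ik)) oe//.
    by rewrite (_ : (j == i :> nat) = false) ?mulr0//; apply/negbTE.
  have cc : cct (fun y => c * r y) by apply: cctM => //; exact: cct_cst.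
  apply/asboolP; exists (fun i => if (i < k)%N then e i else fun y => c * r y).
  split=> [i _|i j].
    by case: ifP => [/he//|_]; exact: eigenfunZ.
  rewrite !ltnS => ik jk; case: ifPn => ik'; case: ifPn => jk'.
  - exact: oe.
  - rewrite (ipC mu cc (ce _ ik')) (ipZl mu c cr (ce _ ik')) re// mulr0 conjC0.
    by rewrite (_ : (i == j) = false)//; apply/eqP => ij; move: jk'; rewrite -ij ik'.
  - rewrite (ipZl mu c cr (ce _ jk')) re// mulr0.
    by rewrite (_ : (i == j) = false)//; apply/eqP => ij; move: ik'; rewrite ij jk'.
  - have -> : i = j by apply/eqP; rewrite eqn_leq; move: ik' jk'; rewrite -!leqNgt; lia.
    rewrite eqxx ipxx (N2Z mu c cr) normcR real_normK ?num_real// exprVn.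
    by rewrite sqr_sqrtr ?ltW// mulVf// gt_eqF.
have Q0 : Q 0%N by apply/asboolP; exists (fun=> g).
have Q1 : Q 1%N.
  move/asboolP: (Q0) => [e he]; apply: (ext 0%N e g xg) => //.
  by rewrite big_ord0.
have bQ k : Q k -> (k <= Num.truncn (M ^+ 2 / L))%N.
  move=> /asboolP[e he]; rewrite truncn_ge_nat; last by rewrite divr_ge0 ?exprn_ge0// ltW.
  by rewrite ler_pdivlMr//; exact: eigen_family_bound he.
case: (ex_maxnP (ex_intro (fun k => is_true (Q k)) 0%N Q0) bQ) => -[|k] Qk kmax.
  by have := kmax _ Q1.
move/asboolP: (Qk) => [e he]; exists k, e => // f hf x; apply/eqP/negPn/negP => fx.
by have := kmax _ (ext _ _ _ _ he hf fx); rewrite ltnn.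
Qed.

Lemma convol_character g : dual R X g -> (forall f, dual R X f -> fourier mu h f = 0) ->
  T g 0 = 0.
Proof.
move=> [cg gM g1] hf; rewrite -(hf (fun x => (g x)^*)).
  by apply: eq_cI => y; rewrite subr0 conjCK.
split; first by case: (cctJ (Cct cg)).
  by move=> x y; rewrite gM conjcM.
by move=> x; rewrite normc_conj.
Qed.

(** If [h] is not zero, translations act on a nonzero finite-dimensional eigenspace by commuting
    matrices. A common eigenvector, divided by its value at 0, is a character [g]. As [Ts g] is a
    multiple of [g], [T (Ts g) 0 = Ts g 0 * T g 0]; the last factor is a Fourier coefficient of [h],
    hence 0, against [L > 0]. *)
Theorem fourier_uniqueness : (forall f, dual R X f -> fourier mu h f = 0) ->
  forall x, h x = 0.
Proof.
move=> hf x0; apply/eqP/negPn/negP => hx0.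
have [L hL hs] := convol_norm_exists mu ch.
have L0 := convol_norm_gt0 haar ch hL hx0.
have [k [e [he oe] span]] := eigen_family_max (eigenfun_exists haar ch hL hs hx0) L0 hx0.
have ce i : (i < k.+1)%N -> cct (e i) by move=> /he[].
pose A (a : X) : 'M[R[i]]_k.+1 := \matrix_(i, j) ip (fun x => e i (x + a)) (e j).
have eA (i : 'I_k.+1) a x : e i (x + a) = \sum_(j < k.+1) A a i j * e j x.
  rewrite (span _ (eigenfun_translate a (he i (ltn_ord i))) x).
  by apply: eq_bigr => j _; rewrite mxE.
have AM a b : A a *m A b = A (b + a).
  apply/matrixP => i l; rewrite !mxE.
  pose F (j : 'I_k.+1) x := A a i j * e j (x + b).
  have cF j : cct (F j).
    by apply: cctM; [exact: cct_cst|apply: cct_addr; exact: ce].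
  have -> : (fun x => e i (x + (b + a))) = fun x => \sum_(j < k.+1) F j x.
    by apply/funext => x; rewrite addrA eA.
  rewrite (ip_suml mu _ cF (ce _ (ltn_ord l))); apply: eq_bigr => j _.
  have cj : cct (fun x => e j (x + b)) by apply: cct_addr; exact: ce.
  by rewrite [A b j l]mxE /F (ipZl mu _ cj (ce _ (ltn_ord l))).
have [|v v0 hv] := @common_eigenvector_family _ X k.+1 A isT.
  by move=> a b; rewrite !AM addrC.
pose phi x := \sum_(j < k.+1) v 0 j * e j x.
have phiE : eigenfun mu h L phi.
  have := @eigenfun_sum L k.+1 e (fun j => v 0 (inord j)) he.
  congr eigenfun; apply/funext => x; apply: eq_bigr => j _.
  by rewrite inord_val.
have phiT a : exists c, forall x, phi (x + a) = c * phi x.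
  have [c hc] := hv a; exists c => x.
  rewrite /phi mulr_sumr.
  transitivity (\sum_(j < k.+1) (v *m A a) 0 j * e j x); last first.
    by apply: eq_bigr => j _; rewrite hc mxE mulrA.
  under eq_bigr => i _ do rewrite eA mulr_sumr.
  rewrite exchange_big /=; apply: eq_bigr => j _.
  by rewrite mxE mulr_suml; apply: eq_bigr => i _; rewrite mulrA.
have cphi : cct phi by case: phiE.
have [j vj] : exists j, v 0 j != 0.
  apply/existsP; apply: contraNT v0; rewrite negb_exists => /forallP hv0.
  by apply/eqP/rowP => j; rewrite mxE; apply/eqP; move: (hv0 j); rewrite negbK.
have phi0 : phi 0 != 0.
  apply/eqP => p0; move/eqP: vj; apply.
  have phi00 : phi = fun=> 0.
    by apply/funext => x; have [c hc] := phiT x; rewrite -[x]add0r hc p0 mulr0.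
  pose F (i : 'I_k.+1) x := v 0 i * e i x.
  have cF i : cct (F i) by apply: cctM; [exact: cct_cst|exact: ce].
  have : ip phi (e j) = v 0 j.
    rewrite (ip_suml mu (index_enum _) cF (ce _ (ltn_ord j))) (bigD1 j)//= big1 => [|i ij].
      by rewrite addr0 (ipZl mu _ (ce _ (ltn_ord j)) (ce _ (ltn_ord j))) oe// eqxx mulr1.
    rewrite (ipZl mu _ (ce _ (ltn_ord i)) (ce _ (ltn_ord j))) oe//.
    by rewrite (_ : (i == j :> nat) = false) ?mulr0//; apply/negbTE.
  move=> <-; rewrite phi00 -[RHS](cI_cst mu); apply: eq_cI => x; exact: mul0r.
pose g x := (phi 0)^-1 * phi x.
have gE : eigenfun mu h L g by exact: eigenfunZ.
have cg : cct g by case: gE.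
have g0 : g 0 = 1 by rewrite /g mulVf.
have gM x a : g (x + a) = g x * g a.
  have [c hc] := phiT a; have pa : phi a = c * phi 0 by rewrite -hc add0r.
  by rewrite /g hc pa [c * phi 0]mulrC mulKf// -[RHS]mulrA [phi x * c]mulrC.
have dg : dual R X g.
  by split => //; [case: cg|exact: multiplicative_unimodular].
have cTs := cct_convol mu ca cg.
have TsE y : Ts g y = Ts g 0 * g y.
  have := convol_translate haar y 0 ca cg; rewrite add0r => <-.
  have -> : (fun x => g (x + y)) = fun x => g y * g x by apply/funext => x; rewrite gM mulrC.
  by rewrite (convolZ mu _ 0 ca cg) mulrC.
case: gE => _ /(_ 0); rewrite g0 mulr1.
have -> : Ts g = fun y => Ts g 0 * g y by apply/funext.
rewrite (convolZ mu _ 0 ch cg) (convol_character dg hf) mulr0.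
by move/(congr1 (@complex.Re R)) => /= L00; move: L0; rewrite -L00 ltxx.
Qed.

End peter_weyl2.

(** * Orthogonality of characters *)

Section characters.
Context {R : realType} {X : compactAbGroupType}.
Implicit Types g h : X -> R[i].

Lemma dual_cct g : dual R X g -> cct g. Proof. by case. Qed.
Lemma dualM g x y : dual R X g -> g (x + y) = g x * g y. Proof. by case. Qed.
Lemma dual_normc g x : dual R X g -> normc (g x) = 1. Proof. by case. Qed.
Lemma dual_mulcJ g x : dual R X g -> g x * (g x)^* = 1.
Proof. by move=> dg; rewrite mulcJ1// dual_normc. Qed.
Lemma dual_neq0 g x : dual R X g -> g x != 0.
Proof. by move=> dg; rewrite -normc_eq0 dual_normc// oner_eq0. Qed.
Lemma dual0 g : dual R X g -> g 0 = 1.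
Proof.
move=> dg; apply: (mulfI (dual_neq0 0 dg)).
by rewrite -dualM// addr0 mulr1.
Qed.
Variable mu : probability (borel X) R.
Hypothesis haar : is_haar mu.

Lemma cI_quasi_invariant (F : X -> R[i]) (a : X) (c : R[i]) : cct F -> c != 1 ->
  (forall x, F (a + x) = c * F x) -> cI mu F = 0.
Proof.
move=> cF c1 hF; have := cI_translate haar a cF.
have -> : (fun x => F (a + x)) = fun x => c * F x by apply/funext.
rewrite (cIZ mu c cF) => cJ; have : (c - 1) * cI mu F == 0 by rewrite mulrBl mul1r cJ subrr.
by rewrite mulf_eq0 subr_eq0 (negbTE c1) => /eqP.
Qed.

Lemma dual_ortho : {in [set g | dual R X g] &, forall g h, ip mu g h = (g == h)%:R}.
Proof.
move=> g h; rewrite !inE => dg dh; have [->|gh] := eqVneq g h.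
  rewrite -[RHS](cI_cst mu); apply: eq_cI => x; exact: dual_mulcJ.
have [a ha] : exists a, g a != h a.
  apply: contrapT => /forallNP hn; move/eqP: gh; apply; apply/funext => x.
  by apply/eqP/negPn/negP; exact: hn.
apply: (@cI_quasi_invariant _ a (g a * (h a)^*)).
- by apply: cctM; [exact: dual_cct|apply: cctJ; exact: dual_cct].
- apply: contra ha => /eqP gh1; apply/eqP.
  have := congr1 (fun z => z * h a) gh1.
  by rewrite -mulrA [(h a)^* * _]mulrC (dual_mulcJ a dh) mulr1 mul1r.
- by move=> x; rewrite !dualM// conjcM mulrACA.
Qed.

End characters.

Lemma pair_continuous (S T U : topologicalType) (u : S -> T) (v : S -> U) :
  continuous u -> continuous v -> continuous (fun s => (u s, v s)).
Proof. by move=> cu cv s; apply: cvg_pair => /=; [exact: cu|exact: cv]. Qed.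

Lemma comp_continuous (S T U : topologicalType) (u : S -> T) (v : T -> U) :
  continuous u -> continuous v -> continuous (fun s => v (u s)).
Proof. by move=> cu cv s; apply: continuous_comp; [exact: cu|exact: cv]. Qed.

Lemma fst_cont (S T : topologicalType) : continuous (@fst S T).
Proof. by move=> p; exact: cvg_fst. Qed.
Lemma snd_cont (S T : topologicalType) : continuous (@snd S T).
Proof. by move=> p; exact: cvg_snd. Qed.
Lemma id_cont (S : topologicalType) : continuous (fun s : S => s).
Proof. by move=> p; exact: cvg_id. Qed.
Lemma cst_cont (S T : topologicalType) (c : T) : continuous (fun _ : S => c).
Proof. by move=> p; exact: cvg_cst. Qed.

(** * Products of groups *)

Section product_integrals.
Context {R : realType} {I : finType} (G : I -> compactAbGroupType).
Local Notation P := (prod_topology G).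
Variable mu : forall j, probability (borel (G j)) R.
Hypothesis hmu : forall j, is_haar (mu j).
Implicit Types (k : I) (x : P).

Definition upd x k (t : G k) : P := @dfwith I G x k t.
(** The embedding of the k-th factor; composing a character of the product with it gives the k-th
    component of this character. *)
Definition iota k (t : G k) : P := upd 0 t.

Lemma upd_in x k (t : G k) : upd x t k = t. Proof. exact: dfwith_in. Qed.
Lemma upd_out x k (t : G k) i : k != i -> upd x t i = x i. Proof. exact: dfwith_out. Qed.
Lemma prod_ext x y : (forall i, x i = y i) -> x = y.
Proof. by move=> h; apply: functional_extensionality_dep. Qed.
Lemma upd_upd x k (s t : G k) : upd (upd x s) t = upd x t.
Proof.
apply: prod_ext => i; have [<-|ki] := eqVneq k i; first by rewrite !upd_in.
by rewrite !upd_out.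
Qed.
Lemma updC x k j (s : G k) (t : G j) : k != j -> upd (upd x s) t = upd (upd x t) s.
Proof.
move=> kj; apply: prod_ext => i; have [<-|ji] := eqVneq j i.
  by rewrite upd_in upd_out// upd_in.
rewrite upd_out//; have [<-|ki] := eqVneq k i; first by rewrite !upd_in.
by rewrite !upd_out.
Qed.
Lemma prodD x y i : (x + y) i = x i + y i. Proof. by []. Qed.
Lemma prod0 i : (0 : P) i = 0. Proof. by []. Qed.
Lemma iotaD k (t : G k) x : iota t + x = upd x (t + x k).
Proof.
apply: prod_ext => i; rewrite prodD /iota; have [<-|ki] := eqVneq k i.
  by rewrite !upd_in.
by rewrite !upd_out// prod0 add0r.
Qed.
Lemma upd_iota x k (t : G k) : upd x t = iota (t - x k) + x.
Proof. by rewrite iotaD subrK. Qed.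
Lemma prod_continuous (S : topologicalType) (u : S -> P) :
  (forall i, continuous (fun s => u s i)) -> continuous u.
Proof.
move=> hu s; apply/cvg_sup => i; move: s.
apply: (@continuous_comp_initial _ _ _ (fun f : P => f i) u) => s; exact: hu.
Qed.
Lemma eval_continuous i : continuous (fun x : P => x i).
Proof. exact: (@proj_continuous I G i). Qed.

Lemma upd_continuous k : continuous (fun p : P * G k => upd p.1 p.2).
Proof.
apply: prod_continuous => i; have [<-|ki] := eqVneq k i.
  rewrite (_ : (fun _ => _) = snd); first by move=> p; exact: cvg_snd.
  by apply/funext => p; rewrite upd_in.
rewrite (_ : (fun _ => _) = fun p : P * G k => p.1 i).
  exact: (comp_continuous (@fst_cont _ _) (@eval_continuous i)).
by apply/funext => p; rewrite upd_out.
Qed.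
Lemma upd_section_continuous x k : continuous (fun t : G k => upd x t).
Proof.
apply: (comp_continuous (u := fun t : G k => (x : P, t)) _ (@upd_continuous k)).
by apply: pair_continuous; [exact: cst_cont|exact: id_cont].
Qed.

(** Conditional expectations that integrate out the k-th variable. They stay functions on the whole
    product so that they can be iterated, and [indep k] records that a variable is gone. *)
Definition rE k (f : P -> R) (x : P) : R := \int[mu k]_t f (upd x t).
Definition cE k (f : P -> R[i]) (x : P) : R[i] := cI (mu k) (fun t => f (upd x t)).
Definition indep k T (f : P -> T) := forall x (t : G k), f (upd x t) = f x.

Lemma ct_section f x k : ct f -> ct (fun t : G k => f (upd x t) : R).
Proof. by move=> cf; apply: (ct_comp _ cf); exact: upd_section_continuous. Qed.
Lemma cct_section f x k : cct f -> cct (fun t : G k => f (upd x t) : R[i]).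
Proof. by move=> cf; apply: (cct_comp _ cf); exact: upd_section_continuous. Qed.
Lemma ct_rE k f : ct f -> ct (rE k f).
Proof.
move=> cf; apply: (@ct_rI _ _ (mu k) _ (fun p => f (upd p.1 p.2))).
by apply: (ct_comp _ cf); exact: upd_continuous.
Qed.
Lemma cct_cE k f : cct f -> cct (cE k f).
Proof.
move=> cf; apply: (@cct_cI _ _ (mu k) _ (fun p => f (upd p.1 p.2))).
by apply: (cct_comp _ cf); exact: upd_continuous.
Qed.
Lemma rE_indep k f : indep k (rE k f).
Proof. by move=> x t; rewrite /rE; apply: eq_Rintegral => s _; rewrite upd_upd. Qed.
Lemma cE_indep k f : indep k (cE k f).
Proof. by move=> x t; apply: eq_cI => s; rewrite upd_upd. Qed.
Lemma rE_indep_out k j f : indep j f -> indep j (rE k f).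
Proof.
move=> hf; have [->|kj] := eqVneq j k; first exact: rE_indep.
by move=> x t; apply: eq_Rintegral => s _; rewrite updC// hf.
Qed.
Lemma rE_pull k g f x : ct f -> indep k g -> rE k (fun y => g y * f y) x = g x * rE k f x.
Proof.
move=> cf hg; rewrite -rIZ; last exact: ct_section.
by apply: eq_Rintegral => t _; rewrite hg.
Qed.
Lemma cE_pull k g f x : cct f -> indep k g -> cE k (fun y => g y * f y) x = g x * cE k f x.
Proof.
move=> cf hg; apply: (etrans _ (cIZ (mu k) (g x) (cct_section x k cf))).
by apply: eq_cI => t; rewrite hg.
Qed.
Lemma rE_le k f g x : ct f -> ct g -> (forall y, f y <= g y) -> rE k f x <= rE k g x.
Proof. by move=> cf cg fg; apply: rI_le => //; exact: ct_section. Qed.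
Lemma rE_ge0 k f x : (forall y, 0 <= f y) -> 0 <= rE k f x.
Proof. by move=> h; exact: rI_ge0. Qed.
Lemma rE_swap k j f x : ct f -> rE k (rE j f) x = rE j (rE k f) x.
Proof.
move=> cf; have [->//|kj] := eqVneq k j.
have cF : ct (fun p : G k * G j => f (upd (upd x p.1) p.2)).
  apply: (ct_comp _ cf).
  apply: (comp_continuous (u := fun p : G k * G j => (upd x p.1, p.2)) _ (@upd_continuous j)).
  apply: pair_continuous; last exact: snd_cont.
  exact: (comp_continuous (@fst_cont _ _) (@upd_section_continuous x k)).
rewrite /rE (fubini_ct (mu k) (mu j) cF); apply: eq_Rintegral => t _.
by apply: eq_Rintegral => s _; rewrite /= updC.
Qed.

Variable nu : probability (borel P) R.
Hypothesis hnu : is_haar nu.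

(** The link between [nu] and the [mu k]. Translating by [iota t] does not change the [nu]-integral,
    so one may average over [t]; after Fubini the inner integral is [rE k f] by invariance of
    [mu k]. *)
Lemma rI_rE k f : ct f -> \int[nu]_x rE k f x = \int[nu]_x f x.
Proof.
move=> cf.
have cF : ct (fun p : G k * P => f (iota p.1 + p.2)).
  apply: (ct_comp _ cf).
  apply: (comp_continuous (u := fun p : G k * P => (iota p.1, p.2)) _ (@add_continuous P)).
  apply: pair_continuous; last exact: snd_cont.
  exact: (comp_continuous (@fst_cont _ _) (@upd_section_continuous 0 k)).
have -> : \int[nu]_x f x = \int[mu k]_t \int[nu]_x f (iota t + x).
  rewrite -[LHS](rI_cst (mu k)); apply: eq_Rintegral => t _.
  by rewrite (rI_translate hnu (iota t) cf).
rewrite (fubini_ct (mu k) nu cF); apply: eq_Rintegral => x _ /=.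
rewrite /rE -(rI_translate (hmu k) (x k) (ct_section x k cf)).
by apply: eq_Rintegral => t _; rewrite iotaD addrC.
Qed.

Lemma cI_cE k f : cct f -> cI nu (cE k f) = cI nu f.
Proof.
by move=> cf; rewrite /cI /=; congr (_ +i* _); apply: rI_rE; cts.
Qed.

End product_integrals.

Lemma rI_cauchy {R : realType} {X : compactAbGroupType} (mu : probability (borel X) R)
    (f g : X -> R) : ct f -> ct g ->
  \int[mu]_x (f x * g x) <=
  Num.sqrt (\int[mu]_x (f x ^+ 2)) * Num.sqrt (\int[mu]_x (g x ^+ 2)).
Proof.
move=> cf cg; have := normc_ip_le mu (cct_real cf) (cct_real cg).
have N2E (h : X -> R) : N2 mu (fun x => (h x)%:C) = \int[mu]_x (h x ^+ 2).
  by apply: eq_Rintegral => x _; rewrite normcR real_normK ?num_real.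
rewrite !N2E; apply: le_trans.
have -> : ip mu (fun x => (f x)%:C) (fun x => (g x)%:C) = (\int[mu]_x (f x * g x))%:C.
  by rewrite -cI_real; apply: eq_cI => x; rewrite conjCR -(rmorphM (real_complex R)).
by rewrite normcR ler_norm.
Qed.

Lemma mul_cancel {K : comPzRingType} (a b c f : K) : a * b = 1 -> a * c * (f * b) = f * c.
Proof. by move=> ab; rewrite -[f * c]mul1r -ab; ring. Qed.
Lemma mul_shuffle {K : comPzRingType} (a b c d e : K) : c * (a * b) * (d * e) = a * d * (c * b * e).
Proof. by ring. Qed.

(** The Lambda(2) property for [q = 1], with squared norms. In this form the constants multiply
    under products ([L2L1_prod]); [Lambda2_L2L1] and [L2L1_Lambda2] pass from one notion to the
    other. *)
Definition L2L1 {R : realType} {X : compactAbGroupType} (mu : probability (borel X) R)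
    (L : set (X -> R[i])) (C : R) : Prop :=
  forall f, cct f -> spectrum_in mu L f -> N2 mu f <= C * (\int[mu]_x normc (f x)) ^+ 2.

Section product_spectrum.
Context {R : realType} {I : finType} (G : I -> compactAbGroupType).
Local Notation P := (prod_topology G).
Variable mu : forall j, probability (borel (G j)) R.
Hypothesis hmu : forall j, is_haar (mu j).
Variable nu : probability (borel P) R.
Hypothesis hnu : is_haar nu.
Implicit Types (k : I) (x : P).

Lemma dual_eval k (g : G k -> R[i]) : dual R (G k) g -> dual R P (fun x : P => g (x k)).
Proof.
move=> dg; split.
- by case: (cct_comp (@eval_continuous I G k) (dual_cct dg)).
- by move=> x y; rewrite dualM.
- by move=> x; rewrite dual_normc.
Qed.

Lemma dual_prod_char (g : forall j, G j -> R[i]) :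
  (forall j, dual R (G j) (g j)) -> dual R P (prod_char g).
Proof.
move=> dg; split.
- suff : cct (prod_char g) by case.
  apply: (@cct_prod _ _ _ _ _ (fun j (x : P) => g j (x j))) => j.
  exact: (dual_cct (dual_eval (dg j))).
- move=> x y; rewrite /prod_char -big_split /=; apply: eq_bigr => j _.
  by rewrite dualM.
- by move=> x; rewrite /prod_char normc_prod big1// => j _; rewrite dual_normc.
Qed.

Lemma prod_char_iota (g : forall j, G j -> R[i]) k (t : G k) :
  (forall j, dual R (G j) (g j)) -> prod_char g (iota t) = g k t.
Proof.
move=> dg; rewrite /prod_char (bigD1 k)//= big1 => [|j jk].
  by rewrite mulr1 /iota upd_in.
by rewrite /iota upd_out ?prod0 ?dual0// eq_sym.
Qed.

(** [coef g f] is the Fourier coefficient in the k-th variable alone, a function of the other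
    variables. [proj g f] projects onto the characters with k-th component [g]; its [N2] is the mass
    [b_k(g)]. *)
Definition coef k (g : G k -> R[i]) (f : P -> R[i]) : P -> R[i] :=
  cE mu k (fun y : P => f y * (g (y k))^*).
Definition proj k (g : G k -> R[i]) (f : P -> R[i]) (x : P) : R[i] := coef g f x * g (x k).

Lemma cct_coef_body k (g : G k -> R[i]) f : dual R (G k) g -> cct f ->
  cct (fun y : P => f y * (g (y k))^*).
Proof. by move=> dg cf; apply: cctM => //; apply: cctJ; exact: (dual_cct (dual_eval dg)). Qed.
Lemma cct_coef k (g : G k -> R[i]) f : dual R (G k) g -> cct f -> cct (coef g f).
Proof. by move=> dg cf; apply: cct_cE; exact: cct_coef_body. Qed.
Lemma cct_proj k (g : G k -> R[i]) f : dual R (G k) g -> cct f -> cct (proj g f).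
Proof. by move=> dg cf; apply: cctM; [exact: cct_coef|exact: (dual_cct (dual_eval dg))]. Qed.
Lemma normc_proj k (g : G k -> R[i]) f x : dual R (G k) g -> normc (proj g f x) = normc (coef g f x).
Proof. by move=> dg; rewrite /proj normcM (dual_normc _ dg) mulr1. Qed.

Lemma coefE k (g : G k -> R[i]) f x : coef g f x = fourier (mu k) (fun t => f (upd x t)) g.
Proof. by apply: eq_cI => t; rewrite upd_in. Qed.

Lemma fourier_proj_eq k (g : G k -> R[i]) f chi : dual R (G k) g -> dual R P chi -> cct f ->
  (forall t : G k, chi (iota t) = g t) -> fourier nu (proj g f) chi = fourier nu f chi.
Proof.
move=> dg dchi cf hchi.
(* The k-th components cancel, so [w] does not depend on the k-th variable and passes through
   [cE]. *)
pose w (x : P) := g (x k) * (chi x)^*.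
have wi : indep k w.
  move=> x t; rewrite /w upd_in upd_iota dualM// hchi.
  have -> : g t = g (t - x k) * g (x k) by rewrite -dualM// subrK.
  by rewrite conjcM mulrACA dual_mulcJ// mul1r.
have cb := cct_coef_body dg cf.
have cw : cct w by apply: cctM; [exact: (dual_cct (dual_eval dg))|apply: cctJ; exact: dual_cct].
transitivity (cI nu (cE mu k (fun y : P => w y * (f y * (g (y k))^*)))).
  apply: eq_cI => x; rewrite (cE_pull mu x cb wi) /proj -/(coef g f) /w.
  by rewrite [RHS]mulrC mulrA.
rewrite (cI_cE hmu hnu k (cctM cw cb)); apply: eq_cI => x.
by rewrite /w; apply: mul_cancel; exact: dual_mulcJ.
Qed.

Lemma fourier_proj_neq k (g : G k -> R[i]) f chi (t : G k) :
  dual R (G k) g -> dual R P chi -> cct f -> chi (iota t) != g t ->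
  fourier nu (proj g f) chi = 0.
Proof.
move=> dg dchi cf ht.
apply: (@cI_quasi_invariant _ _ nu hnu _ (iota t) (g t * (chi (iota t))^*)).
- by apply: cctM; [exact: cct_proj|apply: cctJ; exact: dual_cct].
- apply: contra ht => /eqP h; apply/eqP.
  have := congr1 (fun z => z * chi (iota t)) h.
  by rewrite -mulrA [_^* * _]mulrC dual_mulcJ// mulr1 mul1r => ->.
have ci : indep k (coef g f) by exact: cE_indep.
move=> x; rewrite (dualM _ _ dchi) iotaD /proj upd_in ci dualM// conjcM.
exact: mul_shuffle.
Qed.

Variable L : forall j, set (G j -> R[i]).
Hypothesis Ldual : forall j, @L j `<=` dual R (G j).

Lemma prod_spectrum_iota chi k : prod_spectrum L chi -> @L k (fun t => chi (iota t)).
Proof.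
case=> g Lg <-; suff -> : (fun t => prod_char g (iota t)) = g k by exact: Lg.
by apply/funext => t; apply: prod_char_iota => j; exact/Ldual/Lg.
Qed.

Lemma prod_spectrum_dual : prod_spectrum L `<=` dual R P.
Proof. by move=> _ [g Lg <-]; apply: dual_prod_char => j; exact/Ldual/Lg. Qed.

Lemma proj_spectrum k (g : G k -> R[i]) f : dual R (G k) g -> cct f ->
  spectrum_in nu (prod_spectrum L) f -> spectrum_in nu (prod_spectrum L) (proj g f).
Proof.
move=> dg cf hf chi dchi nL; have [h|/existsNP[t /eqP ht]] := pselect (forall t : G k, chi (iota t) = g t).
  by rewrite fourier_proj_eq// hf.
exact: fourier_proj_neq ht.
Qed.

(** An almost-everywhere statement would say nothing about the section at a given [x]. Uniqueness
    gives [proj g f = 0] at every point, and [g] has no zero. *)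
Lemma section_spectrum f k x : cct f -> spectrum_in nu (prod_spectrum L) f ->
  spectrum_in (mu k) (@L k) (fun t => f (upd x t)).
Proof.
move=> cf hf g dg nL; rewrite -coefE.
have /(_ x) : forall x, proj g f x = 0.
  apply: (fourier_uniqueness hnu (cct_proj dg cf)) => chi dchi.
  have [h|/existsNP[t /eqP ht]] := pselect (forall t : G k, chi (iota t) = g t).
    rewrite fourier_proj_eq//; apply: hf => // Lchi; apply: nL.
    by have := prod_spectrum_iota k Lchi; rewrite (_ : (fun t => chi (iota t)) = g)//; apply/funext.
  exact: fourier_proj_neq ht.
by move/eqP; rewrite mulf_eq0 (negbTE (dual_neq0 _ dg)) orbF => /eqP.
Qed.

Definition rEs (s : seq I) (f : P -> R) : P -> R := foldr (fun k => rE mu k) f s.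

Lemma ct_rEs s f : ct f -> ct (rEs s f).
Proof. by move=> cf; elim: s => //= k s IH; exact: ct_rE. Qed.
Lemma rEs_le s f g x : ct f -> ct g -> (forall y, f y <= g y) -> rEs s f x <= rEs s g x.
Proof.
move=> cf cg fg; elim: s x => [//|k s IH] x /=.
by apply: rE_le => //; exact: ct_rEs.
Qed.
Lemma rEs_ge0 s f x : (forall y, 0 <= f y) -> 0 <= rEs s f x.
Proof. by move=> f0; elim: s x => [//|k s IH] x /=; exact: rE_ge0. Qed.
Lemma rEs_indep s k f : k \in s -> indep k (rEs s f).
Proof.
elim: s => //= j s IH; rewrite inE => /orP[/eqP->|ks]; first exact: rE_indep.
by apply: rE_indep_out; exact: IH.
Qed.
Lemma rEs_pull s g f x : ct f -> (forall k, k \in s -> indep k g) ->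
  rEs s (fun y => g y * f y) x = g x * rEs s f x.
Proof.
move=> cf; elim: s x => [//|k s IH] x hg /=.
have -> : rEs s (fun y => g y * f y) = fun y => g y * rEs s f y.
  by apply/funext => y; apply: IH => j js; apply: hg; rewrite inE js orbT.
by rewrite rE_pull//; [exact: ct_rEs|apply: hg; rewrite mem_head].
Qed.
Lemma rEs_swap s k f x : ct f -> rE mu k (rEs s f) x = rEs s (rE mu k f) x.
Proof.
move=> cf; elim: s x => [//|j s IH] x /=.
rewrite rE_swap; last exact: ct_rEs.
by congr (rE mu j _ x); apply/funext.
Qed.
Lemma rI_rEs s f : ct f -> \int[nu]_x rEs s f x = \int[nu]_x f x.
Proof.
move=> cf; elim: s => [//|k s IH] /=.
by rewrite rI_rE//; exact: ct_rEs.
Qed.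

(** Minkowski's inequality by duality. Let [A] be the average of [|f|] over [s] and [a] that of
    [A^2] in the variable [j]. Then [a] is the average of [A |f|] over [j] and [s]; Cauchy-Schwarz
    in [j] and the one-variable estimate bound it by [sqrt (C j) * sqrt a] times the average of [A]
    in [j], and [sqrt a] cancels. *)
Lemma rEs_L2L1 (C : I -> R) f s x : (forall j, 0 <= C j) ->
  (forall j, L2L1 (mu j) (@L j) (C j)) -> cct f -> spectrum_in nu (prod_spectrum L) f -> uniq s ->
  rEs s (fun y => normc (f y) ^+ 2) x <= \prod_(j <- s) C j * (rEs s (fun y => normc (f y)) x) ^+ 2.
Proof.
move=> C0 hC cf hf; elim: s x => [|j s IH] x /= => [_|/andP[js us]].
  by rewrite big_nil mul1r.
rewrite big_cons.
have cn : ct (fun y => normc (f y)) by exact: cct_normc.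
have cn2 : ct (fun y => normc (f y) ^+ 2) by cts.
pose A := rEs s (fun y => normc (f y)).
have cA : ct A by exact: ct_rEs.
have A0 y : 0 <= A y by apply: rEs_ge0 => z; exact: normc_ge0.
have Pi0 : 0 <= \prod_(i <- s) C i by apply: prodr_ge0.
pose a y := rE mu j (fun y => A y ^+ 2) y.
have ca : ct a by apply: ct_rE; cts.
have a0 y : 0 <= a y by apply: rE_ge0 => z; rewrite sqr_ge0.
apply: (@le_trans _ _ (\prod_(i <- s) C i * a x)).
  have -> : \prod_(i <- s) C i * a x = rE mu j (fun y => \prod_(i <- s) C i * A y ^+ 2) x.
    have cA2 : ct (fun y => A y ^+ 2) by cts.
    by rewrite /a /rE rIZ//; exact: (ct_section x j cA2).
  by apply: rE_le => [||y]; [exact: ct_rEs|cts|exact: IH].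
suff ha : a x <= C j * (rE mu j A x) ^+ 2.
  by rewrite [C j * _]mulrC -mulrA ler_wpM2l.
pose B := rE mu j A x.
have B0 : 0 <= B by exact: rE_ge0.
have ai k : k \in s -> indep k (fun y => Num.sqrt (a y)).
  move=> ks y t; congr Num.sqrt; apply: rE_indep_out => z u.
  by rewrite /A (rEs_indep _ ks).
pose n1 y := rE mu j (fun y => normc (f y)) y.
have cn1 : ct n1 by exact: ct_rE.
have h1 : a x <= Num.sqrt (C j) * Num.sqrt (a x) * B.
  have aE : a x = rEs s (rE mu j (fun y => A y * normc (f y))) x.
    rewrite -rEs_swap; last by cts.
    congr (rE mu j _ x); apply/funext => y; rewrite rEs_pull//.
    by move=> k ks; exact: rEs_indep.
  rewrite [leLHS]aE.
  have -> : Num.sqrt (C j) * Num.sqrt (a x) * B =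
      rEs s (fun y => Num.sqrt (C j) * (Num.sqrt (a y) * n1 y)) x.
    rewrite (rEs_pull (g := fun=> Num.sqrt (C j)))//; last by cts.
    by rewrite rEs_pull// -rEs_swap// mulrA.
  apply: rEs_le; [by apply: ct_rE; cts|by cts|move=> y].
  apply: le_trans (rI_cauchy (mu j) (ct_section y j cA) (ct_section y j cn)) _.
  rewrite -/(a y) mulrCA ler_wpM2l ?sqrtr_ge0//.
  have := hC j _ (cct_section y j cf) (section_spectrum y cf hf).
  move=> /(ler_wsqrtr); rewrite sqrtrM// sqrtr_sqr ger0_norm//.
  by apply: rI_ge0 => t; exact: normc_ge0.
have [->|an0] := eqVneq (a x) 0; first by rewrite mulr_ge0// sqr_ge0.
have sa0 : 0 < Num.sqrt (a x) by rewrite sqrtr_gt0 lt_neqAle eq_sym an0 a0.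
have h2 : Num.sqrt (a x) <= Num.sqrt (C j) * B.
  by rewrite -(ler_pM2r sa0) -expr2 sqr_sqrtr// mulrAC.
rewrite -(sqr_sqrtr (a0 x)) -(sqr_sqrtr (C0 j)) -exprMn.
by rewrite ler_pXn2r// nnegrE ?sqrtr_ge0// mulr_ge0// sqrtr_ge0.
Qed.

Lemma all_indep_const (f : P -> R) : (forall k, indep k f) -> forall x y, f x = f y.
Proof.
move=> hf x y.
have key (s : seq I) (z : P) : (forall i, i \notin s -> z i = x i) -> f z = f x.
  elim: s z => [|k s IH] z hz; first by congr f; apply: prod_ext => i; rewrite hz.
  rewrite -(hf k z (x k)); apply: IH => i is'.
  have [<-|ki] := eqVneq k i; first by rewrite upd_in.
  by rewrite upd_out// hz// inE negb_or eq_sym ki.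
by apply/esym/(key (enum I)) => i; rewrite mem_enum.
Qed.

Lemma L2L1_prod (C : I -> R) : (forall j, 0 <= C j) ->
  (forall j, L2L1 (mu j) (@L j) (C j)) -> L2L1 nu (prod_spectrum L) (\prod_j C j).
Proof.
move=> C0 hC f cf hf.
have cn : ct (fun y => normc (f y)) by exact: cct_normc.
have cn2 : ct (fun y => normc (f y) ^+ 2) by cts.
have full k : k \in enum I by rewrite mem_enum.
have cst g x : ct g -> rEs (enum I) g x = \int[nu]_y g y.
  move=> cg; rewrite -(rI_rEs (enum I) cg) -[LHS](rI_cst nu); apply: eq_Rintegral => y _.
  by apply: all_indep_const => k; exact: rEs_indep.
have := rEs_L2L1 0 C0 hC cf hf (enum_uniq I).
by rewrite !cst// big_enum.
Qed.

End product_spectrum.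

(** * Marginals and the Sidon property of products *)

Section convexity.
Context {R : realType}.

Lemma expR_tangent (x : R) : 1 + x <= expR x.
Proof.
have [x1|x1] := ltP (-1) x; last first.
  by apply: le_trans (expR_ge0 x); lra.
have := le_ln1Dx x1; rewrite -ler_expR lnK// posrE; lra.
Qed.

(** The tangent of [expR] at the mean [m] lies below the graph. The weighted AM-GM inequalities
    below reduce to this one. *)
Lemma expR_jensen (J : Type) (s : seq J) (w y : J -> R) :
  (forall j, 0 <= w j) -> \sum_(j <- s) w j = 1 ->
  expR (\sum_(j <- s) w j * y j) <= \sum_(j <- s) w j * expR (y j).
Proof.
move=> w0 w1; set m := \sum_(j <- s) w j * y j.
have -> : expR m = \sum_(j <- s) w j * (expR m * (1 + (y j - m))).
  under eq_bigr => j _ do rewrite mulrCA.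
  rewrite -mulr_sumr; under eq_bigr => j _ do rewrite mulrDr mulr1 mulrBr.
  by rewrite big_split /= sumrB -mulr_suml w1 mul1r -/m subrr addr0 mulr1.
apply: ler_sum => j _; rewrite ler_wpM2l//.
have -> : expR (y j) = expR m * expR (y j - m) by rewrite -expRD addrC subrK.
by rewrite ler_wpM2l ?expR_ge0// expR_tangent.
Qed.

Lemma expR_jensen2 (w y z : R) : 0 <= w <= 1 ->
  expR (w * y + (1 - w) * z) <= w * expR y + (1 - w) * expR z.
Proof.
move=> /andP[w0 w1].
have := @expR_jensen bool [:: true; false] (fun c => if c then w else 1 - w)
  (fun c => if c then y else z).
rewrite !big_cons !big_nil !addr0; apply; last by rewrite addrC subrK.
by case; rewrite ?subr_ge0.
Qed.

Lemma powR_exp (x p : R) : 0 < x -> x `^ p = expR (p * ln x).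
Proof. by move=> x0; rewrite /powR gt_eqF. Qed.

Lemma young_powR (x a p : R) : 0 <= x -> 0 <= a -> 1 <= p ->
  x * a `^ (p - 1) <= p^-1 * x `^ p + (1 - p^-1) * a `^ p.
Proof.
move=> x0 a0 p1; have p0 : 0 < p by exact: lt_le_trans p1.
have pn0 : p != 0 by rewrite gt_eqF.
have pV1 : p^-1 <= 1 by rewrite invf_le1.
have pV0 : 0 <= p^-1 by rewrite invr_ge0 ltW.
have R0 : 0 <= (1 - p^-1) * a `^ p by rewrite mulr_ge0 ?subr_ge0// powR_ge0.
have [->|xn] := eqVneq x 0; first by rewrite mul0r addr_ge0// mulr_ge0// powR_ge0.
have xp : 0 < x by rewrite lt_neqAle eq_sym xn.
have [->|an] := eqVneq a 0.
  (* [powR 0 0] is 1, so the case [p = 1] stands apart. *)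
  have [->|p1'] := eqVneq p 1.
    by rewrite subrr powRr0 invr1 subrr mul0r addr0 mulr1 mul1r powRr1.
  rewrite powR0 ?subr_eq0// mulr0 addr_ge0// ?mulr_ge0 ?powR_ge0 ?subr_ge0//.
have ap : 0 < a by rewrite lt_neqAle eq_sym an.
have := @expR_jensen2 p^-1 (p * ln x) (p * ln a).
rewrite pV0 pV1 => /(_ isT); rewrite !powR_exp//; apply: le_trans.
rewrite -{1}(lnK (x := x)) ?posrE// -expRD ler_expR le_eqVlt; apply/orP; left; apply/eqP.
by rewrite /=; field.
Qed.

(* Jensen for [exp] twice: at weights [w] and then at weights [s, 1 - s]. *)
Lemma marginal_young (J : finType) (s : R) (w t u v : J -> R) (b : R) (c : J -> R) :
  0 <= s <= 1 -> (forall j, 0 <= w j) -> \sum_j w j = 1 ->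
  (forall j, u j = w j * (1 - t j)) -> (forall j, v j * (1 - s) = u j * s) ->
  0 < b -> (forall j, 0 < c j) ->
  b `^ s <= s * \sum_j w j * (b * c j `^ (t j - 1)) + (1 - s) * \prod_j c j `^ (v j).
Proof.
move=> s01 w0 w1 hu hv b0 c0.
pose y j := ln b + (t j - 1) * ln (c j).
have -> : \prod_j c j `^ (v j) = expR (\sum_j v j * ln (c j)).
  by rewrite expR_sum; apply: eq_bigr => j _; rewrite powR_exp.
have h1 : expR (\sum_j w j * y j) <= \sum_j w j * (b * c j `^ (t j - 1)).
  apply: le_trans (expR_jensen y w0 w1) _; apply: ler_sum => j _.
  by rewrite /y expRD lnK ?posrE// powR_exp.
have /andP[s0 s1] := s01.
apply: le_trans (lerD (ler_wpM2l s0 h1) (lexx _)).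
apply: le_trans (expR_jensen2 _ _ s01).
rewrite powR_exp// ler_expR le_eqVlt; apply/orP; left; apply/eqP.
rewrite !mulr_sumr; have -> : s * ln b = \sum_j w j * (s * ln b).
  by rewrite -mulr_suml w1 mul1r.
rewrite -big_split /=; apply: eq_bigr => j _.
have -> : (1 - s) * (v j * ln (c j)) = w j * (1 - t j) * s * ln (c j).
  by rewrite mulrA [(1 - s) * _]mulrC hv hu.
by rewrite /y; ring.
Qed.

Lemma sum_by_fiber (A B : eqType) (X : seq A) (k : A -> B) (F : A -> R) :
  \sum_(a <- X) F a = \sum_(c <- undup (map k X)) \sum_(a <- X | k a == c) F a.
Proof.
rewrite (exchange_big_dep xpredT)//= big_seq [RHS]big_seq; apply: eq_bigr => a aX.
rewrite (eq_bigl (fun c => c == k a)); last by move=> c; rewrite eq_sym.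
rewrite big_mkcond (bigD1_seq (k a)) ?undup_uniq ?mem_undup ?map_f//= eqxx.
by rewrite big1 ?addr0// => c /negbTE ->.
Qed.

(** On the fibre over [g] the power of [c] is constant, and the [b a] add up to at most [c g]. *)
Lemma marginal_sum (A B : eqType) (X : seq A) (k : A -> B) (b : A -> R) (c : B -> R) (t : R) :
  0 < t -> (forall g, 0 <= c g) -> (forall g, \sum_(a <- X | k a == g) b a <= c g) ->
  \sum_(a <- X) b a * c (k a) `^ (t - 1) <= \sum_(g <- undup (map k X)) c g `^ t.
Proof.
move=> t0 c0 hc; rewrite (sum_by_fiber _ k); apply: ler_sum => g _.
rewrite (eq_bigr (fun a => b a * c g `^ (t - 1))) => [|a /eqP->//].
rewrite -mulr_suml -[leRHS]mulr_powRB1//.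
by rewrite ler_wpM2r// powR_ge0.
Qed.

(** [D] is left abstract because it is bounded in two ways: by a product of sums for a full product
    of sets ([sum_prod_le]), and by Finner's inequality for fractional sets. *)
Lemma marginal_inequality (J : finType) (A : eqType) (B : J -> eqType) (X : seq A)
    (k : forall j, A -> B j) (b : A -> R) (c : forall j, B j -> R)
    (s : R) (w t u v : J -> R) (M D : R) :
  0 < s <= 1 -> (forall j, 0 <= w j) -> \sum_j w j = 1 ->
  (forall j, u j = w j * (1 - t j)) -> (forall j, v j * (1 - s) = u j * s) ->
  (forall j, 0 < t j) ->
  (forall a, 0 <= b a) -> (forall j g, 0 <= c j g) ->
  (forall j g, \sum_(a <- X | k j a == g) b a <= c j g) ->
  (forall j, \sum_(g <- undup (map (k j) X)) c j g `^ t j <= M) ->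
  \sum_(a <- X) \prod_j c j (k j a) `^ v j <= D ->
  \sum_(a <- X) b a `^ s <= s * M + (1 - s) * D.
Proof.
move=> /andP[s0 s1] w0 w1 hu hv t0 b0 c0 hbc hM hD.
have s01 : 0 <= s <= 1 by rewrite ltW.
have pr0 a : 0 <= \prod_j c j (k j a) `^ v j by apply: prodr_ge0 => j _; exact: powR_ge0.
have pt a : a \in X -> b a `^ s <=
    s * \sum_j w j * (b a * c j (k j a) `^ (t j - 1)) + (1 - s) * \prod_j c j (k j a) `^ v j.
  move=> aX; have [->|bn] := eqVneq (b a) 0.
    rewrite powR0 ?gt_eqF// addr_ge0//; last by rewrite mulr_ge0 ?subr_ge0.
    by apply: mulr_ge0; [exact: ltW|apply: sumr_ge0 => j _; rewrite mul0r mulr0].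
  have bp : 0 < b a by rewrite lt_neqAle eq_sym bn b0.
  (* [a] lies in its own fibre, so each marginal at [a] is at least [b a > 0]. *)
  apply: marginal_young => // j; apply: lt_le_trans bp _.
  apply: le_trans (hbc j (k j a)); rewrite (big_rem a)//= eqxx lerDl sumr_ge0//.
apply: (@le_trans _ _ (\sum_(a <- X) (s * \sum_j w j * (b a * c j (k j a) `^ (t j - 1)) +
    (1 - s) * \prod_j c j (k j a) `^ v j))).
  by rewrite big_seq [leRHS]big_seq; apply: ler_sum.
rewrite big_split /= -!mulr_sumr; apply: lerD; last by rewrite ler_wpM2l ?subr_ge0.
apply: ler_wpM2l; [exact: ltW|rewrite exchange_big /=].
have -> : M = \sum_j w j * M by rewrite -mulr_suml w1 mul1r.
apply: ler_sum => j _; rewrite -mulr_sumr ler_wpM2l//.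
by apply: le_trans (hM j); exact: marginal_sum.
Qed.

End convexity.

(** * The Sidon and Lambda(2) properties in terms of finite sums and integrals *)

Section sidon_sums.
Context {R : realType} {X : compactAbGroupType}.
Variable mu : probability (borel X) R.
Implicit Types (f g : X -> R[i]) (L : set (X -> R[i])).

Lemma normc_le_sup f x : cct f -> normc (f x) <= sup_norm f.
Proof.
move=> cf; have [M hM] := cct_bounded cf.
by apply: ub_le_sup; [exists M => _ [y _ <-]|exists x].
Qed.
Lemma sup_norm_le f M : (forall x, normc (f x) <= M) -> sup_norm f <= M.
Proof.
by move=> fM; apply: ge_sup => [|_ [y _ <-]//]; exists (normc (f 0)), 0.
Qed.
Lemma sup_norm_ge0 f : cct f -> 0 <= sup_norm f.
Proof. by move=> /(normc_le_sup 0); apply: le_trans; exact: normc_ge0. Qed.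

Lemma fourier_lp_norm_le f (p K : R) : 0 < p -> 0 <= K ->
  (forall s : seq (X -> R[i]), uniq s -> (forall g, g \in s -> dual R X g) ->
     \sum_(g <- s) normc (fourier mu f g) `^ p <= K `^ p) ->
  (fourier_lp_norm mu p f <= K%:E)%E.
Proof.
move=> p0 K0 h; rewrite /fourier_lp_norm.
have -> : K%:E = ((K `^ p)%:E `^ p^-1)%E.
  by rewrite poweR_EFin -powRrM mulfV ?gt_eqF// powRr1.
have e0 : (0 <= \esum_(g in dual R X) (normc (fourier mu f g) `^ p)%:E)%E.
  by apply: esum_ge0 => g _; rewrite lee_fin powR_ge0.
apply: gt0_ler_poweR; rewrite ?invr_ge0 ?(ltW p0)//.
- by rewrite in_itv/= leey e0.
- by rewrite in_itv/= leey lee_fin powR_ge0.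
apply: ge_ereal_sup => _ [A [fA Ad] <-].
have [s us sA] : exists2 s : seq (X -> R[i]), uniq s & A = [set` s].
  move/finite_seqP: (fA) => [t tA]; exists (undup t); first exact: undup_uniq.
  by rewrite tA; apply/seteqP; split => y /=; rewrite mem_undup.
rewrite sA -fsbig_seq// sumEFin lee_fin; apply: h => // g gs.
by apply: Ad; rewrite sA.
Qed.

Lemma fourier_lp_norm_ge f (p K : R) (s : seq (X -> R[i])) : 0 < p -> 0 <= K ->
  (fourier_lp_norm mu p f <= K%:E)%E -> uniq s -> (forall g, g \in s -> dual R X g) ->
  \sum_(g <- s) normc (fourier mu f g) `^ p <= K `^ p.
Proof.
move=> p0 K0 hK us sd; rewrite -lee_fin.
have e0 : (0 <= \esum_(g in dual R X) (normc (fourier mu f g) `^ p)%:E)%E.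
  by apply: esum_ge0 => g _; rewrite lee_fin powR_ge0.
apply: (@le_trans _ _ (\esum_(g in dual R X) (normc (fourier mu f g) `^ p)%:E)).
  apply: esum_ge; exists [set` s].
    by split; [exact: finite_seq|move=> g /= /sd].
  by rewrite -fsbig_seq// sumEFin.
have -> : (\esum_(g in dual R X) (normc (fourier mu f g) `^ p)%:E =
    (fourier_lp_norm mu p f) `^ p)%E.
  by rewrite /fourier_lp_norm -poweRrM mulVf ?gt_eqF// poweRe1.
rewrite -poweR_EFin; apply: gt0_ler_poweR; rewrite ?(ltW p0)//.
- by rewrite in_itv/= leey poweR_ge0.
- by rewrite in_itv/= leey andbT lee_fin.
Qed.

Lemma sidon_intro L (p C : R) : 0 < p ->
  (forall f, cct f -> spectrum_in mu L f -> (forall x, normc (f x) <= 1) ->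
     forall s : seq (X -> R[i]), uniq s -> (forall g, g \in s -> dual R X g) ->
     \sum_(g <- s) normc (fourier mu f g) `^ p <= C) ->
  sidon mu p L.
Proof.
(* The Sidon constant has to be positive, whereas [C] is any real number. *)
move=> p0 h; pose C' := 1 + `|C|.
have C'0 : 0 < C' by rewrite ltr_wpDr.
exists (C' `^ p^-1); first exact: powR_gt0.
move=> f /Cct cf hf; have M0 := sup_norm_ge0 cf.
apply: fourier_lp_norm_le => //; first by rewrite mulr_ge0// powR_ge0.
move=> s us sd; rewrite powRM ?powR_ge0// -powRrM mulVf ?gt_eqF// powRr1 ?(ltW C'0)//.
have [M00|Mn] := eqVneq (sup_norm f) 0.
  have f0 x : f x = 0.
    apply/eqP; rewrite -normc_eq0 eq_le normc_ge0 andbT.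
    by have := normc_le_sup x cf; rewrite M00.
  rewrite big1 => [|g _]; first by rewrite mulr_ge0 ?powR_ge0// ltW.
  have -> : fourier mu f g = 0.
    by rewrite -[RHS](cI_cst mu); apply: eq_cI => x; rewrite f0 mul0r.
  by rewrite normc0 powR0// gt_eqF.
have Mp : 0 < sup_norm f by rewrite lt_neqAle eq_sym Mn.
pose c : R[i] := ((sup_norm f)^-1)%:C.
have nc : normc c = (sup_norm f)^-1 by rewrite normcR ger0_norm// invr_ge0.
have [F [cF FE0 FE]] : exists F, [/\ cct F, forall x, F x = c * f x &
    forall g, dual R X g -> fourier mu F g = c * fourier mu f g].
  exists (fun x => c * f x); split => //; first by apply: cctM => //; exact: cct_cst.
  move=> g dg; apply: (etrans _ (cIZ mu c (cctM cf (cctJ (dual_cct dg))))).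
  by apply: eq_cI => x; rewrite mulrA.
have hF : \sum_(g <- s) normc (fourier mu F g) `^ p <= C.
  apply: h => //.
  - by move=> g dg nL; rewrite (FE g dg) (hf g dg nL) mulr0.
  - by move=> x; rewrite FE0 normcM nc mulrC ler_pdivrMr// mul1r normc_le_sup.
have hC : ((sup_norm f)^-1) `^ p * \sum_(g <- s) normc (fourier mu f g) `^ p <= C.
  apply: le_trans hF; rewrite mulr_sumr le_eqVlt; apply/orP; left; apply/eqP.
  rewrite big_seq [RHS]big_seq; apply: eq_bigr => g gs.
  by rewrite (FE g (sd g gs)) normcM nc powRM ?invr_ge0// normc_ge0.
have SM : ((sup_norm f)^-1) `^ p = (sup_norm f `^ p)^-1 by rewrite -powR_inv1// -powRrM mulN1r powRN.
rewrite SM mulrC ler_pdivrMr ?powR_gt0// in hC.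
apply: le_trans hC _; rewrite ler_wpM2r ?powR_ge0//.
by apply: le_trans (ler_norm C) _; rewrite /C' lerDr.
Qed.

Lemma sidon_elim L (p : R) : 0 < p -> sidon mu p L -> exists2 K, 0 <= K &
  forall f, cct f -> spectrum_in mu L f -> (forall x, normc (f x) <= 1) ->
  forall s : seq (X -> R[i]), uniq s -> (forall g, g \in s -> dual R X g) ->
  \sum_(g <- s) normc (fourier mu f g) `^ p <= K.
Proof.
move=> p0 [k k0 hk]; exists (k `^ p); first exact: powR_ge0.
move=> f cf hf f1 s us sd; apply: fourier_lp_norm_ge => //; first exact: ltW.
have fc : continuous (f : X -> R[i]^o) by case: cf.
apply: le_trans (hk f fc hf) _.
by rewrite lee_fin -[leRHS]mulr1 ler_wpM2l ?(ltW k0)//; exact: sup_norm_le.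
Qed.

Lemma Lp_norm2E f : cct f -> Lp_norm mu 2 f = ((N2 mu f) `^ 2^-1)%:E.
Proof.
move=> cf; rewrite /Lp_norm unlock -poweR_EFin; congr (_ `^ _)%E.
have cn : ct (fun x => normc (f x) ^+ 2) by cts.
rewrite /N2 /Rintegral fineK.
  apply: eq_integral => x _ /=; rewrite ger0_norm ?normc_ge0//.
  by rewrite powR_mulrn ?normc_ge0.
by apply: integrable_fin_num => //; exact: (ct_integrable mu cn).
Qed.

Lemma Lp_norm1E f : cct f -> Lp_norm mu 1 f = (\int[mu]_x normc (f x))%:E.
Proof.
move=> cf; rewrite /Lp_norm Lnorm1 /Rintegral fineK.
  by apply: eq_integral => x _ /=; rewrite ger0_norm ?normc_ge0.
by apply: integrable_fin_num => //; exact: (ct_integrable mu (cct_normc cf)).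
Qed.

Lemma L2L1_Lambda2 L C : 0 <= C -> L2L1 mu L C -> Lambda2 mu L.
Proof.
move=> C0 hC; exists 1; first by rewrite lexx ltr1n.
exists (Num.sqrt C + 1); first by rewrite ltr_wpDl ?sqrtr_ge0.
move=> f /Cct cf hf; rewrite Lp_norm2E// Lp_norm1E// -EFinM lee_fin powR12_sqrt ?N2_ge0//.
have I0 : 0 <= \int[mu]_x normc (f x) by apply: rI_ge0 => x; exact: normc_ge0.
have := ler_wsqrtr (hC f cf hf); rewrite sqrtrM// sqrtr_sqr ger0_norm// => h.
by apply: le_trans h _; rewrite ler_wpM2r// lerDl.
Qed.

(* Interpolation of [L^q] between [L^1] and [L^2], through the pointwise form
   [y^q <= B^(2-q) A^(q-1) ((2-q) y/B + (q-1) y^2/A)] of weighted AM-GM. *)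
Lemma Lq_interpolation f (q : R) : cct f -> 1 <= q < 2 ->
  0 < N2 mu f -> 0 < \int[mu]_x normc (f x) ->
  (\int[mu]_x (`|(normc (f x))%:E| `^ q) <=
   ((\int[mu]_x normc (f x)) `^ (2 - q) * (N2 mu f) `^ (q - 1))%:E)%E.
Proof.
move=> cf /andP[q1 q2]; set A := N2 mu f; set B := Rintegral _ _ _ => A0 B0.
have cn := cct_normc cf.
have cn2 : ct (fun x => normc (f x) ^+ 2) by cts.
pose Q := B `^ (2 - q) * A `^ (q - 1).
have pt x : normc (f x) `^ q <= Q * ((2 - q) / B * normc (f x) + (q - 1) / A * normc (f x) ^+ 2).
  have Q0 : 0 <= Q by rewrite mulr_ge0 ?powR_ge0.
  set y := normc (f x); have y0 : 0 <= y := normc_ge0 _.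
  have [->|yn] := eqVneq y 0.
    rewrite powR0 ?expr0n/= ?mulr0 ?addr0 ?mulr0//.
    by rewrite gt_eqF// (lt_le_trans _ q1).
  have yp : 0 < y by rewrite lt_neqAle eq_sym yn.
  have := @expR_jensen2 R (2 - q) (ln y - ln B) (2 * ln y - ln A).
  have -> : 1 - (2 - q) = q - 1 by ring.
  have -> : expR (ln y - ln B) = y / B by rewrite expRB !lnK ?posrE.
  have -> : expR (2 * ln y - ln A) = y ^+ 2 / A.
    by rewrite expRB expRM_natl !lnK ?posrE.
  move=> /(_ _)/wrap[]; first by apply/andP; lra.
  have -> : (2 - q) / B * y + (q - 1) / A * y ^+ 2 = (2 - q) * (y / B) + (q - 1) * (y ^+ 2 / A) by ring.
  move=> h; apply: le_trans (ler_wpM2l Q0 h).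
  rewrite /Q !powR_exp// -!expRD ler_expR le_eqVlt; apply/orP; left; apply/eqP; ring.
pose g x := Q * ((2 - q) / B * normc (f x) + (q - 1) / A * normc (f x) ^+ 2).
have cg : ct g by rewrite /g; cts.
have Ig : \int[mu]_x g x = Q.
  rewrite /g rIZ; last by cts.
  rewrite rID; [|by cts|by cts]; rewrite !rIZ// -/B -/(N2 mu f) -/A.
  by rewrite !mulfVK ?gt_eqF// [_ + _](_ : _ = 1) ?mulr1//; ring.
have ig : mu.-integrable setT (EFin \o g) := ct_integrable mu cg.
have -> : Q%:E = (\int[mu]_x (g x)%:E)%E.
  by rewrite -Ig /Rintegral fineK//; exact: integrable_fin_num.
apply: ge0_le_integral => //.
- by move=> x _; exact: poweR_ge0.
- rewrite (_ : (fun x => _) = EFin \o (fun x : borel X => `|normc (f x)| `^ q))//.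
  apply/measurable_EFinP; apply: (@measurableT_comp _ _ _ _ _ _ (@powR R ^~ q)) => //.
  by apply: measurableT_comp => //; exact: (ct_measurable cn).
- by apply/measurable_EFinP; exact: ct_measurable.
- by move=> x _; rewrite /= lee_fin ger0_norm ?normc_ge0//; exact: pt.
Qed.

Hypothesis haar : is_haar mu.

(** Interpolation turns the hypothesis into [A^(1/2) <= k (B^(2-q) A^(q-1))^(1/q)]. Since [q < 2]
    this can be solved for [A], with the result [A <= k^(2q/(2-q)) B^2]; the computation is linear
    in the logarithms [a], [b], [c]. *)
Lemma Lambda2_L2L1 L : Lambda2 mu L -> exists2 C, 0 <= C & L2L1 mu L C.
Proof.
case=> q q12 [k k0 hk].
have /andP[q1 q2] := q12.
exists (k `^ (2 * q / (2 - q))); first exact: powR_ge0.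
move=> f cf hf; set A := N2 mu f; set B := Rintegral _ _ _.
have B0 : 0 <= B by apply: rI_ge0 => x; exact: normc_ge0.
have [A0|An] := eqVneq A 0; first by rewrite A0 mulr_ge0 ?powR_ge0// sqr_ge0.
have Ap : 0 < A by rewrite lt_neqAle eq_sym An N2_ge0.
have Bp : 0 < B.
  rewrite lt_neqAle B0 andbT eq_sym; apply: contra An => /eqP Bz.
  have f0 := rI_eq0 haar (cct_normc cf) (fun x => normc_ge0 _) Bz.
  apply/eqP; rewrite /A /N2; under eq_Rintegral do rewrite f0 expr0n/=.
  exact: rI_cst.
have fc : continuous (f : X -> R[i]^o) by case: cf.
have := hk f fc hf; rewrite Lp_norm2E// => h.
have : (Lp_norm mu q f <= ((B `^ (2 - q) * A `^ (q - 1)) `^ q^-1)%:E)%E.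
  rewrite /Lp_norm unlock -poweR_EFin; apply: gt0_ler_poweR.
  - by rewrite invr_ge0 (le_trans _ q1).
  - by rewrite in_itv/= leey integral_ge0// => x _; exact: poweR_ge0.
  - by rewrite in_itv/= leey lee_fin mulr_ge0 ?powR_ge0.
  - exact: Lq_interpolation.
move=> h2; have : (k%:E * Lp_norm mu q f <= k%:E * ((B `^ (2 - q) * A `^ (q - 1)) `^ q^-1)%:E)%E.
  by apply: lee_wpmul2l => //; rewrite lee_fin ltW.
move=> /(le_trans h); rewrite -EFinM lee_fin -/A.
have q0 : 0 < q by lra.
have qn : q != 0 by rewrite gt_eqF.
have dq : 0 < 2 - q by lra.
have dn : 2 - q != 0 by rewrite gt_eqF.
have [a Aa] : exists a, A = expR a by exists (ln A); rewrite lnK.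
have [b Bb] : exists b, B = expR b by exists (ln B); rewrite lnK.
have [c kc] : exists c, k = expR c by exists (ln k); rewrite lnK.
rewrite Aa Bb kc -!expRM -expRM_natl -!expRD -expRM -expRD !ler_expR => hh.
rewrite [c * _]mulrC.
have -> : 2 * q / (2 - q) * c + 2 * b = (2 * q / (2 - q)) * (c + (2 - q) / q * b) by field; rewrite qn dn.
rewrite [leLHS](_ : a = (2 * q / (2 - q)) * ((2 - q) / (2 * q) * a)); last by field; rewrite qn dn.
rewrite ler_wpM2l ?divr_ge0 ?mulr_ge0 ?(ltW q0) ?(ltW dq)//.
have -> : (2 - q) / (2 * q) * a = 2^-1 * a - q^-1 * ((q - 1) * a) by field.
rewrite lerBlDr [2^-1 * a]mulrC; apply: le_trans hh _.
by rewrite le_eqVlt; apply/orP; left; apply/eqP; field.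
Qed.

End sidon_sums.

Lemma sum_uniq_le {R : realType} (T : finType) (s : seq T) (H : T -> R) :
  uniq s -> (forall x, 0 <= H x) -> \sum_(x <- s) H x <= \sum_x H x.
Proof.
move=> us H0; rewrite big_uniq//= big_mkcond /=; apply: ler_sum => x _.
by case: ifP.
Qed.

(** Expanding the product of sums gives one nonnegative term per choice of values; the left side is
    the subsum over the choices made by elements of [X], distinct by injectivity. *)
Lemma sum_prod_le {R : realType} (J : finType) (A : eqType) (B : J -> eqType) (X : seq A)
    (k : forall j, A -> B j) (F : forall j, B j -> R) :
  uniq X -> {in X &, forall a a', (forall j, k j a = k j a') -> a = a'} ->
  (forall j g, 0 <= F j g) ->
  \sum_(a <- X) \prod_j F j (k j a) <= \prod_j \sum_(g <- undup (map (k j) X)) F j g.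
Proof.
move=> uX inj F0; case: X uX inj => [|a0 X'].
  by move=> _ _; rewrite big_nil prodr_ge0// => j _; rewrite sumr_ge0.
set X := a0 :: X' => uX inj; pose N := size X'.
pose s j := undup (map (k j) X).
have sN j : (size (s j) <= N.+1)%N.
  by apply: leq_trans (size_undup _) _; rewrite size_map.
(* The types [B j] differ, so values are replaced by their positions in [s j], with zeros up to the
   common length [N.+1]. *)
pose F' j (i : 'I_N.+1) := if (i < size (s j))%N then F j (nth (k j a0) (s j) i) else 0.
have F'0 j i : 0 <= F' j i by rewrite /F'; case: ifP.
have sumF j : \sum_(g <- s j) F j g = \sum_i F' j i.
  rewrite (big_nth (k j a0)) big_mkord (big_ord_widen _ (fun i => F j (nth (k j a0) (s j) i)) (sN j)).
  by rewrite big_mkcond.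
under [leRHS]eq_bigr => j _ do rewrite sumF.
rewrite bigA_distr_bigA /=.
pose phi a : {ffun J -> 'I_N.+1} := [ffun j => inord (index (k j a) (s j))].
have ks j a : a \in X -> k j a \in s j by move=> aX; rewrite mem_undup map_f.
have phiE j a : a \in X -> phi a j = index (k j a) (s j) :> nat.
  move=> aX; rewrite ffunE inordK// ltnS -ltnS; apply: leq_trans (sN j).
  by rewrite index_mem ks.
apply: (@le_trans _ _ (\sum_(f <- map phi X) \prod_j F' j (f j))).
  rewrite big_map big_seq [leRHS]big_seq; apply: ler_sum => a aX.
  rewrite le_eqVlt; apply/orP; left; apply/eqP; apply: eq_bigr => j _.
  by rewrite /F' phiE// index_mem ks// nth_index// ks.
apply: sum_uniq_le; last by move=> f; apply: prodr_ge0.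
rewrite map_inj_in_uniq// => a a' aX a'X /ffunP h; apply: inj => // j.
have := congr1 (@nat_of_ord _) (h j); rewrite !phiE// => hi.
by rewrite -(nth_index (k j a0) (ks j a aX)) hi nth_index// ks.
Qed.

Lemma sum_over_spectrum {R : realType} {X : compactAbGroupType} (mu : probability (borel X) R)
    (L : set (X -> R[i])) f (s : seq (X -> R[i])) (q : R) :
  spectrum_in mu L f -> 0 < q -> (forall g, g \in s -> dual R X g) ->
  \sum_(g <- s) normc (fourier mu f g) `^ q =
  \sum_(g <- [seq g <- s | `[< L g >]]) (normc (fourier mu f g) ^+ 2) `^ (q / 2).
Proof.
move=> hf q0 sd.
rewrite big_filter [RHS]big_mkcond big_seq [RHS]big_seq; apply: eq_bigr => g gs.
case: asboolP => hg.
  by rewrite -(powR_mulrn 2 (normc_ge0 (fourier mu f g))) -powRrM mulrCA divff ?mulr1 ?pnatr_eq0.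
by rewrite hf//; [rewrite normc0 powR0// gt_eqF|exact: sd].
Qed.

(** * The marginal masses of a function with spectrum in the product *)

Section marginals.
Context {R : realType} {I : finType} (G : I -> compactAbGroupType).
Local Notation P := (prod_topology G).
Variable mu : forall j, probability (borel (G j)) R.
Hypothesis hmu : forall j, is_haar (mu j).
Variable nu : probability (borel P) R.
Hypothesis hnu : is_haar nu.
Variable L : forall j, set (G j -> R[i]).
Hypothesis Ldual : forall j, @L j `<=` dual R (G j).

Lemma proj_bessel k (g : G k -> R[i]) f (s : seq (P -> R[i])) : dual R (G k) g -> cct f ->
  uniq s -> (forall chi, chi \in s -> dual R P chi /\ (fun t : G k => chi (iota t)) = g) ->
  \sum_(chi <- s) normc (fourier nu f chi) ^+ 2 <= N2 nu (proj mu g f).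
Proof.
move=> dg cf us hs.
apply: (@le_trans _ _ (\sum_(chi <- s) normc (ip nu (proj mu g f) chi) ^+ 2)).
  rewrite le_eqVlt; apply/orP; left; apply/eqP.
  rewrite big_seq [RHS]big_seq; apply: eq_bigr => chi /hs[dchi chig].
  rewrite -(fourier_proj_eq hmu hnu dg dchi cf)// => t.
  by rewrite -chig.
apply: (bessel (e := fun chi => chi)) => //.
- by move=> chi /hs[dchi _]; exact: dual_cct.
- exact: cct_proj.
- by move=> chi psi /hs[dchi _] /hs[dpsi _]; apply: dual_ortho; rewrite ?inE.
Qed.

Lemma marginal_bound (p : I -> R) : (forall j, 1 <= p j) ->
  (forall j, sidon (mu j) (p j) (@L j) /\ Lambda2 (mu j) (@L j)) ->
  exists2 C, 0 <= C & forall f, cct f -> spectrum_in nu (prod_spectrum L) f ->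
    (forall x, normc (f x) <= 1) ->
    forall k (s : seq (G k -> R[i])), uniq s -> (forall g, g \in s -> L g) ->
    \sum_(g <- s) N2 nu (proj mu g f) `^ (p k / 2) <= C.
Proof.
move=> p1 hL.
have p0 j : 0 < p j by exact: lt_le_trans (p1 j).
have /choice[D hD] : forall j, exists D, 0 <= D /\ L2L1 (mu j) (@L j) D.
  by move=> j; have [D D0 hD] := Lambda2_L2L1 (hmu j) (proj2 (hL j)); exists D.
have /choice[K hK] : forall j, exists K, 0 <= K /\
    forall f, cct f -> spectrum_in (mu j) (@L j) f -> (forall x, normc (f x) <= 1) ->
    forall s : seq (G j -> R[i]), uniq s -> (forall g, g \in s -> dual R (G j) g) ->
    \sum_(g <- s) normc (fourier (mu j) f g) `^ p j <= K.
  by move=> j; have [K K0 h] := sidon_elim (p0 j) (proj1 (hL j)); exists K.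
have D0 j : 0 <= D j by case: (hD j).
have K0 j : 0 <= K j by case: (hK j).
pose DD := \prod_j D j.
have DD0 : 0 <= DD by apply: prodr_ge0.
have hDD := L2L1_prod hmu hnu Ldual D0 (fun j => proj2 (hD j)).
exists (\sum_j DD `^ (p j / 2) * K j).
  by apply: sumr_ge0 => j _; rewrite mulr_ge0// powR_ge0.
move=> f cf hf f1 k s us sL.
have sd g : g \in s -> dual R (G k) g by move=> /sL /Ldual.
pose a (g : G k -> R[i]) := \int[nu]_x normc (coef mu g f x).
have a0 g : 0 <= a g by apply: rI_ge0 => x; exact: normc_ge0.
have step1 g : g \in s -> N2 nu (proj mu g f) `^ (p k / 2) <= DD `^ (p k / 2) * a g `^ p k.
  move=> gs; have dg := sd _ gs.
  have := hDD _ (cct_proj mu dg cf) (proj_spectrum hmu hnu (L := L) dg cf hf).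
  have -> : \int[nu]_x normc (proj mu g f x) = a g.
    by apply: eq_Rintegral => x _; exact: normc_proj.
  have tk0 : 0 <= p k / 2 by apply: divr_ge0 => //; exact: ltW.
  move=> h; apply: (@le_trans _ _ ((DD * a g ^+ 2) `^ (p k / 2))).
    by apply: ge0_ler_powR => //; rewrite nnegrE ?N2_ge0// mulr_ge0// sqr_ge0.
  rewrite powRM ?sqr_ge0//.
  have -> : (a g ^+ 2) `^ (p k / 2) = a g `^ p k; last by [].
  by rewrite -powR_mulrn// -powRrM mulrCA divff ?mulr1 ?pnatr_eq0.
(* Jensen's inequality in a form that keeps the integrands continuous: [T] is the integral of
   [sum_g a g ^ (p - 1) |coef g f|], Young's inequality and the Sidon bound on each section estimate
   the integrand by a constant, and the term in [T] is absorbed on the left. *)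
have step2 : \sum_(g <- s) a g `^ p k <= K k.
  set T := \sum_(g <- s) _.
  have pV0 : 0 <= (p k)^-1 by rewrite invr_ge0 ltW.
  have pV1 : (p k)^-1 <= 1 by rewrite invf_le1.
  pose W g x := if g \in s then a g `^ (p k - 1) * normc (coef mu g f x) else 0.
  have cW g : ct (W g).
    rewrite /W; case: (boolP (g \in s)) => gs; last exact: ct_cst.
    apply: ctM; first exact: ct_cst.
    exact: (cct_normc (cct_coef mu (sd g gs) cf)).
  have TE : T = \int[nu]_x (\sum_(g <- s) W g x).
    rewrite rI_sum// /T big_seq [RHS]big_seq; apply: eq_bigr => g gs.
    rewrite /W gs rIZ; last exact: (cct_normc (cct_coef mu (sd g gs) cf)).
    by rewrite -/(a g) mulrC mulr_powRB1.
  have TK : T <= (p k)^-1 * K k + (1 - (p k)^-1) * T.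
    rewrite {1}TE -[leRHS](rI_cst nu); apply: rI_le; [exact: ct_sum|exact: ct_cst|move=> x].
    rewrite big_seq (eq_bigr (fun g => a g `^ (p k - 1) * normc (coef mu g f x))); last first.
      by move=> g gs; rewrite /W gs.
    rewrite -big_seq; apply: (@le_trans _ _ (\sum_(g <- s)
        ((p k)^-1 * normc (coef mu g f x) `^ p k + (1 - (p k)^-1) * a g `^ p k))).
      by apply: ler_sum => g _; rewrite mulrC; apply: young_powR => //; exact: normc_ge0.
    rewrite big_split /= -!mulr_sumr lerD2r ler_wpM2l//.
    case: (hK k) => _ /(_ (fun t => f (upd x t)) (cct_section x k cf)
      (section_spectrum hmu hnu Ldual x cf hf) (fun t => f1 _) s us sd).
    apply: le_trans; rewrite le_eqVlt; apply/orP; left; apply/eqP.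
    by apply: eq_bigr => g _; rewrite -(coefE mu g f x).
  have pp : 0 < (p k)^-1 by rewrite invr_gt0.
  have : (p k)^-1 * T <= (p k)^-1 * K k by lra.
  by rewrite ler_pM2l.
apply: (@le_trans _ _ (DD `^ (p k / 2) * K k)).
  apply: (@le_trans _ _ (\sum_(g <- s) DD `^ (p k / 2) * a g `^ p k)).
    by rewrite big_seq [leRHS]big_seq; apply: ler_sum.
  by rewrite -mulr_sumr ler_wpM2l ?powR_ge0.
rewrite (bigD1 k)//= lerDl; apply: sumr_ge0 => j _.
by rewrite mulr_ge0// powR_ge0.
Qed.

Lemma prod_spectrum_inj chi psi : prod_spectrum L chi -> prod_spectrum L psi ->
  (forall j, (fun t : G j => chi (iota t)) = (fun t => psi (iota t))) -> chi = psi.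
Proof.
move=> [g Lg <-] [h Lh <-] gh; congr prod_char.
apply: functional_extensionality_dep => j; apply/funext => t.
have := congr1 (fun F => F t) (gh j); rewrite /= !prod_char_iota// => i; exact/Ldual.
Qed.

End marginals.

Theorem product_sidon {R : realType} {I : finType} (i0 : I) (p : I -> R) (r : R)
    (hp : forall j, 1 <= p j < 2)
    (hr : 1 / r = 1 / 2 + 1 / (2 * \sum_k p k / (2 - p k)))
    (G : I -> compactAbGroupType)
    (mu : forall j, probability (borel (G j)) R)
    (nu : probability (borel (prod_topology G)) R)
    (L : forall j, set (G j -> R[i])) :
  (forall j, is_haar (mu j)) -> is_haar nu ->
  (forall j, @L j `<=` dual R (G j)) ->
  (forall j, sidon (mu j) (p j) (@L j) /\ Lambda2 (mu j) (@L j)) ->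
  sidon nu r (prod_spectrum L).
Proof.
move=> hmu hnu Ldual hL.
have p1 j : 1 <= p j by case/andP: (hp j).
have p2 j : 0 < 2 - p j by rewrite subr_gt0; case/andP: (hp j).
have p0 j : 0 < p j by exact: lt_le_trans (p1 j).
set S := \sum_k p k / (2 - p k) in hr.
have S0 : 0 < S.
  rewrite /S (bigD1 i0)//= ltr_pwDl ?divr_gt0// sumr_ge0// => j _.
  by rewrite divr_ge0// ltW.
have S1 : S + 1 != 0 by rewrite gt_eqF// addr_gt0.
have Sn : S != 0 by rewrite gt_eqF.
have rE : r = 2 * S / (S + 1).
  have hr' : r^-1 = 1 / 2 + 1 / (2 * S) by rewrite -hr div1r.
  by rewrite -[LHS]invrK hr'; field; rewrite S1 Sn.
have r0 : 0 < r by rewrite rE divr_gt0 ?mulr_gt0 ?addr_gt0.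
have [C C0 hC] := marginal_bound hmu hnu Ldual p1 hL.
pose t j := p j / 2.
(* These weights make the exponents of the product term equal to [t], so that [hM] bounds each
   factor. *)
pose w j := S^-1 * (p j / (2 - p j)).
pose u j := w j * (1 - t j).
pose s := r / 2.
have sE : s = S / (S + 1) by rewrite /s rE; field.
apply: (@sidon_intro _ _ nu _ r (s * C + (1 - s) * \prod_(j : I) C)) => //.
move=> f cf hf f1 X uX Xd.
rewrite (sum_over_spectrum hf r0 Xd) -/s.
set Y := [seq g <- X | _].
have uY : uniq Y by exact: filter_uniq.
have YL g : g \in Y -> prod_spectrum L g.
  by rewrite mem_filter => /andP[/asboolP].
pose k j (chi : prod_topology G -> R[i]) : G j -> R[i] := fun x => chi (iota x).
pose c j (g : G j -> R[i]) := if `[< @L j g >] then N2 nu (proj mu g f) else 0.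
have c0 j g : 0 <= c j g by rewrite /c; case: ifP => // _; exact: N2_ge0.
have kL j g : g \in undup (map (k j) Y) -> @L j g.
  by rewrite mem_undup => /mapP[chi /YL hchi ->]; exact: (prod_spectrum_iota Ldual j hchi).
have hM j : \sum_(g <- undup (map (k j) Y)) c j g `^ t j <= C.
  apply: le_trans (hC f cf hf f1 j (undup (map (k j) Y)) (undup_uniq _) (kL j)).
  rewrite le_eqVlt; apply/orP; left; apply/eqP.
  by rewrite big_seq [RHS]big_seq; apply: eq_bigr => g /kL hg; rewrite /c asboolT.
apply: (@marginal_inequality R I _ (fun j => (G j -> R[i] : eqType)) Y k _ c s w t u t).
- rewrite sE divr_gt0 ?addr_gt0//= ler_pdivrMr ?addr_gt0// mul1r lerDl//.
- by move=> j; rewrite mulr_ge0 ?invr_ge0 ?(ltW S0)// divr_ge0// ltW.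
- by rewrite -mulr_sumr mulVf.
- by [].
- move=> j; rewrite /u /w /t sE; field.
  by rewrite S1 Sn gt_eqF.
- by move=> j; rewrite divr_gt0.
- by move=> a; rewrite sqr_ge0.
- exact: c0.
- move=> j g; rewrite -big_filter.
  have [hg|hg] := pselect (@L j g); last first.
    rewrite big_seq big1 ?/c ?asboolF// => chi; rewrite mem_filter => /andP[/eqP kg] chiY.
    by exfalso; apply: hg; rewrite -kg; exact: (prod_spectrum_iota Ldual j (YL _ chiY)).
  rewrite /c asboolT//; apply: (proj_bessel hmu hnu) => //.
  + exact: Ldual.
  + exact: filter_uniq.
  + move=> chi; rewrite mem_filter => /andP[/eqP kg /YL chiL]; split; last by rewrite -kg.
    exact: prod_spectrum_dual chiL.
- exact: hM.
- apply: le_trans (sum_prod_le (F := fun j g => c j g `^ t j) uY _ _) _.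
  + move=> a b aY bY hab; apply: (prod_spectrum_inj Ldual (YL _ aY) (YL _ bY)) => j.
    exact: hab.
  + by move=> j g; exact: powR_ge0.
  + apply: ler_prod => j _; rewrite hM andbT sumr_ge0// => g _; exact: powR_ge0.
Qed.

(** * Haar measure on the Cantor group *)

Section regularity.
Context {R : realType} {X : compactAbGroupType}.
Variable mu : probability (borel X) R.

(** Squeezing from both sides at once is a condition symmetric under complements, which is how it
    propagates from open sets to all Borel sets. *)
Definition regular := forall A : set (borel X), measurable A -> forall e : R, 0 < e ->
  exists K U : set X, [/\ compact K, open U, K `<=` A, A `<=` U & (mu (U `\` K) <= e%:E)%E].

Lemma compact_measurable_borel (K : set X) : compact K -> measurable (K : set (borel X)).
Proof.
move=> /(compact_closed hausdorff_setT) cK; rewrite -[K]setCK; apply: measurableC.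
by apply: open_measurable_borel; exact: closed_openC.
Qed.

Lemma closed_compact (K : set X) : closed K -> compact K.
Proof. by move=> cK; apply: (subclosed_compact cK (@compact_setT X)). Qed.

Lemma measure_subset_split (A B : set (borel X)) : measurable A -> measurable B -> A `<=` B ->
  mu B = (mu A + mu (B `\` A))%E.
Proof.
move=> mA mB AB; rewrite -measureU ?setDUK//; first exact: measurableD.
by rewrite setDIK.
Qed.

Lemma regular_haar : regular ->
  (forall (a : X) (A : set (borel X)), measurable A ->
     mu [set a + x | x in (A : set X)] = mu A) -> is_haar mu.
Proof.
move=> reg inv; split => // A mA.
have near_sets e : 0 < e -> exists K U : set X, [/\ compact K, open U, K `<=` A, A `<=` U &
    (mu U <= mu A + e%:E)%E /\ (mu A <= mu K + e%:E)%E].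
  move=> e0; have [K [U [cK oU KA AU KU]]] := reg A mA e e0.
  exists K, U; split => //.
  have mK := compact_measurable_borel cK; have mU := open_measurable_borel oU.
  split.
    rewrite (measure_subset_split mA mU AU); apply: leeD => //; apply: le_trans KU.
    by apply: le_measure; rewrite ?inE; [exact: measurableD|exact: measurableD|exact: setDS].
  rewrite (measure_subset_split mK mA KA); apply: leeD => //; apply: le_trans KU.
  by apply: le_measure; rewrite ?inE; [exact: measurableD|exact: measurableD|exact: setSD].
split; apply/eqP; rewrite eq_le; apply/andP; split.
- apply: le_ereal_inf_tmp => _ [U [oU AU] <-]; apply: le_measure; rewrite ?inE//.
  exact: open_measurable_borel.
- apply/lee_addgt0Pr => e e0; have [K [U [_ oU _ AU [h _]]]] := near_sets e e0.
  by apply: le_trans h; apply: ereal_inf_lbound; exists U.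
- apply/lee_addgt0Pr => e e0; have [K [U [cK _ KA _ [_ h]]]] := near_sets e e0.
  apply: le_trans h _; apply: leeD => //.
  by apply: ereal_sup_ubound; exists K.
- apply: ge_ereal_sup => _ [K [cK KA] <-]; apply: le_measure; rewrite ?inE//.
  exact: compact_measurable_borel.
Qed.

Lemma nonincreasing_small (D : nat -> set (borel X)) (e : R) :
  (forall n, measurable (D n)) -> (forall m n, (m <= n)%N -> D n `<=` D m) ->
  (mu (\bigcap_n D n) < e%:E)%E -> exists N, (mu (D N) <= e%:E)%E.
Proof.
move=> mD niD lte.
have mDD : measurable (\bigcap_n D n) by exact: bigcapT_measurable.
have cv := @nonincreasing_cvg_mu _ _ _ mu D _ mD mDD _.
have /cv {}cv : (mu (D 0%N) < +oo)%E.
  by apply: (@le_lt_trans _ _ 1%E); [exact: probability_le1|exact: ltry].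
have /cv {}cv : nonincreasing_seq D by move=> m n mn; apply/subsetPset; exact: niD.
have : \forall n \near \oo, (mu (D n) < e%:E)%E.
  apply: (cv [set t | (t < e%:E)%E]); apply: open_nbhs_nbhs; split => //.
  exact: open_ereal_lt_ereal.
by case=> N _ /(_ N (leqnn _))/ltW h; exists N.
Qed.

(* The sets that can be squeezed between a compact and an open set up to
   arbitrarily small measure form a sigma-algebra. *)
Lemma open_regular : (forall U : set X, open U -> forall e : R, 0 < e ->
    exists K : set X, [/\ compact K, K `<=` U & (mu (U `\` K) <= e%:E)%E]) -> regular.
Proof.
move=> hU A; apply: (@smallest_sub _ (@sigma_algebra _ setT) (@open X : set (set (borel X)))
  [set A : set (borel X) | forall e : R, 0 < e ->
  exists K U : set X, [/\ compact K, open U, K `<=` A, A `<=` U & (mu (U `\` K) <= e%:E)%E]]).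
- split.
  + move=> e e0; exists set0, set0; split => //; first exact: compact0.
      exact: open0.
    by rewrite setD0 measure0 lee_fin ltW.
  + move=> B hB e e0; have [K [U [cK oU KB BU KU]]] := hB e e0.
    exists (~` U), (~` K); split.
    * by apply: closed_compact; exact: open_closedC.
    * by apply: closed_openC; exact: (compact_closed hausdorff_setT).
    * by rewrite setTD; exact: subsetC.
    * by rewrite setTD; exact: subsetC.
    * by rewrite setDE setCK setIC -setDE.
  + move=> F hF e e0; have e2 : 0 < e / 2 by rewrite divr_gt0.
    have /choice[KU hKU] : forall n : nat, exists KU : set X * set X,
        [/\ compact KU.1, open KU.2, KU.1 `<=` F n, F n `<=` KU.2 &
          (mu (KU.2 `\` KU.1) <= (e / 2 / (2 ^ n.+1)%:R)%:E)%E].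
      move=> n; have [|K [U h]] := hF n (e / 2 / (2 ^ n.+1)%:R).
        by rewrite divr_gt0// ltr0n expn_gt0.
      by exists (K, U).
    pose U := \bigcup_n (KU n).2; pose K n := \bigcup_(i < n) (KU i).1.
    have oU : open U by apply: bigcup_open => n _; case: (hKU n).
    have mKn n : measurable ((KU n).1 : set (borel X)).
      by apply: compact_measurable_borel; case: (hKU n).
    have mUn n : measurable ((KU n).2 : set (borel X)).
      by apply: open_measurable_borel; case: (hKU n).
    have mU : measurable (U : set (borel X)) by exact: open_measurable_borel.
    have cK n : compact (K n).
      by rewrite /K bigcup_mkord; apply: bigsetU_compact => i _; case: (hKU i).
    pose D n : set (borel X) := U `\` K n.
    have mD n : measurable (D n) by apply: measurableD => //; exact: compact_measurable_borel.
    have mDD : measurable (\bigcap_n D n) by exact: bigcapT_measurable.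
    have DD : (mu (\bigcap_n D n) <= (e / 2)%:E)%E.
      have sub : \bigcap_n D n `<=` \bigcup_n ((KU n).2 `\` (KU n).1).
        move=> x Dx; have [[n _ Ux] _] := Dx 0%N I; exists n => //; split => // Kx.
        by have [_] := Dx n.+1 I; apply; exists n => /=.
      have mB n : measurable ((KU n).2 `\` (KU n).1 : set (borel X)) by exact: measurableD.
      apply: (le_trans (@measure_sigma_subadditive _ _ _ mu _
         (fun n => (KU n).2 `\` (KU n).1) mB mDD sub)).
      apply: le_trans (epsilon_trick0 xpredT (ltW e2)).
      by apply: lee_nneseries => n _ //; case: (hKU n).
    have [N hN] : exists N, (mu (D N) <= e%:E)%E.
      apply: nonincreasing_small => //.
        by move=> m n mn; apply: setDS => x [i /= im Kx]; exists i => //=; exact: leq_trans mn.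
      by apply: (le_lt_trans DD); rewrite lte_fin ltr_pdivrMr// mulr_natr mulr2n ltrDl.
    exists (K N), U; split => //.
    * by move=> x [i _ Kx]; exists i => //; case: (hKU i) => _ _ + _ _; apply.
    * by move=> x [i _ Fx]; exists i => //; case: (hKU i) => _ _ _ + _; apply.
- move=> U oU e e0; have [K [cK KU h]] := hU U oU e e0.
  by exists K, U; split.
Qed.

End regularity.

(** * Images of Haar measures under surjective continuous morphisms *)

Section image.
Context {R : realType} {X Y : compactAbGroupType}.
Variables (mu : probability (borel X) R) (u : X -> Y).
Hypotheses (cu : continuous u) (uD : {morph u : x y / x + y}) (su : forall y, exists x, u x = y).

Lemma image_measurable : @measurable_fun _ _ (borel X) (borel Y) setT (u : borel X -> borel Y).
Proof. exact: continuous_measurable_borel. Qed.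

(** [distribution] takes a bundled measurable function. *)
Definition mfun_of d d' (T : measurableType d) (T' : measurableType d') (f : T -> T')
    (mf : measurable_fun setT f) : {mfun T >-> T'} :=
  MeasurableFun.Pack (MeasurableFun.Class (isMeasurableFun.Build _ _ _ _ _ mf)).

Definition image_prob : probability (borel Y) R := distribution mu (mfun_of image_measurable).

Lemma image_probE (A : set (borel Y)) : image_prob A = mu (u @^-1` A).
Proof. by []. Qed.

(** Only compact sets are pushed forward: the open set around [A] is the complement of the image of
    a compact subset of the preimage of the complement of [A]. Surjectivity lifts each translation
    of [Y] to one of [X]. *)
Lemma image_haar : is_haar mu -> is_haar image_prob.
Proof.
move=> [inv reg]; apply: regular_haar.
- move=> A mA e e0; have e2 : 0 < e / 2 by rewrite divr_gt0.
  have inner B : measurable (B : set (borel X)) -> exists K : set X,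
      [/\ compact K, K `<=` B & (mu (B `\` K) <= (e / 2)%:E)%E].
    move=> mB; have [_ supE] := reg B mB.
    have fB : mu B \is a fin_num by exact: fin_num_measure.
    have : (mu B - (e / 2)%:E < ereal_sup [set mu K | K in [set K : set X | compact K /\ K `<=` B]])%E.
      by rewrite -supE lteBlDr// lteDl// lte_fin.
    move=> /ereal_sup_gt[_ [K [cK KB] <-] h]; exists K; split => //.
    have mK := compact_measurable_borel cK.
    have fK : mu K \is a fin_num by exact: fin_num_measure.
    have fD : mu (B `\` K) \is a fin_num by apply: fin_num_measure; exact: measurableD.
    move: h; rewrite lteBlDr// (measure_subset_split mu mK mB KB) -(fineK fK) -(fineK fD).
    by rewrite -!EFinD lte_fin lee_fin => h; lra.
  have mpre (B : set (borel Y)) : measurable B -> measurable (u @^-1` B : set (borel X)).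
    by move=> mB; rewrite -[X in measurable X]setTI; exact: image_measurable.
  have [K [cK KA hK]] := inner _ (mpre A mA).
  have mAC : measurable (~` A) by exact: measurableC.
  have [K2 [cK2 K2A hK2]] := inner _ (mpre _ mAC).
  have cim (B : set X) : compact B -> compact (u @` B).
    by move=> cB; apply: continuous_compact => //; exact: continuous_subspaceT.
  exists (u @` K), (~` (u @` K2)); split.
  + exact: cim.
  + by apply: closed_openC; apply: (compact_closed hausdorff_setT); exact: cim.
  + by move=> _ [x Kx <-]; exact: KA.
  + by move=> y Ay [x K2x xy]; have := K2A x K2x; rewrite /preimage/= xy.
  + rewrite image_probE.
    have mK := compact_measurable_borel cK; have mK2 := compact_measurable_borel cK2.
    have m1 : measurable (u @^-1` A `\` K : set (borel X)) by apply: measurableD => //; exact: mpre.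
    have m2 : measurable (u @^-1` (~` A) `\` K2 : set (borel X)) by apply: measurableD => //; exact: mpre.
    apply: (@le_trans _ _ (mu ((u @^-1` A `\` K) `|` (u @^-1` (~` A) `\` K2)))).
      apply: le_measure; rewrite ?inE.
      * apply: mpre; apply: measurableD; last by apply: compact_measurable_borel; exact: cim.
        by apply: measurableC; apply: compact_measurable_borel; exact: cim.
      * exact: measurableU.
      * move=> x [n1 n2]; have [Ax|nAx] := pselect (A (u x)).
          by left; split => // Kx; apply: n2; exists x.
        by right; split => // K2x; apply: n1; exists x.
    apply: le_trans (measureU2 mu m1 m2) _.
    by rewrite [X in X%:E]splitr EFinD; apply: leeD.
- move=> b A mA; have [a ab] := su b.
  rewrite !image_probE.
  have mB : measurable (u @^-1` A : set (borel X)).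
    by rewrite -[X in measurable X]setTI; exact: image_measurable.
  rewrite -(inv a _ mB); congr (mu _); apply/seteqP; split => x.
    move=> [y Ay ux]; exists (x - a); last by rewrite addrC subrK.
    have u0 : u 0 = 0 by apply: (addrI (u 0)); rewrite -uD !addr0.
    have uN z : u (- z) = - u z by apply: (addrI (u z)); rewrite -uD !subrr u0.
    by rewrite /preimage/= uD uN ab -ux addrAC subrr add0r.
  by move=> [y Ay <-]; exists (u y) => //; rewrite uD ab.
Qed.

End image.

(** * The Cantor group, its cylinders and its coin-tossing measure *)

Section bool_group.

Let sub_cont : continuous (fun x : bool * bool => x.1 - x.2).
Proof.
move=> [a b] A /= /nbhs_singleton Aab; exists ([set a], [set b]) => /=.
  by split; rewrite nbhs_principalE; exact/principal_filterP.
by move=> [c d] [/= -> ->].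
Qed.

HB.instance Definition _ := PreTopologicalNmodule_isTopologicalZmodule.Build bool sub_cont.

HB.instance Definition _ := isCompactHausdorff.Build bool bool_compact discrete_hausdorff.

End bool_group.

Definition cantor : compactAbGroupType :=
  prod_topology (fun _ : nat => (bool : compactAbGroupType)).

Section cylinders.
Implicit Types (x y a : cantor) (w : seq bool).

Definition cyl w : set cantor := [set y | mkseq y (size w) = w].

Lemma cyl_mkseq x n y : cyl (mkseq x n) y <-> forall i, (i < n)%N -> y i = x i.
Proof.
rewrite /cyl/= size_mkseq; split => [e i lin|e].
  by have := congr1 (fun s => nth false s i) e; rewrite !nth_mkseq.
by apply: (@eq_from_nth _ false); rewrite !size_mkseq// => i lin; rewrite !nth_mkseq// e.
Qed.

Lemma cyl_self x n : cyl (mkseq x n) x.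
Proof. exact/cyl_mkseq. Qed.

(** Convergence in the product is tested one coordinate at a time, and a prefix of length [i.+1]
    fixes the coordinate [i]. *)
Lemma nbhs_cyl x (U : set cantor) : nbhs x U -> exists n, cyl (mkseq x n) `<=` U.
Proof.
pose F := filter_from setT (fun n => cyl (mkseq x n)).
have FF : Filter F.
  apply: filter_from_filter; first by exists 0%N.
  move=> i j _ _; exists (maxn i j) => // y /cyl_mkseq h.
  split; apply/cyl_mkseq => k kl; apply: h; rewrite leq_max kl ?orbT//.
have : F --> x.
  apply/cvg_sup => i A [? /= [[W oW <-]]] /= Wx sub; exists i.+1 => // y /cyl_mkseq h.
  by apply: sub => /=; rewrite h.
by move=> cv /cv [n _ h]; exists n.
Qed.

Lemma open_prefix n (A : set cantor) :
  (forall x y, (forall i, (i < n)%N -> y i = x i) -> A x -> A y) -> open A.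
Proof.
move=> h; rewrite openE => x Ax.
suff H : nbhs x [set y : cantor | forall i, (i < n)%N -> y i = x i].
  by apply: filterS H => y yx; exact: h yx Ax.
elim: n {h} => [|n IH]; first by apply: filterS filterT.
have Hn : nbhs x [set y : cantor | y n = x n].
  have /(_ x [set b | b = x n]) : continuous (fun y : cantor => y n).
    exact: (@proj_continuous nat (fun _ => bool) n).
  by apply; rewrite nbhs_principalE; exact/principal_filterP.
apply: filterS2 IH Hn => y yi yn i; rewrite ltnS leq_eqVlt => /orP[/eqP->//|]; exact: yi.
Qed.

Lemma open_cyl w : open (cyl w).
Proof.
apply: (@open_prefix (size w)) => x y h; rewrite /cyl/= => <-.
apply: (@eq_from_nth _ false); rewrite !size_mkseq// => i lin; rewrite !nth_mkseq//; exact: h.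
Qed.

Lemma open_bigcup_cyl (U : set cantor) : open U ->
  U = \bigcup_(w in [set w | cyl w `<=` U]) cyl w.
Proof.
rewrite openE => oU; apply/seteqP; split => [x Ux|x [w /= wU]]; last exact: wU.
by have [n h] := nbhs_cyl (oU x Ux); exists (mkseq x n) => //; exact: cyl_self.
Qed.

Lemma measurable_preimage_open d (T : measurableType d) (f : T -> cantor) (U : set cantor) :
  (forall w, measurable (f @^-1` cyl w)) -> open U -> measurable (f @^-1` U).
Proof.
move=> mf /open_bigcup_cyl ->; rewrite preimage_bigcup bigcup_mkcond.
by apply: countable_bigcupT_measurable => [|w]; [exact: countableP|case: ifP].
Qed.

(** The cylinders and the empty set form a pi-system, on which [cantor_haar] compares two
    measures. *)
Lemma cyl_setI w v : cyl w `&` cyl v = set0 \/ exists u, cyl w `&` cyl v = cyl u.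
Proof.
wlog wv : w v / (size w <= size v)%N.
  by move=> H; have [/H//|/ltnW/H] := leqP (size w) (size v); rewrite setIC.
have [->|/set0P[x [xw xv]]] := eqVneq (cyl w `&` cyl v) set0; [by left|right].
exists v; apply/seteqP; split => [y []//|y yv]; split => //.
rewrite /cyl/= in xw xv yv *; rewrite -xw; apply: (@eq_from_nth _ false); rewrite !size_mkseq// => i lin.
rewrite !nth_mkseq//; have := congr1 (fun s => nth false s i) (etrans yv (esym xv)).
by rewrite !nth_mkseq//; exact: leq_trans wv.
Qed.

Lemma borel_cyl : @measurable _ (borel cantor) = <<s [set A | A = set0 \/ exists w, A = cyl w] >>.
Proof.
apply/seteqP; split.
  apply: smallest_sub; first exact: smallest_sigma_algebra.
  move=> U oU; pose T := g_sigma_algebraType [set A : set (borel cantor) | A = set0 \/ exists w, A = cyl w].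
  apply: (@measurable_preimage_open _ T id U _ oU) => w.
  by apply: sub_sigma_algebra; right; exists w.
apply: smallest_sub; first exact: smallest_sigma_algebra.
move=> _ [->|[w ->]]; first exact: measurable0.
by apply: open_measurable_borel; exact: open_cyl.
Qed.

End cylinders.

Section cantor_measure.
Context {R : realType}.

Fixpoint binary_value (w : seq bool) (c : nat) : nat :=
  if w is b :: w' then binary_value w' (b + c.*2) else c.

Lemma binary_value_rcons w b c : binary_value (rcons w b) c = (b + (binary_value w c).*2)%N.
Proof. by elim: w c => //= a w IH c. Qed.

Lemma binary_value_lt w c : (binary_value w c < c.+1 * 2 ^ size w)%N.
Proof.
elim: w c => [|b w IH] c /=; first by rewrite muln1.
apply: leq_trans (IH _) _; rewrite expnS mulnA leq_mul2r; apply/orP; right.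
by rewrite muln2; case: b; rewrite ?add0n ?add1n ?doubleS// ltnS.
Qed.

(** The binary digits of a uniform random number are fair independent bits, so their law is the Haar
    measure. Outside [[0, 1[] the value is the constant 0, a set that [unit_measure] does not
    charge. *)
Definition binary_digits (t : R) : cantor :=
  fun n => (0 <= t < 1) && odd (Num.truncn (2 ^+ n.+1 * t)).

Lemma truncn_half (t : R) : 0 <= t -> Num.truncn t = (Num.truncn (2 * t))./2.
Proof.
move=> t0; apply: truncn_def.
have /truncn_itv/andP[] : 0 <= 2 * t by rewrite mulr_ge0.
set k := Num.truncn _ => h1 h2.
have := odd_double_half k; rewrite -muln2 => e.
have e2 : k%:R = (odd k)%:R + (k./2)%:R * 2 :> R by rewrite -[in LHS]e natrD natrM.
have nS (i : nat) : i.+1%:R = i%:R + 1 :> R by rewrite -natr1.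
by move: h1 h2; rewrite !nS e2; case: (odd k) => /= h1 h2; apply/andP; split; lra.
Qed.

Lemma cyl_binary_digits w (t : R) : 0 <= t < 1 ->
  cyl w (binary_digits t) <-> Num.truncn (2 ^+ size w * t) = binary_value w 0.
Proof.
move=> t01; have /andP[t0 t1] := t01.
rewrite /cyl/=; elim/last_ind: w => [|w b IH].
  by split => // _ /=; rewrite expr0 mul1r; apply: truncn_def; rewrite t0.
rewrite size_rcons mkseqS binary_value_rcons.
have e : 2 ^+ (size w).+1 * t = 2 * (2 ^+ size w * t) by rewrite exprS mulrA.
have h := truncn_half (mulr_ge0 (exprn_ge0 (size w) (ler0n R 2)) t0).
have dE : binary_digits t (size w) = odd (Num.truncn (2 ^+ (size w).+1 * t)).
  by rewrite /binary_digits t01.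
rewrite dE e; split.
  move=> /eqP; rewrite eqseq_rcons => /andP[/eqP/IH]; rewrite h => e1 /eqP e2.
  by rewrite -[LHS]odd_double_half e1 e2.
move=> e1; move: h; rewrite e1 half_bit_double => /IH ->.
by rewrite oddD odd_double addbF; case: b {e1}.
Qed.

(* [binary_value w 0] is the integer with binary expansion [w], most significant digit first. *)
Definition dyadic (w : seq bool) : interval R :=
  `[(binary_value w 0)%:R / 2 ^+ size w, ((binary_value w 0).+1)%:R / 2 ^+ size w[.

Lemma cyl_dyadic w : `[0, 1[%classic `&` (binary_digits @^-1` cyl w) = [set` dyadic w].
Proof.
have p0 : 0 < 2 ^+ size w :> R by rewrite exprn_gt0.
have dE (t : R) : (t \in dyadic w) = ((binary_value w 0)%:R <= 2 ^+ size w * t < (binary_value w 0).+1%:R).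
  by rewrite in_itv/= ler_pdivrMr// ltr_pdivlMr// mulrC.
apply/seteqP; split => t; rewrite /= (dE t) in_itv /=.
  move=> [t01 /(cyl_binary_digits _ t01) <-]; apply: truncn_itv.
  by apply: mulr_ge0; [exact: ltW|case/andP: t01].
move=> /[dup] /truncn_def h1 /andP[h2 h3].
have t01 : 0 <= t < 1.
  apply/andP; split.
    by rewrite -(pmulr_rge0 _ p0); apply: le_trans h2.
  rewrite -(ltr_pM2l p0) mulr1; apply: lt_le_trans h3 _.
  have := binary_value_lt w 0; rewrite mul1n => h.
  by rewrite -natrX ler_nat.
by split => //; apply/cyl_binary_digits.
Qed.

Lemma binary_digits_measurable :
  @measurable_fun _ _ (measurableTypeR R) (borel cantor) setT binary_digits.
Proof.
apply: (measurability (@open cantor : set (set (borel cantor)))) => //.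
move=> _ [U oU <-]; rewrite setTI; apply: measurable_preimage_open => // w.
have mI : measurable (`[0, 1[%classic : set R) by [].
rewrite -[X in measurable X]setTI -(setUv (`[0, 1[%classic : set R)) setIUl.
apply: measurableU; first by rewrite cyl_dyadic; exact: measurable_itv.
have [w0|w0] := pselect (cyl w (0 : cantor)).
- rewrite (_ : _ `&` _ = ~` `[0, 1[%classic); first exact: measurableC.
  apply/seteqP; split => [t []//|t /= tI]; split => //.
  rewrite (_ : binary_digits t = 0)//; apply/funext => n.
  by rewrite /binary_digits; move: tI; rewrite in_itv/= => /negP/negbTE ->.
- rewrite (_ : _ `&` _ = set0)//.
  apply/seteqP; split => // t [/= tI]; rewrite (_ : binary_digits t = 0)//; apply/funext => n.
  by rewrite /binary_digits; move: tI; rewrite in_itv/= => /negP/negbTE ->.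
Qed.

Let mI : measurable (`[0, 1[%classic : set R). Proof. by []. Qed.

Definition unit_measure := mrestr (@lebesgue_measure R) mI.

HB.instance Definition _ := Measure.on unit_measure.

Let unit_measureT : unit_measure setT = 1%E.
Proof.
by rewrite /unit_measure /mrestr setTI lebesgue_measure_itv/= lte_fin ltr01 -EFinB subr0.
Qed.

HB.instance Definition _ := @Measure_isProbability.Build _ _ R unit_measure unit_measureT.

Definition cantor_measure : probability (borel cantor) R :=
  distribution unit_measure (mfun_of binary_digits_measurable).

Lemma cantor_measure_cyl w : cantor_measure (cyl w) = ((2 ^+ size w)^-1)%:E.
Proof.
rewrite (_ : cantor_measure (cyl w) = lebesgue_measure ((binary_digits @^-1` cyl w) `&` `[0, 1[%classic))//.
rewrite setIC cyl_dyadic /dyadic lebesgue_measure_itv/= lte_fin.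
have p0 : 0 < 2 ^+ size w :> R by rewrite exprn_gt0.
by rewrite ltr_pM2r ?invr_gt0// ltr_nat ltnSn -EFinB -mulrBl -natr1 addrAC subrr add0r mul1r.
Qed.

(** [K n] is the union of the cylinders of length [n] inside [U]; it is closed, and these sets
    increase to [U]. *)
Lemma cantor_measure_regular : regular cantor_measure.
Proof.
apply: open_regular => U oU e e0.
pose K n : set cantor := [set x | cyl (mkseq x n) `<=` U].
have mk n x y : (forall i, (i < n)%N -> y i = x i) -> mkseq y n = mkseq x n :> seq bool.
  move=> h; apply: (@eq_from_nth _ false); rewrite !size_mkseq// => i lin.
  by rewrite !nth_mkseq// h.
have cK n : compact (K n).
  apply: closed_compact; rewrite -[K n]setCK; apply: open_closedC.
  by apply: (@open_prefix n) => x y /mk e1; rewrite /K/= e1.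
have KU n : K n `<=` U by move=> x; apply; exact: cyl_self.
pose D n : set (borel cantor) := U `\` K n.
have mD n : measurable (D n).
  by apply: measurableD; [exact: open_measurable_borel|exact: compact_measurable_borel].
have D0 : \bigcap_n D n = set0.
  apply/seteqP; split => // x Dx; have [Ux _] := Dx 0%N I.
  move: oU; rewrite openE => /(_ x Ux)/nbhs_cyl[n h]; by have [] := Dx n I.
have [| |N hN] := @nonincreasing_small _ _ cantor_measure D e mD.
- move=> m n mn x [Ux nK]; split => // Km; apply: nK => y /cyl_mkseq h; apply: Km.
  by apply/cyl_mkseq => i im; apply: h; exact: leq_trans mn.
- by rewrite D0 measure0 lte_fin.
by exists (K N).
Qed.

(** A translation permutes the cylinders of a given length, which all have the same measure; the
    measure and its translate then agree on a generating pi-system. *)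
Lemma cantor_haar : is_haar cantor_measure.
Proof.
apply: (regular_haar cantor_measure_regular) => a A mA.
have cu : continuous (fun x : cantor => - a + x) by exact: translation_continuous.
have -> : cantor_measure [set a + x | x in (A : set cantor)] = image_prob cantor_measure cu A.
  rewrite image_probE; congr (cantor_measure _); apply/seteqP; split => [_ [x Ax <-]|x Ax].
    by rewrite /preimage/= addKr.
  by exists (- a + x) => //; rewrite addNKr.
apply: (@measure_unique _ R (borel cantor) [set A : set (borel cantor) | A = set0 \/ exists w, A = cyl w]
   (fun _ => setT)) => //.
- exact: borel_cyl.
- move=> _ _ [->|[w ->]] [->|[v ->]]; rewrite ?set0I ?setI0; try by left.
  by case: (cyl_setI w v) => [|[u ->]]; [left|right; exists u].
- by move=> _; right; exists [::]; apply/seteqP; split.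
- by rewrite bigcup_const//; exists 0%N.
- move=> _ [->|[w ->]]; first by rewrite !measure0.
  symmetry; transitivity (cantor_measure ((fun x : cantor => - a + x) @^-1` cyl w)); last by [].
  rewrite (_ : _ @^-1` _ = cyl (mkseq (fun i => a i + nth false w i) (size w))); last first.
    apply/seteqP; split => x.
      move=> /= xw; apply/cyl_mkseq => i lin; rewrite /cyl/= in xw; rewrite -xw nth_mkseq//.
      by rewrite [X in a i + X](_ : _ = - a i + x i)// addNKr.
    move=> /cyl_mkseq h; rewrite /preimage/cyl/=.
    apply: (@eq_from_nth _ false); rewrite size_mkseq// => i lin.
    by rewrite nth_mkseq// [LHS](_ : _ = - a i + x i)// h// addKr.
  by apply: (etrans (cantor_measure_cyl w)); rewrite cantor_measure_cyl size_mkseq.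
- by move=> _; apply: (@le_lt_trans _ _ 1%E); [exact: probability_le1|exact: ltry].
Qed.

End cantor_measure.

Section cantor_powers.
Context {R : realType}.

Definition cantor_power (d : nat) : compactAbGroupType := prod_topology (fun _ : 'I_d => cantor).

Lemma cantor_coordinate_continuous n : continuous (fun x : cantor => x n).
Proof. exact: (@proj_continuous nat (fun _ => bool) n). Qed.

Lemma into_cantor_continuous (S : topologicalType) (u : S -> cantor) :
  (forall n, continuous (fun s => u s n)) -> continuous u.
Proof.
move=> hu s; apply/cvg_sup => i; move: s.
apply: (@continuous_comp_initial _ _ _ (fun f : cantor => f i) u) => s; exact: hu.
Qed.

(** The bits of one point of [cantor], read along [pickle], form a point of the power. This morphism
    is onto because [pickle] is injective, and it carries the Haar measure along. *)
Lemma cantor_power_haar d : exists mu : probability (borel (cantor_power d)) R, is_haar mu.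
Proof.
pose u (x : cantor) : cantor_power d := fun j n => x (pickle (nat_of_ord j, n)).
have cu : continuous u.
  apply: prod_continuous => j; apply: into_cantor_continuous => n; exact: cantor_coordinate_continuous.
exists (image_prob cantor_measure cu); apply: image_haar cantor_haar => //.
move=> y; exists (fun i => `[< exists j n, i = pickle (nat_of_ord j, n) /\ y j n >]).
apply: functional_extensionality_dep => j; apply: functional_extensionality_dep => n.
apply/idP/idP => [/asboolP[j' [n' [e yn]]]|yn].
  have [/ord_inj -> ->] : (nat_of_ord j, n) = (nat_of_ord j', n') by apply: (pcan_inj pickleK).
  by [].
by apply/asboolP; exists j, n.
Qed.

Lemma cantor_powers_haar m (d : 'I_m -> nat) :
  exists nu : probability (borel (prod_topology (fun k => cantor_power (d k)))) R, is_haar nu.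
Proof.
pose u (x : cantor) : prod_topology (fun k => cantor_power (d k)) :=
  fun k j n => x (pickle (nat_of_ord k, nat_of_ord j, n)).
have cu : continuous u.
  apply: prod_continuous => k; apply: prod_continuous => j.
  apply: into_cantor_continuous => n; exact: cantor_coordinate_continuous.
exists (image_prob cantor_measure cu); apply: image_haar cantor_haar => //.
move=> y.
exists (fun i => `[< exists (k : 'I_m) (j : 'I_(d k)) n,
   i = pickle (nat_of_ord k, nat_of_ord j, n) /\ y k j n >]).
apply: functional_extensionality_dep => k; apply: functional_extensionality_dep => j.
apply: functional_extensionality_dep => n.
apply/idP/idP => [/asboolP[k' [j' [n' [e yn]]]]|yn]; last by apply/asboolP; exists k, j, n.
have [/ord_inj ek ej ->] : (nat_of_ord k, nat_of_ord j, n) = (nat_of_ord k', nat_of_ord j', n').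
  by apply: (pcan_inj pickleK).
by case: k' / ek j' ej yn {e} => j' /ord_inj <-.
Qed.

End cantor_powers.

(** * Rademacher functions *)

Section rademacher.
Context {R : realType}.
Local Notation mu := (@cantor_measure R).

Definition sign_of (b : bool) : R := (-1) ^+ b.
Definition rademacher (n : nat) (x : cantor) : R[i] := (sign_of (x n))%:C.

Lemma dual_rademacher n : dual R cantor (rademacher n).
Proof.
split.
- apply: (@comp_continuous _ _ _ (fun x : cantor => x n) (fun b : bool => (sign_of b)%:C : R[i]^o)).
    exact: cantor_coordinate_continuous.
  move=> b A /nbhs_singleton Ab.
  have H : nbhs b [set b] by rewrite nbhs_principalE; exact/principal_filterP.
  by have := @filterS _ (nbhs b) _ [set b] (fun c => A (sign_of c)%:C); apply => // _ ->.
- move=> x y; rewrite /rademacher -rmorphM; congr (_%:C).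
  by rewrite /sign_of -signr_addb.
- by move=> x; rewrite /rademacher normcR normrX normrN1 expr1n.
Qed.

Definition rademachers : set (cantor -> R[i]) := range rademacher.

Lemma rademachers_dual : rademachers `<=` dual R cantor.
Proof. by move=> _ [n _ <-]; exact: dual_rademacher. Qed.

Lemma cct_rademacher n : cct (rademacher n).
Proof. exact: dual_cct (dual_rademacher n). Qed.

Definition unit_point (i : nat) : cantor := fun j => i == j.

Lemma sign_of_inj : injective sign_of.
Proof.
move=> [] [] //; rewrite /sign_of expr1 expr0 => h; exfalso; move: (ltrN10 R) (ltr01 : 0 < 1 :> R).
  by rewrite h => /lt_trans h' /h'; rewrite ltxx.
by rewrite -h => /lt_trans h' /h'; rewrite ltxx.
Qed.

Lemma real_complex_inj : injective (fun x : R => x%:C).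
Proof. by move=> x y []. Qed.

Lemma rademacher_inj : injective rademacher.
Proof.
move=> i j /(congr1 (fun r => r (unit_point i)))/real_complex_inj/sign_of_inj.
by rewrite /unit_point eqxx => /esym/eqP.
Qed.

Definition walsh n (A : {set 'I_n}) (x : cantor) : R[i] := \prod_(i in A) rademacher i x.

Lemma walsh_real n (A : {set 'I_n}) x : walsh A x = (\prod_(i in A) sign_of (x i))%:C.
Proof. by rewrite rmorph_prod. Qed.

Lemma dual_walsh n (A : {set 'I_n}) : dual R cantor (walsh A).
Proof.
split.
- apply: (cct_continuous (F := walsh A)); apply: cct_prod => i; exact: cct_rademacher.
- by move=> x y; rewrite -big_split; apply: eq_bigr => i _; apply: dualM; exact: dual_rademacher.
- move=> x; rewrite normc_prod big1// => i _; exact: dual_normc (dual_rademacher i).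
Qed.

Lemma walsh_unit_point n (A : {set 'I_n}) (i : 'I_n) : walsh A (unit_point i) = (sign_of (i \in A))%:C.
Proof.
rewrite walsh_real; congr (_%:C).
have [iA|iA] := boolP (i \in A).
  rewrite (bigD1 i)//= big1 ?mulr1; first by rewrite /unit_point eqxx.
  move=> j /andP[_ ji]; rewrite /unit_point (_ : _ == _ = false)//.
  by apply/negP => /eqP/ord_inj ij; rewrite ij eqxx in ji.
rewrite big1// => j jA; rewrite /unit_point (_ : _ == _ = false)//.
by apply/negP => /eqP/ord_inj ij; rewrite ij jA in iA.
Qed.

Lemma walsh_rademacher n (A : {set 'I_n}) m : walsh A = rademacher m ->
  exists2 i : 'I_n, A = finset.set1 i & m = i.
Proof.
move=> e.
have h (i : 'I_n) : (i \in A) = (i == m :> nat).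
  have := congr1 (fun r => r (unit_point i)) e.
  by rewrite walsh_unit_point => /real_complex_inj/sign_of_inj.
have [mn|nm] := ltnP m n.
  exists (Ordinal mn) => //; apply/setP => i; rewrite h inE -val_eqE//.
have A0 : A = finset.set0.
  apply/setP => i; rewrite h inE; apply/eqP => im; move: (ltn_ord i); rewrite im ltnNge nm//.
have := congr1 (fun r => r (unit_point m)) e.
rewrite A0 /walsh big1; last by (move=> i; rewrite inE).
move=> /real_complex_inj; rewrite /unit_point eqxx => /(@sign_of_inj false true).
by [].
Qed.

(** Riesz products. For real [z] with [|z i| <= 1] they are nonnegative of mean 1, which gives the
    1-Sidon property ([rademacher_l1]); for imaginary [z] of Euclidean norm 1 they are bounded by
    [sqrt e], which gives Lambda(2) ([rademacher_l2]). *)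
Definition riesz n (z : 'I_n -> R[i]) (x : cantor) : R[i] := \prod_(i < n) (1 + z i * rademacher i x).

Lemma cct_riesz n (z : 'I_n -> R[i]) : cct (riesz z).
Proof.
apply: cct_prod => i; apply: cctD; first exact: cct_cst.
by apply: cctM; [exact: cct_cst|exact: cct_rademacher].
Qed.

Lemma rieszE n (z : 'I_n -> R[i]) x : riesz z x = \sum_(A : {set 'I_n}) (\prod_(i in A) z i) * walsh A x.
Proof.
rewrite /riesz; under eq_bigr do rewrite addrC.
rewrite bigA_distr; apply: eq_bigr => A _.
by rewrite -big_split/= [RHS]big_mkcond/=; apply: eq_bigr => i _; case: ifP.
Qed.

Lemma riesz_mean n (z : 'I_n -> R[i]) : cI mu (riesz z) = 1.
Proof.
rewrite (eq_cI mu (rieszE z)) cI_sum; last first.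
  by move=> A; apply: cctM; [exact: cct_cst|exact: dual_cct (dual_walsh A)].
rewrite (@big_only1 _ _ _ _ (finset.set0 : {set (ordinal n)}))//.
  apply: etrans _ (cI_cst mu 1); apply: eq_cI.
  by move=> x; rewrite /walsh !big1 ?mulr1// => i; rewrite inE.
move=> A /set0Pn[i iA] _; apply: (etrans (cIZ mu _ (dual_cct (dual_walsh A)))).
have -> : cI mu (walsh A) = 0; last by rewrite mulr0.
apply: (cI_quasi_invariant cantor_haar (a := unit_point i) (c := walsh A (unit_point i))).
- exact: dual_cct (dual_walsh A).
- rewrite walsh_unit_point iA; apply/eqP => /real_complex_inj/(@sign_of_inj true false); by [].
- by move=> x; apply: dualM; exact: dual_walsh.
Qed.

(** Among the Walsh functions in the expansion only those of singletons are Rademacher functions;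
    the others meet zero coefficients of [f]. *)
Lemma riesz_pairing n (z : 'I_n -> R[i]) f : cct f -> spectrum_in mu rademachers f ->
  cI mu (fun x => f x * riesz z x) = \sum_(i < n) z i * fourier mu f (rademacher i).
Proof.
move=> cf hf.
have cw (A : {set 'I_n}) : cct (fun x => f x * walsh A x) by apply: cctM => //; exact: dual_cct (dual_walsh A).
have fw (A : {set 'I_n}) : cI mu (fun x => f x * walsh A x) = fourier mu f (walsh A).
  by apply: eq_cI => x; rewrite walsh_real conjCR.
rewrite (eq_cI mu (H := fun x => \sum_(A : {set 'I_n}) (\prod_(i in A) z i) * (f x * walsh A x))); last first.
  by move=> x; rewrite rieszE mulr_sumr; apply: eq_bigr => A _; rewrite mulrCA.
rewrite cI_sum; last by move=> A; apply: cctM => //; exact: cct_cst.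
transitivity (\sum_(A : {set 'I_n}) (\prod_(i in A) z i) * fourier mu f (walsh A)).
  by apply: eq_bigr => A _; rewrite -fw; exact: cIZ.
rewrite (bigID (fun A : {set 'I_n} => #|A| == 1%N))/= [X in _ + X]big1 ?addr0; last first.
  move=> A A1; rewrite hf ?mulr0//; first exact: dual_walsh.
  by move=> [m _ /esym/walsh_rademacher[i Ai _]]; rewrite Ai cards1 eqxx in A1.
have w1 (i : 'I_n) : walsh (finset.set1 i) = rademacher i by apply/funext => x; rewrite /walsh big_set1.
rewrite (eq_bigl (mem ((@finset.set1 'I_n) @: 'I_n))%SET); last first.
  by move=> A; apply/cards1P/imsetP => [[i ->]|[i _ ->]]; exists i.
rewrite big_imset/=; last by move=> i j _ _; exact: set1_inj.
by apply: eq_bigr => i _; rewrite big_set1 w1.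
Qed.

End rademacher.

Lemma sum_sub_le {R : realType} (T : eqType) (s t : seq T) (h : T -> R) :
  uniq s -> {subset s <= t} -> (forall x, 0 <= h x) -> \sum_(x <- s) h x <= \sum_(x <- t) h x.
Proof.
move=> us st h0; elim: s t us st => [|a s IH] t /=.
  by move=> _ _; rewrite big_nil; apply: sumr_ge0 => x _.
move=> /andP[as_ us] st; have at_ : a \in t by apply: st; rewrite inE eqxx.
rewrite big_cons (perm_big _ (perm_to_rem at_)) big_cons lerD2l; apply: IH => // x xs.
have xt : x \in a :: rem a t by rewrite -(perm_mem (perm_to_rem at_)); apply: st; rewrite inE xs orbT.
by move: xt; rewrite inE => /orP[/eqP e|//]; rewrite -e xs in as_.
Qed.

Lemma sum_support_le {R : realType} (T : eqType) (s t : seq T) (h : T -> R) :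
  uniq s -> (forall x, x \in s -> x \notin t -> h x = 0) -> (forall x, 0 <= h x) ->
  \sum_(x <- s) h x <= \sum_(x <- t) h x.
Proof.
move=> us st h0; rewrite (bigID (mem t))/= [X in _ + X]big1_seq ?addr0; last first.
  by move=> x /andP[xt xs]; exact: st.
rewrite -big_filter; apply: sum_sub_le; rewrite ?filter_uniq//.
by move=> x; rewrite mem_filter => /andP[].
Qed.

Section rademacher_sets.
Context {R : realType}.
Local Notation mu := (@cantor_measure R).
Local Notation rademacher := (@rademacher R).

Lemma riesz_dual_bound n (z : 'I_n -> R[i]) f : cct f -> spectrum_in mu rademachers f ->
  normc (\sum_(i < n) z i * fourier mu f (rademacher i)) <= \int[mu]_x (normc (f x) * normc (riesz z x)).
Proof.
move=> cf hf; rewrite -riesz_pairing//; apply: le_trans (normc_cI _ _) _.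
  by apply: cctM => //; exact: cct_riesz.
rewrite le_eqVlt; apply/orP; left; apply/eqP; apply: eq_Rintegral => x _; exact: normcM.
Qed.

Lemma Re_mulr_real (a : R) (z : R[i]) : complex.Re (a%:C * z) = a * complex.Re z.
Proof. by case: z => x y /=; rewrite mul0r subr0. Qed.
Lemma Im_mulr_real (a : R) (z : R[i]) : complex.Im (a%:C * z) = a * complex.Im z.
Proof. by case: z => x y /=; rewrite mul0r addr0. Qed.
Lemma Re_sum (I : Type) (s : seq I) (P : pred I) (h : I -> R[i]) :
  complex.Re (\sum_(i <- s | P i) h i) = \sum_(i <- s | P i) complex.Re (h i).
Proof. by apply: (big_morph _ ReD). Qed.
Lemma Im_sum (I : Type) (s : seq I) (P : pred I) (h : I -> R[i]) :
  complex.Im (\sum_(i <- s | P i) h i) = \sum_(i <- s | P i) complex.Im (h i).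
Proof. by apply: (big_morph _ ImD). Qed.

Lemma riesz_real n (e : 'I_n -> R) x : (forall i, `|e i| <= 1) ->
  riesz (fun i => (e i)%:C) x = (normc (riesz (fun i => (e i)%:C) x))%:C.
Proof.
move=> he; pose P := \prod_(i < n) (1 + e i * sign_of (x i)).
have -> : riesz (fun i => (e i)%:C) x = P%:C.
  rewrite /P rmorph_prod; apply: eq_bigr => i _.
  by rewrite rmorphD rmorph1 rmorphM.
rewrite normcR ger0_norm//; apply: prodr_ge0 => i _.
have : `|e i * sign_of (x i)| <= 1.
  by rewrite normrM normrX normrN1 expr1n mulr1.
by rewrite ler_norml -lerBlDl sub0r => /andP[].
Qed.

Lemma riesz_norm_mean n (e : 'I_n -> R) : (forall i, `|e i| <= 1) ->
  \int[mu]_x normc (riesz (fun i => (e i)%:C) x) = 1.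
Proof.
move=> he; apply: real_complex_inj; rewrite -[RHS](riesz_mean (fun i => (e i)%:C)).
apply: etrans (esym (cI_real mu _)) _; apply: eq_cI => x; exact: (esym (riesz_real x he)).
Qed.

Lemma rademacher_l1 n f : cct f -> spectrum_in mu rademachers f -> (forall x, normc (f x) <= 1) ->
  \sum_(i < n) normc (fourier mu f (rademacher i)) <= 2.
Proof.
move=> cf hf f1.
have key (e : 'I_n -> R) : (forall i, `|e i| <= 1) ->
    normc (\sum_(i < n) (e i)%:C * fourier mu f (rademacher i)) <= 1.
  move=> he; apply: le_trans (riesz_dual_bound _ cf hf) _.
  rewrite -(riesz_norm_mean he); have cr := cct_normc (cct_riesz (fun i => (e i)%:C)).
  apply: rI_le => //; first by apply: ctM => //; exact: cct_normc.
  by move=> x; rewrite ler_piMl// normc_ge0.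
(* The coefficients are the signs of the real, then of the imaginary parts; each choice contributes
   1 to the constant 2. *)
have sg1 (c : R) : `|Num.sg c| <= 1 by rewrite normr_sg; case: (c != 0).
have re : \sum_(i < n) `|complex.Re (fourier mu f (rademacher i))| <= 1.
  have := key (fun i => Num.sg (complex.Re (fourier mu f (rademacher i)))) (fun i => sg1 _).
  apply: le_trans; apply: le_trans (normc_Re _); apply: le_trans (ler_norm _).
  by rewrite Re_sum; apply: ler_sum => i _; rewrite Re_mulr_real -normrEsg.
have im : \sum_(i < n) `|complex.Im (fourier mu f (rademacher i))| <= 1.
  have := key (fun i => Num.sg (complex.Im (fourier mu f (rademacher i)))) (fun i => sg1 _).
  apply: le_trans; apply: le_trans (normc_Im _); apply: le_trans (ler_norm _).
  by rewrite Im_sum; apply: ler_sum => i _; rewrite Im_mulr_real -normrEsg.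
apply: (@le_trans _ _ (\sum_(i < n) (`|complex.Re (fourier mu f (rademacher i))| +
  `|complex.Im (fourier mu f (rademacher i))|))); first by apply: ler_sum => i _; exact: normc_le.
by rewrite big_split/=; apply: lerD.
Qed.

Lemma rademachers_sidon : sidon mu 1 rademachers.
Proof.
apply: (@sidon_intro _ _ _ _ _ 2) => // f cf hf f1 s us sd.
have /choice[idx hidx] : forall g : cantor -> R[i], exists i, (exists j, rademacher j = g) -> rademacher i = g.
  move=> g; have [[j jg]|h] := pselect (exists j, rademacher j = g); first by exists j.
  by exists 0%N.
pose n := (\max_(g <- s) idx g).+1.
pose t := [seq rademacher i | i <- index_iota 0 n].
apply: (@le_trans _ _ (\sum_(g <- t) normc (fourier mu f g) `^ 1)).
  apply: sum_support_le => // [g gs gt|g]; last exact: powR_ge0.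
  rewrite hf ?powRr1 ?normc0//; first exact: sd.
  move=> [j _ jg]; move/negP: gt; apply; apply/mapP; exists (idx g); last by rewrite hidx//; exists j.
  by rewrite mem_index_iota /= /n ltnS; apply: leq_bigmax_seq.
rewrite big_map big_mkord; under eq_bigr do rewrite powRr1 ?normc_ge0//.
exact: rademacher_l1.
Qed.

Lemma riesz_imaginary n (a : 'I_n -> R) x :
  normc (riesz (fun i => 0 +i* a i) x) ^+ 2 <= expR (\sum_i a i ^+ 2).
Proof.
rewrite normc_prod -prodrXl expR_sum; apply: ler_prod => i _; rewrite sqr_ge0/=.
have -> : normc (1 + (0 +i* a i) * rademacher i x) ^+ 2 = 1 + a i ^+ 2.
  have s2 : sign_of (x i) ^+ 2 = 1 :> R by rewrite /sign_of sqrr_sign.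
  rewrite /rademacher; move: (sign_of (x i)) s2 => s s2 /=.
  rewrite sqr_sqrtr ?addr_ge0 ?sqr_ge0// !mul0r mulr0 subrr !add0r addr0 expr1n.
  by rewrite exprMn s2 mulr1.
exact: expR_ge1Dx.
Qed.

Lemma rademacher_l2 n f : cct f -> spectrum_in mu rademachers f ->
  \sum_(i < n) normc (fourier mu f (rademacher i)) ^+ 2 <= 2 * expR 1 * (\int[mu]_x normc (f x)) ^+ 2.
Proof.
move=> cf hf; set J := \int[mu]_x _.
have J0 : 0 <= J by apply: rI_ge0 => x; exact: normc_ge0.
have key (a : 'I_n -> R) : \sum_i a i ^+ 2 = 1 ->
    normc (\sum_(i < n) (a i)%:C * fourier mu f (rademacher i)) <= Num.sqrt (expR 1) * J.
  move=> a1.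
  (* A factor [i] leaves the modulus alone and makes the Riesz coefficients imaginary, so that the
     product stays below [sqrt e]. *)
  have -> : normc (\sum_(i < n) (a i)%:C * fourier mu f (rademacher i)) =
     normc (\sum_(i < n) (0 +i* a i) * fourier mu f (rademacher i)).
    rewrite -[LHS]mul1r -[X in X * _](_ : normc (0 +i* 1 : R[i]) = 1); last first.
      by rewrite /= expr0n expr1n add0r sqrtr1.
    rewrite -normcM mulr_sumr; congr (normc _); apply: eq_bigr => i _.
    by rewrite mulrA complexME !mul0r !mul1r subrr add0r.
  apply: le_trans (riesz_dual_bound _ cf hf) _.
  rewrite -rIZ; last exact: cct_normc.
  have cr := cct_normc (cct_riesz (fun i => 0 +i* a i)).
  apply: rI_le.
  - by apply: ctM => //; exact: cct_normc.
  - by apply: ctM; [exact: ct_cst|exact: cct_normc].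
  - move=> x; rewrite mulrC ler_wpM2r ?normc_ge0//.
    rewrite -[leLHS]ger0_norm ?normc_ge0// -sqrtr_sqr ler_wsqrtr// -a1; exact: riesz_imaginary.
(* Duality in Euclidean space, tested on the unit vector [x / sqrt S]; it is used for the real and
   for the imaginary parts, whence the factor 2. *)
have l2 (x : 'I_n -> R) : (forall a : 'I_n -> R, \sum_i a i ^+ 2 = 1 ->
    \sum_i a i * x i <= Num.sqrt (expR 1) * J) -> \sum_i x i ^+ 2 <= expR 1 * J ^+ 2.
  move=> h; set S := \sum_i _; have S0 : 0 <= S by apply: sumr_ge0 => i _; exact: sqr_ge0.
  have [->|Sn] := eqVneq S 0; first by rewrite mulr_ge0 ?expR_ge0 ?sqr_ge0.
  have Sp : 0 < S by rewrite lt0r Sn.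
  have r0 : Num.sqrt S != 0 by rewrite sqrtr_eq0 -ltNge.
  have := h (fun i => x i / Num.sqrt S) _.
  have -> : \sum_i x i / Num.sqrt S * x i = Num.sqrt S.
    rewrite (eq_bigr (fun i => x i ^+ 2 / Num.sqrt S)); last by move=> i _; rewrite mulrAC.
    by rewrite -mulr_suml -/S -{1}(sqr_sqrtr S0) expr2 mulfK.
  move=> h1; rewrite -(sqr_sqrtr S0) -[X in X * _](sqr_sqrtr (expR_ge0 1)) -exprMn.
  rewrite ler_pXn2r ?nnegrE ?sqrtr_ge0// ?mulr_ge0 ?sqrtr_ge0//; apply: h1.
  rewrite (eq_bigr (fun i => x i ^+ 2 / S)); last by move=> i _; rewrite expr_div_n sqr_sqrtr.
  by rewrite -mulr_suml mulfV.
have re := l2 (fun i => complex.Re (fourier mu f (rademacher i))) _.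
have im := l2 (fun i => complex.Im (fourier mu f (rademacher i))) _.
rewrite (eq_bigr (fun i : 'I_n => complex.Re (fourier mu f (rademacher i)) ^+ 2 +
  complex.Im (fourier mu f (rademacher i)) ^+ 2)); last first.
  by move=> i _; case: (fourier _ _ _) => x y /=; rewrite sqr_sqrtr// addr_ge0 ?sqr_ge0.
rewrite big_split/= -mulrA mulr_natl mulr2n; apply: lerD; [apply: re|apply: im] => a /key; apply: le_trans.
  apply: le_trans (normc_Re _); apply: le_trans (ler_norm _).
  by rewrite Re_sum; apply: ler_sum => i _; rewrite Re_mulr_real.
apply: le_trans (normc_Im _); apply: le_trans (ler_norm _).
by rewrite Im_sum; apply: ler_sum => i _; rewrite Im_mulr_real.
Qed.

End rademacher_sets.

(** * The Lambda(2) property of the Rademacher functions *)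

Section tail_average.
Context {R : realType}.
Local Notation mu := (@cantor_measure R).
Local Notation rademacher := (@rademacher R).

Definition tail (n : nat) (y : cantor) : cantor := fun i => if (i < n)%N then false else y i.

Lemma tail_continuous n : continuous (tail n).
Proof.
apply: into_cantor_continuous => i; rewrite /tail; case: (i < n)%N; first exact: (@cst_cont cantor bool false).
exact: cantor_coordinate_continuous.
Qed.

Lemma tailD n x y : tail n (x + y) = tail n x + tail n y.
Proof.
apply: functional_extensionality_dep => i.
by rewrite [RHS](_ : _ = tail n x i + tail n y i)// /tail; case: ifP.
Qed.

(** The conditional expectation on the first [n] coordinates, written as an average of translates so
    that it acts on Fourier coefficients as a multiplier. *)
Definition tail_average n (f : cantor -> R[i]) (x : cantor) : R[i] := cI mu (fun y => f (x + tail n y)).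

Lemma add_tail_continuous n : continuous (fun p : cantor * cantor => p.1 + tail n p.2).
Proof.
apply: (@comp_continuous _ _ _ (fun p : cantor * cantor => (p.1, tail n p.2)) (fun p : cantor * cantor => p.1 + p.2)).
  apply: pair_continuous; first exact: fst_cont.
  exact: (comp_continuous (@snd_cont _ _) (@tail_continuous n)).
exact: add_continuous.
Qed.

Lemma cct_tail_body n (f : cantor -> R[i]) : cct f -> cct (fun p : cantor * cantor => f (p.1 + tail n p.2)).
Proof. by move=> cf; exact: (cct_comp (@add_tail_continuous n) cf). Qed.

Lemma cct_tail_section n x (f : cantor -> R[i]) : cct f -> cct (fun y => f (x + tail n y)).
Proof.
move=> /(cct_tail_body n) cb; apply: (cct_comp (u := fun y => (x, y)) _ cb).
by apply: pair_continuous; [exact: cst_cont|exact: id_cont].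
Qed.

Lemma cct_tail_average n f : cct f -> cct (tail_average n f).
Proof. by move=> cf; apply: cct_cI (cct_tail_body n cf). Qed.

Lemma dual_tail n (chi : cantor -> R[i]) : dual R cantor chi -> dual R cantor (fun y => chi (tail n y)).
Proof.
move=> dchi; split.
- apply: (cct_continuous (F := fun y => chi (tail n y))).
  exact: (cct_comp (@tail_continuous n) (dual_cct dchi)).
- by move=> x y; rewrite tailD; exact: dualM.
- by move=> x; exact: dual_normc.
Qed.

Lemma fourier_tail_average n f chi : cct f -> dual R cantor chi ->
  fourier mu (tail_average n f) chi = cI mu (fun y => chi (tail n y)) * fourier mu f chi.
Proof.
move=> cf dchi; have cchi := dual_cct dchi.
have ct1 : cct (fun y => chi (tail n y)) by exact: dual_cct (dual_tail n dchi).
have cfc : cct (fun x => f x * (chi x)^*) by apply: cctM => //; exact: cctJ.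
transitivity (cI mu (fun x => cI mu (fun y => f (x + tail n y) * (chi x)^*))).
  apply: eq_cI => x; rewrite mulrC.
  apply: etrans (esym (cIZ mu _ (cct_tail_section n x cf))) _.
  by apply: eq_cI => y; exact: mulrC.
rewrite (fubini_cct mu mu (F := fun p => f (p.1 + tail n p.2) * (chi p.1)^*)); last first.
  apply: cctM; first exact: cct_tail_body.
  by apply: cctJ; exact: (cct_comp (@fst_cont _ _) cchi).
transitivity (cI mu (fun y => fourier mu f chi * chi (tail n y))); last first.
  by apply: etrans (cIZ mu _ ct1) _; exact: mulrC.
apply: eq_cI => y /=.
transitivity (cI mu (fun x => chi (tail n y) * (f (tail n y + x) * (chi (tail n y + x))^*))).
  apply: eq_cI => x; rewrite (dualM _ _ dchi) conjcM [x + _]addrC mulrCA; congr (_ * _).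
  by rewrite mulrA dual_mulcJ// mul1r.
apply: etrans (cIZ mu _ _) _; last first.
  rewrite (cI_translate cantor_haar (tail n y) (F := fun x => f x * (chi x)^*))//; exact: mulrC.
exact: (cct_comp (@translation_continuous _ (tail n y)) cfc).
Qed.

(* Both sides have the same Fourier coefficients. *)
Lemma tail_average_rademacher n f : cct f -> spectrum_in mu rademachers f ->
  tail_average n f =1 fun x => \sum_(i < n) fourier mu f (rademacher i) * rademacher i x.
Proof.
move=> cf hf x; apply/eqP; rewrite -subr_eq0; apply/eqP; move: x.
pose g x := \sum_(i < n) fourier mu f (rademacher i) * rademacher i x.
have cr (i : 'I_n) : cct (fun x => fourier mu f (rademacher i) * rademacher i x).
  by apply: cctM; [exact: cct_cst|exact: cct_rademacher].
have cg : cct g by exact: cct_sum.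
have cta := cct_tail_average n cf.
apply: (@fourier_uniqueness _ _ mu cantor_haar (fun x => tail_average n f x - g x)).
  by apply: cctD => //; exact: cctN.
move=> chi dchi; have cchi := dual_cct dchi.
transitivity (fourier mu (tail_average n f) chi - fourier mu g chi).
  apply: etrans (cIB mu _ _); last by [apply: cctM => //; exact: cctJ|apply: cctM => //; exact: cctJ].
    by apply: eq_cI => x; rewrite mulrBl.
  by apply: cctM => //; exact: cctJ.
rewrite fourier_tail_average//.
have -> : fourier mu g chi = \sum_(i < n) fourier mu f (rademacher i) * (rademacher i == chi)%:R.
  apply: etrans (ip_suml mu _ cr cchi) _; apply: eq_bigr => i _.
  apply: etrans (ipZl mu _ (cct_rademacher i) cchi) _; congr (_ * _).
  by apply: dual_ortho; rewrite ?inE//; [exact: cantor_haar|exact: dual_rademacher].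
have [[m _ mchi]|h] := pselect (rademachers chi); last first.
  rewrite hf// mulr0 big1 ?subrr// => i _.
  by rewrite (_ : _ == _ = false) ?mulr0//; apply/eqP => e; apply: h; exists i.
rewrite -mchi; have [mn|nm] := ltnP m n.
  rewrite (@big_only1 _ _ _ _ (Ordinal mn))//; last first.
    move=> i im _; rewrite (_ : _ == _ = false) ?mulr0//; apply/eqP => /rademacher_inj e.
    by move: im; rewrite -val_eqE/= e eqxx.
  rewrite eqxx mulr1 (_ : cI mu _ = 1) ?mul1r ?subrr//.
  apply: etrans _ (cI_cst mu 1); apply: eq_cI => y.
  by rewrite /rademacher /tail mn.
rewrite big1 ?subr0; last first.
  move=> i _; rewrite (_ : _ == _ = false) ?mulr0//; apply/eqP => /rademacher_inj e.
  by move: (ltn_ord i); rewrite e ltnNge nm.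
rewrite (_ : cI mu _ = 0) ?mul0r//.
have cm := cct_rademacher (R := R) m.
transitivity (cI mu (rademacher m)).
  by apply: eq_cI => y; rewrite /rademacher /tail ltnNge nm.
apply: (cI_quasi_invariant cantor_haar (a := unit_point m) (c := rademacher m (unit_point m))) => //.
  by rewrite /rademacher /unit_point eqxx; apply/eqP => /real_complex_inj/(@sign_of_inj R true false).
by move=> x; apply: dualM; exact: dual_rademacher.
Qed.

(** [f] varies little on each of finitely many cylinders that cover; with [n] the largest of their
    lengths, [x + tail n y] stays in a cylinder of [x]. *)
Lemma tail_average_close f (e : R) : cct f -> 0 < e ->
  exists n, forall x, normc (f x - tail_average n f x) <= e.
Proof.
move=> cf e0; have e2 : 0 < e / 2 by rewrite divr_gt0.
have /choice[N hN] : forall x : cantor, exists n, forall y, cyl (mkseq x n) y -> normc (f x - f y) < e / 2.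
  by move=> x; have [n h] := nbhs_cyl (proj1 (cctP f) cf x _ e2); exists n => y /h.
have [|s hs] := @finite_cover cantor cantor (fun x y => cyl (mkseq x (N x)) y).
  move=> y; exists y; exact: (open_nbhs_nbhs (conj (open_cyl _) (cyl_self y (N y)))).
exists (\max_(x <- s) N x) => x; set n := \max_(_ <- s) _.
rewrite -[f x](cI_cst mu); have cb := cct_tail_section n x cf.
rewrite -(cIB mu (cct_cst (f x)) cb); apply: normc_cI_bound.
  by apply: cctD; [exact: cct_cst|exact: cctN].
move=> y; have [a as_ ax] := hs x.
have ay : cyl (mkseq a (N a)) (x + tail n y).
  move/cyl_mkseq : ax => ax; apply/cyl_mkseq => i ia; rewrite -ax//.
  have -> : (x + tail n y) i = x i + tail n y i by [].
  rewrite /tail (_ : (i < n)%N); first exact: addr0.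
  by apply: leq_trans ia _; exact: leq_bigmax_seq.
rewrite (_ : f x - _ = (f a - f (x + tail n y)) - (f a - f x)); last first.
  by rewrite opprB [RHS]addrC addrA subrK.
apply: le_trans (normcD _ _) _; rewrite normcN (splitr e); apply: lerD; apply: ltW; exact: hN.
Qed.

(** [rademacher_l2] only bounds finite sums of squares, and [N2 f] is reached by approximation: for
    [f_n] the tail average, [<f - f_n, f>] equals [N2 f] minus the sum over [i < n], and is at most
    [e] because [f_n] is within [e / (J + 1)] of [f]. *)
Lemma rademachers_L2L1 : L2L1 mu rademachers (2 * expR 1).
Proof.
move=> f cf hf; set J := \int[mu]_x _.
have J0 : 0 <= J by apply: rI_ge0 => x; exact: normc_ge0.
apply/ler_addgt0Pr => e e0.
have e0' : 0 < e / (J + 1) by rewrite divr_gt0// ltr_wpDl.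
have [n hn] := tail_average_close cf e0'.
have cta := cct_tail_average n cf.
have cj : cct (fun x => (f x)^*) by exact: cctJ.
pose g x := f x - tail_average n f x.
have cg : cct g by apply: cctD => //; exact: cctN.
have E : ip mu g f = (N2 mu f)%:C - (\sum_(i < n) normc (fourier mu f (rademacher i)) ^+ 2)%:C.
  transitivity (ip mu f f - ip mu (tail_average n f) f).
    apply: etrans (cIB mu _ _); last by apply: cctM.
      by apply: eq_cI => x; rewrite mulrBl.
    by apply: cctM.
  rewrite ipxx; congr (_ - _).
  transitivity (ip mu (fun x => \sum_(i < n) fourier mu f (rademacher i) * rademacher i x) f).
    by apply: eq_cI => x; rewrite tail_average_rademacher.
  have cr (i : 'I_n) : cct (fun x => fourier mu f (rademacher i) * rademacher i x).
    by apply: cctM; [exact: cct_cst|exact: cct_rademacher].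
  apply: etrans (ip_suml mu _ cr cf) _; rewrite rmorph_sum; apply: eq_bigr => i _.
  apply: etrans (ipZl mu _ (cct_rademacher i) cf) _.
  by rewrite (ipC mu cf (cct_rademacher i)) mulcJ.
have : complex.Re (ip mu g f) <= e.
  apply: le_trans (ler_norm _) _; apply: le_trans (normc_Re _) _.
  apply: le_trans (normc_cI mu (cctM cg cj)) _.
  apply: (@le_trans _ _ (\int[mu]_x (e / (J + 1) * normc (f x)))).
    apply: rI_le.
    - by apply: cct_normc; exact: cctM.
    - by apply: ctM; [exact: ct_cst|exact: cct_normc].
    - by move=> x; rewrite normcM normc_conj ler_wpM2r ?normc_ge0//; exact: hn.
  rewrite rIZ; last exact: cct_normc.
  rewrite -/J mulrAC ler_pdivrMr ?ltr_wpDl// ler_pM2l// lerDl ler01//.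
rewrite E ReB /= lerBlDl => /le_trans; apply; rewrite lerD2r; exact: rademacher_l2.
Qed.

Lemma rademachers_Lambda2 : Lambda2 mu rademachers.
Proof. by apply: L2L1_Lambda2 rademachers_L2L1; rewrite mulr_ge0 ?expR_ge0. Qed.

End tail_average.

(** * Fractional products of Rademacher functions *)

Section finner.
Context {R : realType}.

Lemma powR_amgm (J : finType) (P : pred J) (q : nat) (z : J -> R) : #|P| = q -> (0 < q)%N ->
  (forall j, 0 <= z j) -> \prod_(j | P j) z j `^ q%:R^-1 <= \sum_(j | P j) q%:R^-1 * z j.
Proof.
move=> Pq q0 z0; have qn : q%:R^-1 != 0 :> R by rewrite invr_eq0 pnatr_eq0 -lt0n.
have R0 : 0 <= \sum_(j | P j) q%:R^-1 * z j.
  by apply: sumr_ge0 => j _; rewrite mulr_ge0 ?invr_ge0.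
have [/existsP[j /andP[Pj /eqP zj]]|/existsPn h] := boolP [exists j, P j && (z j == 0)].
  by rewrite (bigD1 j)//= zj powR0// mul0r.
have zp j : P j -> 0 < z j.
  by move=> Pj; have := h j; rewrite Pj /= => zj; rewrite lt0r zj z0.
have := @expR_jensen R J [seq j <- index_enum J | P j] (fun=> q%:R^-1) (fun j => ln (z j)) _ _.
rewrite !big_filter sumr_const Pq -(mulr_natr (q%:R^-1)) mulVf; last by rewrite pnatr_eq0 -lt0n.
have -> : \prod_(j | P j) z j `^ q%:R^-1 = expR (\sum_(j | P j) q%:R^-1 * ln (z j)).
  by rewrite expR_sum; apply: eq_bigr => j /zp zj; rewrite powR_exp.
move=> h1; apply: le_trans (h1 _ _) _ => //.
by apply: ler_sum => j /zp zj; rewrite lnK.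
Qed.

(** Each [x j] is normalised to total mass 1; AM-GM at every [a] then sums to 1. *)
Lemma powR_holder (A J : finType) (P : pred J) (q : nat) (x : J -> A -> R) : #|P| = q -> (0 < q)%N ->
  (forall j a, 0 <= x j a) ->
  \sum_a \prod_(j | P j) x j a `^ q%:R^-1 <= \prod_(j | P j) (\sum_a x j a) `^ q%:R^-1.
Proof.
move=> Pq q0 x0; have qn : q%:R^-1 != 0 :> R by rewrite invr_eq0 pnatr_eq0 -lt0n.
have X0 j : 0 <= \sum_a x j a by exact: sumr_ge0.
have [/existsP[j /andP[Pj /eqP xj]]|/existsPn h] := boolP [exists j, P j && (\sum_a x j a == 0)].
  rewrite big1; first by apply: prodr_ge0 => i _; exact: powR_ge0.
  move=> a _; rewrite (bigD1 j)//= (_ : x j a = 0) ?powR0 ?mul0r//.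
  by move/eqP: xj; rewrite psumr_eq0// => /allP/(_ a (mem_index_enum a))/eqP.
have Xp j : P j -> 0 < \sum_a x j a.
  by move=> Pj; have := h j; rewrite Pj /= => Xj; rewrite lt0r Xj X0.
set X := \prod_(j | P j) _.
have Xge : 0 <= X by apply: prodr_ge0 => i _; exact: powR_ge0.
apply: (@le_trans _ _ (\sum_a X * \sum_(j | P j) q%:R^-1 * (x j a / \sum_b x j b))).
  apply: ler_sum => a _.
  have -> : \prod_(j | P j) x j a `^ q%:R^-1 = X * \prod_(j | P j) (x j a / \sum_b x j b) `^ q%:R^-1.
    rewrite -big_split/=; apply: eq_bigr => j /Xp Xj.
    rewrite -powRM ?(ltW Xj)//; last by rewrite divr_ge0// ltW.
    by rewrite mulrCA mulfV ?mulr1// gt_eqF.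
  by rewrite ler_wpM2l//; apply: powR_amgm => // j; rewrite divr_ge0.
rewrite -mulr_sumr exchange_big/= (eq_bigr (fun=> q%:R^-1)); last first.
  by move=> j /Xp Xj; rewrite -mulr_sumr -mulr_suml mulfV ?mulr1// gt_eqF.
by rewrite sumr_const Pq -(mulr_natr (q%:R^-1)) mulVf ?mulr1// pnatr_eq0 -lt0n.
Qed.

Variables (I A : finType).
Local Notation W := {ffun I -> A}.
Implicit Types (w v : W) (G H : W -> R).

(** As with [rE], sums over some coordinates remain functions of the whole word, so that they
    iterate; [w] fills the coordinates that are not summed. *)
Definition updf w i (a : A) : W := [ffun k => if k == i then a else w k].
Definition coord_sum i G w : R := \sum_a G (updf w i a).
Definition coords_sum (s : seq I) G : W -> R := foldr coord_sum G s.

Lemma coord_sum_le i G H w : (forall v, G v <= H v) -> coord_sum i G w <= coord_sum i H w.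
Proof. by move=> h; apply: ler_sum => a _. Qed.

Lemma coords_sum_ge0 s G w : (forall v, 0 <= G v) -> 0 <= coords_sum s G w.
Proof. by elim: s w => //= i s IH w G0; apply: sumr_ge0 => a _; exact: IH. Qed.

Lemma updf_comm w i j a b : i != j -> updf (updf w i a) j b = updf (updf w j b) i a.
Proof.
move=> ij; apply/ffunP => k; rewrite !ffunE; case: eqVneq => [->|//].
by rewrite eq_sym (negbTE ij).
Qed.

Lemma coords_sum_indep s G i : i \notin s -> (forall w a, G (updf w i a) = G w) ->
  forall w a, coords_sum s G (updf w i a) = coords_sum s G w.
Proof.
move=> + hG; elim: s => //= j s IH; rewrite inE negb_or => /andP[ij is_] w a.
by apply: eq_bigr => b _; rewrite updf_comm// IH.
Qed.

Lemma coords_sumE s G w : uniq s ->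
  coords_sum s G w = \sum_(v : W | [forall i, (i \notin s) ==> (v i == w i)]) G v.
Proof.
elim: s w => [|i s IH] w /=.
  move=> _; rewrite (big_pred1 w)// => v; apply/forallP/eqP => [h|-> j]; last by rewrite eqxx ?implybT.
  by apply/ffunP => j; apply/eqP; have := h j.
move=> /andP[is_ us]; rewrite [RHS](partition_big (fun v : W => v i) xpredT)//=.
apply: eq_bigr => a _; rewrite IH//; apply: eq_bigl => v.
apply/forallP/andP => [h|[/forallP h /eqP vi] j].
  split; last by have := h i; rewrite is_ /= ffunE eqxx.
  apply/forallP => j; apply/implyP; rewrite inE negb_or => /andP[ji js].
  by have := h j; rewrite js /= ffunE (negbTE ji).
apply/implyP => js; rewrite ffunE; case: (eqVneq j i) => [->|ji]; first by rewrite vi.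
by have := h j; rewrite inE negb_or ji js.
Qed.

(* Finner's inequality for a uniform fractional cover, by Hölder's inequality
   in one coordinate after another. *)
Lemma finner (J : finType) (S : J -> {set I}) (q : nat) (F : J -> W -> R) (w : W) :
  (0 < q)%N -> (forall i, #|[pred j | i \in S j]| = q) -> (forall j v, 0 <= F j v) ->
  (forall j i v a, i \notin S j -> F j (updf v i a) = F j v) ->
  \sum_v \prod_j F j v `^ q%:R^-1 <= \prod_j (coords_sum (enum (S j)) (F j) w) `^ q%:R^-1.
Proof.
move=> q0 hq F0 hF.
have key s v : coords_sum s (fun v => \prod_j F j v `^ q%:R^-1) v <=
    \prod_j (coords_sum [seq i <- s | i \in S j] (F j) v) `^ q%:R^-1.
  elim: s v => //= i s IH v; apply: le_trans (coord_sum_le _ _ IH) _.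
  rewrite /coord_sum (bigID (fun j => i \in S j))/=.
  apply: (@le_trans _ _ (\sum_a (\prod_(j | i \in S j)
     (coords_sum [seq k <- s | k \in S j] (F j) (updf v i a)) `^ q%:R^-1) *
     \prod_(j | i \notin S j) (coords_sum [seq k <- s | k \in S j] (F j) v) `^ q%:R^-1)).
    apply: ler_sum => a _; rewrite (bigID (fun j => i \in S j))/=.
    rewrite le_eqVlt; apply/orP; left; apply/eqP; congr (_ * _); apply: eq_bigr => j ij.
    rewrite coords_sum_indep//; first by rewrite mem_filter (negbTE ij).
    by move=> u b; exact: hF.
  rewrite -mulr_suml; apply: ler_pM.
  - by apply: sumr_ge0 => a _; apply: prodr_ge0 => j _; exact: powR_ge0.
  - by apply: prodr_ge0 => j _; exact: powR_ge0.
  - apply: le_trans (powR_holder (P := fun j => i \in S j) (q := q) _ q0 _) _.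
    + by rewrite -(hq i); apply: eq_card => j.
    + by move=> j a; apply: coords_sum_ge0.
    + by rewrite le_eqVlt; apply/orP; left; apply/eqP; apply: eq_bigr => j ij; rewrite ij.
  - rewrite le_eqVlt; apply/orP; left; apply/eqP; apply: eq_bigr => j ij; by rewrite (negbTE ij).
have -> : \sum_v \prod_j F j v `^ q%:R^-1 = coords_sum (enum I) (fun v => \prod_j F j v `^ q%:R^-1) w.
  rewrite coords_sumE ?enum_uniq//; apply: eq_bigl => v.
  by apply/esym/forallP => i; rewrite mem_enum.
apply: le_trans (key (enum I) w) _; rewrite le_eqVlt; apply/orP; left; apply/eqP.
by apply: eq_bigr => j _; rewrite enumT.
Qed.

End finner.

Lemma powR_exponent_le {R : realType} (x p q : R) : 0 <= x <= 1 -> 0 < q <= p -> x `^ p <= x `^ q.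
Proof.
move=> /andP[x0 x1] /andP[q0 qp]; have [->|xn] := eqVneq x 0.
  by rewrite !powR0 ?gt_eqF// (lt_le_trans q0).
have xp : 0 < x by rewrite lt0r xn.
by rewrite !powR_exp// ler_expR ler_wnM2r// ln_le0.
Qed.

Lemma normc_fourier_le1 {R : realType} {X : compactAbGroupType} (mu : probability (borel X) R) f g :
  cct f -> (forall x, normc (f x) <= 1) -> dual R X g -> normc (fourier mu f g) <= 1.
Proof.
move=> cf f1 dg; apply: (normc_cI_bound mu).
  by apply: cctM => //; apply: cctJ; exact: dual_cct.
by move=> x; rewrite normcM normc_conj (dual_normc _ dg) mulr1.
Qed.

Section fractional_sets.
Context {R : realType} (d : nat) (S : 'I_d -> {set 'I_d}).
Implicit Types (v : 'I_d -> nat).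
Local Notation H := (cantor_power d).

(* [pickle] makes the index of the Rademacher function in the j-th variable
   an injective function of the restriction of the word [v] to [S j]. *)
Definition code v (j : 'I_d) : nat := pickle (map v (enum (S j))).

Definition frac_char v : H -> R[i] := prod_char (fun j => rademacher (code v j)).

Definition frac_set : set (H -> R[i]) := range frac_char.

Lemma eq_code v v' j : (forall i, i \in S j -> v i = v' i) -> code v j = code v' j.
Proof. by move=> h; congr pickle; apply/eq_in_map => i; rewrite mem_enum; exact: h. Qed.

Lemma code_inj v v' j i : code v j = code v' j -> i \in S j -> v i = v' i.
Proof.
move=> /(pcan_inj pickleK) h iS; move/eq_in_map : h; apply; by rewrite mem_enum.
Qed.

Definition coord_iota (j : 'I_d) (t : cantor) : H := @iota 'I_d (fun _ => cantor) j t.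

Lemma frac_char_iota v j : (fun t : cantor => frac_char v (coord_iota j t)) = rademacher (code v j).
Proof.
by apply/funext => t; rewrite /frac_char /coord_iota prod_char_iota// => k; exact: dual_rademacher.
Qed.

Lemma frac_char_inj v v' : (forall i, exists j, i \in S j) -> frac_char v = frac_char v' -> v =1 v'.
Proof.
move=> hS e i; have [j iS] := hS i; apply: code_inj iS.
have := congr1 (fun F => (fun t : cantor => F (coord_iota j t))) e.
by rewrite !frac_char_iota => /(@rademacher_inj R).
Qed.

Lemma frac_prod_spectrum : frac_set `<=` prod_spectrum (fun _ : 'I_d => @rademachers R).
Proof. by move=> _ [v _ <-]; exists (fun j => rademacher (code v j)) => //= j; exists (code v j). Qed.

Lemma frac_set_dual : frac_set `<=` dual R H.
Proof. by move=> g /frac_prod_spectrum; apply: prod_spectrum_dual => j; exact: rademachers_dual. Qed.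

Variable nu : probability (borel H) R.
Hypothesis hnu : is_haar nu.
Local Notation mu := (fun _ : 'I_d => @cantor_measure R).

Lemma frac_spectrum f : spectrum_in nu frac_set f ->
  spectrum_in nu (prod_spectrum (fun _ : 'I_d => @rademachers R)) f.
Proof. by move=> hf g dg hg; apply: hf => // /frac_prod_spectrum. Qed.

Lemma frac_Lambda2 : Lambda2 nu frac_set.
Proof.
have C0 (j : 'I_d) : 0 <= 2 * expR 1 :> R by rewrite mulr_ge0 ?expR_ge0.
apply: (@L2L1_Lambda2 _ _ _ _ (\prod_(j < d) (2 * expR 1))).
  by apply: prodr_ge0 => j _; exact: C0.
move=> f cf /frac_spectrum hf.
have := @L2L1_prod _ _ _ mu (fun _ => cantor_haar) nu hnu (fun _ => rademachers)
  (fun _ => rademachers_dual) (fun _ => 2 * expR 1) C0 (fun _ => rademachers_L2L1).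
by apply.
Qed.

(** Rademacher functions have [t = 1/2], and the weights are [1/d]. Since each position lies in [q]
    windows, Finner's inequality asks for product exponents [v = 1/(2q)]; the balance
    [(1 - s)/(2q) = s/(2d)] then gives [s = d/(d + q)]. *)
Lemma frac_sidon (q : nat) (p : R) : (0 < d)%N -> (0 < q)%N ->
  (forall i, #|[pred j | i \in S j]| = q) -> 2 * d%:R / (d%:R + q%:R) <= p ->
  sidon nu p frac_set.
Proof.
move=> d0 q0 hq hp.
have dR : 0 < d%:R :> R by rewrite ltr0n.
have qR : 0 < q%:R :> R by rewrite ltr0n.
have dn : d%:R != 0 :> R by rewrite gt_eqF.
have qn : q%:R != 0 :> R by rewrite gt_eqF.
have dqn : d%:R + q%:R != 0 :> R by rewrite gt_eqF// addr_gt0.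
pose p0 : R := 2 * d%:R / (d%:R + q%:R).
have p00 : 0 < p0 by rewrite divr_gt0 ?mulr_gt0 ?addr_gt0.
have hmu (j : 'I_d) : is_haar (mu j) by exact: cantor_haar.
have Ld (j : 'I_d) : @rademachers R `<=` dual R cantor by exact: rademachers_dual.
have [C C0 hC] := @marginal_bound _ _ _ mu hmu nu hnu (fun _ => rademachers) Ld (fun _ => 1)
  (fun _ => lexx 1) (fun _ => conj rademachers_sidon rademachers_Lambda2).
have hS i : exists j, i \in S j.
  have : (0 < #|[pred j | i \in S j]|)%N by rewrite hq.
  by case/card_gt0P => j; exists j.
pose s : R := p0 / 2.
pose D : R := \prod_(j < d) C `^ q%:R^-1.
apply: (@sidon_intro _ _ nu _ p (s * C + (1 - s) * D)); first exact: lt_le_trans hp.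
move=> f cf hf f1 X uX Xd.
(* The coefficients are at most 1, so the smallest exponent is the strongest case. *)
apply: (@le_trans _ _ (\sum_(g <- X) normc (fourier nu f g) `^ p0)).
  rewrite big_seq [leRHS]big_seq; apply: ler_sum => g /Xd dg.
  apply: powR_exponent_le; last by rewrite p00.
  by apply/andP; split; [exact: normc_ge0|exact: normc_fourier_le1].
rewrite (sum_over_spectrum hf p00 Xd) -/s; set Y := [seq g <- X | _].
have uY : uniq Y by exact: filter_uniq.
have /choice[vg hvg] : forall g, exists v, frac_set g -> frac_char v = g.
  move=> g; have [[v _ vg]|h] := pselect (frac_set g); first by exists v.
  by exists (fun=> 0%N).
have YL g : g \in Y -> frac_char (vg g) = g.
  by rewrite mem_filter => /andP[/asboolP h _]; exact: hvg.
have hf' := frac_spectrum hf.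
(* Finitely many words occur; bounding their letters by [N] turns them into words over a finite
   alphabet, the setting of [finner]. *)
pose N := \max_(g <- Y) \max_(i < d) vg g i.
have vgN g i : g \in Y -> (vg g i < N.+1)%N.
  move=> gY; rewrite ltnS; apply: (@leq_trans (\max_(i < d) vg g i)); first exact: leq_bigmax.
  exact: (@leq_bigmax_seq _ Y xpredT (fun g => \max_(i < d) vg g i)).
pose nv (v : {ffun 'I_d -> 'I_N.+1}) (i : 'I_d) : nat := v i.
pose toW g : {ffun 'I_d -> 'I_N.+1} := [ffun i => inord (vg g i)].
have toWE g i : g \in Y -> nv (toW g) i = vg g i.
  by move=> gY; rewrite /nv ffunE inordK// vgN.
have toWc g j : g \in Y -> code (nv (toW g)) j = code (vg g) j.
  by move=> gY; apply: eq_code => i _; exact: toWE.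
have [c [c0 cE]] : exists c : 'I_d -> (cantor -> R[i]) -> R, (forall j g, 0 <= c j g) /\
    forall (j : 'I_d) n, c j (rademacher n) = N2 nu (proj mu (rademacher n : (fun _ : 'I_d => cantor) j -> R[i]) f).
  exists (fun j g => N2 nu (proj mu (g : (fun _ : 'I_d => cantor) j -> R[i]) f)); split => // j g; exact: N2_ge0.
have cC j (t : seq nat) : uniq t -> \sum_(n <- t) c j (rademacher n) `^ 2^-1 <= C.
  move=> ut; have := hC f cf hf' f1 j [seq rademacher n | n <- t].
  rewrite map_inj_uniq; last exact: rademacher_inj.
  move=> /(_ ut); rewrite big_map => h; apply: le_trans (h _); last by move=> _ /mapP[n _ ->]; exists n.
  by apply: ler_sum => n _; rewrite cE mul1r.
pose k (j : 'I_d) (chi : H -> R[i]) : cantor -> R[i] := fun t => chi (coord_iota j t).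
have kE j g : g \in Y -> k j g = rademacher (code (vg g) j).
  by move=> /YL gY; rewrite -[RHS]frac_char_iota gY.
apply: (@marginal_inequality R 'I_d _ (fun _ => (cantor -> R[i] : eqType)) Y k _
  (fun j g => if `[< rademachers g >] then c j g else 0) s (fun=> d%:R^-1) (fun=> 2^-1)
  (fun=> (2 * d%:R)^-1) (fun=> 2^-1 * q%:R^-1)).
- rewrite /s /p0 divr_gt0//= ler_pdivrMr// mul1r ler_pdivrMr ?addr_gt0// ler_pM2l// lerDl ltW//.
- by move=> j; rewrite invr_ge0.
- by rewrite sumr_const card_ord -(mulr_natr (d%:R^-1)) mulVf.
- by move=> j; field.
- by move=> j; rewrite /s /p0; field; rewrite dqn dn qn.
- by move=> j; rewrite invr_gt0.
- by move=> a; rewrite sqr_ge0.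
- by move=> j g; case: ifP.
- move=> j g; rewrite -big_filter.
  have [[n _ gn]|hg] := pselect (rademachers g); last first.
    rewrite big_seq big1 ?asboolF// => chi; rewrite mem_filter => /andP[/eqP kg] chiY.
    by exfalso; apply: hg; rewrite -kg kE//; exists (code (vg chi) j).
  rewrite asboolT; last by exists n.
  rewrite -gn cE; apply: (proj_bessel hmu hnu) => //.
  + exact: dual_rademacher.
  + exact: filter_uniq.
  + move=> chi; rewrite mem_filter => /andP[/eqP kg chiY]; split; last by rewrite -kg.
    by rewrite -(YL _ chiY); apply: frac_set_dual; exists (vg chi).
- move=> j; set t := undup _.
  have tE : t = [seq rademacher n | n <- undup [seq code (vg g) j | g <- Y]].
    rewrite -undup_map_inj; last exact: rademacher_inj.
    by rewrite /t -map_comp; congr undup; apply/eq_in_map => g /kE.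
  rewrite tE big_map; apply: le_trans (cC j _ (undup_uniq _)).
  by apply: ler_sum => n _; rewrite asboolT//; exists n.
- pose F (j : 'I_d) (v : {ffun 'I_d -> 'I_N.+1}) := c j (rademacher (code (nv v) j)) `^ 2^-1.
  have F0 j (v : {ffun 'I_d -> 'I_N.+1}) : 0 <= F j v by exact: powR_ge0.
  have hF j i (v : {ffun 'I_d -> 'I_N.+1}) a : i \notin S j -> F j (updf v i a) = F j v.
    move=> iS; rewrite /F (_ : code _ j = code (nv v) j)//; apply: eq_code => l lS.
    by rewrite /nv ffunE; case: eqVneq => [li|//]; rewrite -li lS in iS.
  apply: (@le_trans _ _ (\sum_(g <- Y) \prod_j F j (toW g) `^ q%:R^-1)).
    rewrite big_seq [leRHS]big_seq; apply: ler_sum => g gY.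
    rewrite le_eqVlt; apply/orP; left; apply/eqP; apply: eq_bigr => j _.
    by rewrite /F toWc// kE// asboolT ?powRrM//; exists (code (vg g) j).
  rewrite -(big_map toW xpredT (fun v : {ffun 'I_d -> 'I_N.+1} => \prod_j F j v `^ q%:R^-1)).
  apply: le_trans (sum_uniq_le _ _) _.
  + rewrite map_inj_in_uniq// => g h gY hY e; rewrite -(YL _ gY) -(YL _ hY); congr prod_char.
    by apply/funext => j; rewrite -!toWc// e.
  + by move=> v; apply: prodr_ge0 => j _; exact: powR_ge0.
  apply: le_trans (finner [ffun=> ord0] q0 hq F0 hF) _.
  apply: ler_prod => j _; rewrite powR_ge0/=.
  have G0 : 0 <= coords_sum (enum (S j)) (F j) [ffun=> ord0] by exact: coords_sum_ge0.
  apply: ge0_ler_powR; rewrite ?nnegrE ?invr_ge0//.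
  (* The words summed here agree with the default outside [S j], so they are determined by their
     code: the sum runs over distinct Rademacher functions and [cC] applies. *)
  rewrite coords_sumE ?enum_uniq// -big_filter.
  set V := [seq v <- _ | _].
  rewrite -(big_map (fun v : {ffun 'I_d -> 'I_N.+1} => code (nv v) j) xpredT (fun n => c j (rademacher n) `^ 2^-1)).
  apply: cC; rewrite map_inj_in_uniq; first by rewrite filter_uniq// index_enum_uniq.
  move=> v v'; rewrite !mem_filter => /andP[/forallP h _] /andP[/forallP h' _] e.
  apply/ffunP => i; have [iS|iS] := boolP (i \in S j); first exact/val_inj/(code_inj e iS).
  have := h i; have := h' i; rewrite mem_enum iS /= => /eqP -> /eqP ->; by [].
Qed.

End fractional_sets.

(** * Failure of the Sidon property *)

Section random_signs.
Context {R : realType}.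

(** The sharp constant is 1/2. With the constant 2 the tangent inequality is enough: beyond 1/2 one
    has [x <= 2 x^2], and below it [expR x <= 1/(1 - x)]. *)
Lemma cosh_le (x : R) : 0 <= x -> expR x + expR (- x) <= 2 * expR (2 * x ^+ 2).
Proof.
move=> x0; have [x2|x2] := ltP (2^-1) x.
  rewrite mulr_natl mulr2n; apply: lerD; rewrite ler_expR; last first.
    by apply: (@le_trans _ _ 0); [rewrite oppr_le0|rewrite mulr_ge0// sqr_ge0].
  rewrite expr2 mulrA -[leLHS]mul1r ler_wpM2r//; lra.
have h1 : expR x <= (1 - x)^-1.
  have := expR_tangent (- x); rewrite expRN => h.
  by rewrite -[leLHS]invrK lef_pV2 ?posrE ?invr_gt0 ?expR_gt0//; lra.
have h2 : expR (- x) <= (1 + x)^-1.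
  by rewrite expRN lef_pV2 ?posrE ?expR_gt0 ?expR_tangent//; lra.
apply: le_trans (lerD h1 h2) _.
apply: (@le_trans _ _ (2 * (1 + 2 * x ^+ 2))); last by rewrite ler_pM2l// expR_tangent.
have xx : x ^+ 2 <= 4^-1 by rewrite expr2; nra.
have -> : (1 - x)^-1 + (1 + x)^-1 = 2 / (1 - x ^+ 2).
  by field; apply/and3P; split; rewrite gt_eqF//; nra.
rewrite ler_pM2l// -[leLHS]mul1r ler_pdivrMr ?mul1r; last by lra.
have := sqr_ge0 x; set y := x ^+ 2 in xx * => y0; nra.
Qed.

Lemma sum_signs_expR (W : finType) (e : W -> R) (l : R) : 0 <= l -> (forall w, e w = 1 \/ e w = -1) ->
  \sum_(s : {ffun W -> bool}) expR (l * \sum_w sign_of (s w) * e w) <= 2 ^+ #|W| * expR (2 * l ^+ 2 * #|W|%:R).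
Proof.
move=> l0 he.
rewrite (eq_bigr (fun s : {ffun W -> bool} => \prod_w expR (l * (sign_of (s w) * e w)))); last first.
  by move=> s _; rewrite mulr_sumr expR_sum.
rewrite -(bigA_distr_bigA (fun w b => expR (l * (sign_of b * e w)))).
have -> : expR (2 * l ^+ 2 * #|W|%:R) = \prod_(w : W) expR (2 * l ^+ 2).
  by rewrite -expR_sum sumr_const mulr_natr.
rewrite -prodr_const -big_split/=; apply: ler_prod => w _.
rewrite big_bool /sign_of expr1 expr0 mul1r addr_ge0 ?expR_ge0//=.
case: (he w) => ->; rewrite ?(mulr1, mulN1r, opprK, mulrN1).
  by rewrite addrC; exact: cosh_le.
exact: cosh_le.
Qed.

(* The Salem-Zygmund argument: some choice of signs does better than the
   average of an exponential moment. *)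
Lemma random_signs (W Z : finType) (e : W -> Z -> R) (n : nat) :
  (forall w z, e w z = 1 \/ e w z = -1) -> (0 < #|W|)%N -> (0 < n)%N -> (#|Z| <= 2 ^ n)%N ->
  exists s : W -> bool, forall z,
    `|\sum_w sign_of (s w) * e w z| <= 4 * Num.sqrt (n%:R * #|W|%:R).
Proof.
move=> he W0 n0 Zn; set B := 4 * _; set N := #|W| in W0 B *.
have N0 : 0 < N%:R :> R by rewrite ltr0n.
have nR : 0 < n%:R :> R by rewrite ltr0n.
apply: contrapT => hs.
have /choice[z hz] : forall s : {ffun W -> bool}, exists z, B < `|\sum_w sign_of (s w) * e w z|.
  move=> s; apply: contrapT => h; apply: hs; exists s => z.
  by rewrite leNgt; apply/negP => hz; apply: h; exists z.
(* With this [l] the exponential moment of one sum is at most [2^N expR (2n)], and the union over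
   [Z] and both signs costs at most [expR (2n)]; the constant 4 in [B] makes [l * B] equal to [4n],
   just out of reach. *)
pose l := Num.sqrt (n%:R / N%:R) : R.
have l0 : 0 < l by rewrite sqrtr_gt0 divr_gt0.
have l2 : l ^+ 2 * N%:R = n%:R by rewrite sqr_sqrtr ?divr_ge0// divfK// gt_eqF.
have lB : l * B = 4 * n%:R.
  rewrite /B mulrCA -sqrtrM ?divr_ge0//; congr (_ * _).
  by rewrite mulrCA mulfVK ?gt_eqF// -expr2 sqrtr_sqr ger0_norm.
pose S (s : {ffun W -> bool}) zz := \sum_w sign_of (s w) * e w zz.
have low (s : {ffun W -> bool}) : expR (4 * n%:R) < \sum_zz (expR (l * S s zz) + expR (l * - S s zz)).
  rewrite (bigD1 (z s))//=; apply: ltr_wpDr.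
    by apply: sumr_ge0 => y _; rewrite addr_ge0 ?expR_ge0.
  have : expR (4 * n%:R) < expR (l * `|S s (z s)|) by rewrite ltr_expR -lB ltr_pM2l//; exact: hz.
  move=> /lt_le_trans; apply; case: (ger0P (S s (z s))) => _; [rewrite lerDl|rewrite lerDr]; exact: expR_ge0.
have tot : \sum_(s : {ffun W -> bool}) \sum_zz (expR (l * S s zz) + expR (l * - S s zz)) <=
    #|Z|%:R * (2 * (2 ^+ N * expR (2 * n%:R))).
  rewrite exchange_big/= mulr_natl -sumr_const; apply: ler_sum => zz _.
  rewrite big_split/= mulr_natl mulr2n -l2 mulrA.
  apply: lerD; first by apply: sum_signs_expR => //; exact: ltW.
  rewrite (eq_bigr (fun s : {ffun W -> bool} => expR (l * \sum_w sign_of (s w) * - e w zz))); last first.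
    by move=> s _; rewrite -sumrN; under eq_bigr do rewrite -mulrN.
  apply: sum_signs_expR; first exact: ltW.
  by move=> w; case: (he w zz) => ->; [right|left; rewrite opprK].
have card : \sum_(s : {ffun W -> bool}) expR (4 * n%:R) = 2 ^+ N * expR (4 * n%:R) :> R.
  by rewrite sumr_const card_ffun card_bool -[LHS]mulr_natl natrX.
have : \sum_(s : {ffun W -> bool}) expR (4 * n%:R : R) <
    \sum_(s : {ffun W -> bool}) \sum_zz (expR (l * S s zz) + expR (l * - S s zz)).
  apply: ltr_sum => [|s _]; last exact: low.
  by apply/hasP; exists [ffun=> true]; rewrite ?mem_index_enum.
rewrite card => /lt_le_trans/(_ tot); apply/negP; rewrite -leNgt.
have p2 : 0 < 2 ^+ N :> R by rewrite exprn_gt0.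
rewrite mulrCA [X in _ * X]mulrCA mulrCA ler_pM2l// mulrA.
have e2 : 2 <= expR 1 :> R by have := expR_tangent (1 : R); lra.
have en : 2 <= expR n%:R :> R by apply: le_trans e2 _; rewrite ler_expR ler1n.
have zn : #|Z|%:R <= expR n%:R :> R.
  apply: (@le_trans _ _ ((2 ^ n)%:R)); first by rewrite ler_nat.
  rewrite natrX -[n%:R]mulr1 expRM_natl; apply: lerXn2r => //; by rewrite nnegrE ?expR_ge0.
have -> : expR (4 * n%:R) = expR n%:R * expR n%:R * expR (2 * n%:R) :> R.
  by rewrite -!expRD; congr expR; ring.
by rewrite ler_wpM2r ?expR_ge0// ler_pM.
Qed.

End random_signs.

Section not_sidon.
Context {R : realType} (m : nat) (d : 'I_m -> nat) (S : forall k, 'I_(d k) -> {set 'I_(d k)}) (q : nat).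
Hypothesis hS : forall k (i : 'I_(d k)), exists j, i \in S j.
Hypothesis hq : forall k (j : 'I_(d k)), #|S j| = q.
Local Notation G := (fun k => cantor_power (d k)).
Local Notation P := (prod_topology G).
Variable nu : probability (borel P) R.
Hypothesis hnu : is_haar nu.
Local Notation L := (fun k => @frac_set R _ (@S k)).
Local Notation T := {k : 'I_m & 'I_(d k)}.

Let Ldual k : L k `<=` dual R (G k). Proof. exact: frac_set_dual. Qed.

Definition word_at (v : T -> nat) (k : 'I_m) (j : 'I_(d k)) : nat := v (Tagged (fun k => 'I_(d k)) j).

Definition word_char (v : T -> nat) : P -> R[i] := prod_char (fun k => frac_char (@S k) (word_at v (k := k))).

Lemma word_char_spectrum v : prod_spectrum L (word_char v).
Proof. by exists (fun k => frac_char (@S k) (word_at v (k := k))) => //= k; exists (word_at v (k := k)). Qed.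

Lemma word_char_dual v : dual R P (word_char v).
Proof. exact: (prod_spectrum_dual Ldual (word_char_spectrum v)). Qed.

Lemma word_char_inj v v' : word_char v = word_char v' -> v =1 v'.
Proof.
move=> e [k j].
have := congr1 (fun F => (fun t : G k => F (@iota _ G k t))) e.
have it w : (fun t : G k => word_char w (@iota _ G k t)) = frac_char (@S k) (word_at w (k := k)).
  apply/funext => t; rewrite /word_char prod_char_iota// => i; apply: (Ldual (k := i)).
  by exists (word_at w (k := i)).
by rewrite !it => /(frac_char_inj (@hS k))/(_ j).
Qed.

Lemma prod_pm1 (J : finType) (F : J -> R) : (forall j, F j = 1 \/ F j = -1) ->
  \prod_j F j = 1 \/ \prod_j F j = -1.
Proof.
move=> hF; apply: (big_ind (fun x => x = 1 \/ x = -1)) => [|x y [->|->] [->|->]|//]; first by left.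
- by left; rewrite mulr1.
- by right; rewrite mul1r.
- by right; rewrite mulr1.
- by left; rewrite mulrNN mulr1.
Qed.

Lemma signed_sum_bound (M : nat) : (0 < M)%N -> (0 < #|{: T}|)%N ->
  exists s : {ffun T -> 'I_M} -> bool, forall x : P,
    normc (\sum_(w : {ffun T -> 'I_M}) (sign_of (s w) : R)%:C * word_char (fun t => w t) x) <=
    4 * Num.sqrt ((#|{: T}| * M ^ q)%:R * (M ^ #|{: T}|)%:R).
Proof.
move=> M0 T0; pose U := q.-tuple 'I_M; pose u0 : U := nseq_tuple q (Ordinal M0).
(* [T] here indexes the windows, of which a factor has as many as positions; a sign belongs to a
   window and its content, hence [#|T| * M ^ q] signs. *)
pose Z := {ffun T * U -> bool}.
(* The default [u0] is never returned, as a window has exactly [q] letters. *)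
pose u (w : {ffun T -> 'I_M}) k (j : 'I_(d k)) : U :=
  insubd u0 [seq w (Tagged (fun k => 'I_(d k)) i) | i <- enum (S j)].
pose e (w : {ffun T -> 'I_M}) (z : Z) : R :=
  \prod_(k < m) \prod_(j < d k) sign_of (z (Tagged (fun k => 'I_(d k)) j, u w k j)).
pose zx (x : P) : Z := [ffun p : T * U => x (tag p.1) (tagged p.1) (pickle (map (fun i : 'I_M => val i) p.2))].
have uE (w : {ffun T -> 'I_M}) k (j : 'I_(d k)) : pickle (map (fun i : 'I_M => val i) (u w k j)) =
    code (@S k) (word_at (fun t => w t) (k := k)) j.
  rewrite /u val_insubd size_map -cardE hq eqxx /code; congr pickle.
  by rewrite -map_comp.
have eE (w : {ffun T -> 'I_M}) (x : P) : word_char (fun t => w t) x = (e w (zx x))%:C.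
  rewrite /e rmorph_prod; apply: eq_bigr => k _; rewrite rmorph_prod; apply: eq_bigr => j _.
  by rewrite ffunE uE.
have pm w z : e w z = 1 \/ e w z = -1.
  apply: prod_pm1 => k; apply: prod_pm1 => j.
  by rewrite /sign_of; case: (z _); [right|left].
have [|||s hs] := @random_signs R _ Z e (#|{: T}| * M ^ q) pm.
- by rewrite card_ffun card_ord expn_gt0 M0.
- by rewrite muln_gt0 T0 expn_gt0 M0.
- by rewrite card_ffun card_bool card_prod card_tuple card_ord.
exists s => x; have := hs (zx x); rewrite card_ffun card_ord.
rewrite -normcR rmorph_sum => h; apply: le_trans _ h; rewrite le_eqVlt; apply/orP; left; apply/eqP.
by congr normc; apply: eq_bigr => w _; rewrite eE rmorphM.
Qed.

(** The test function is the signed sum over all words, divided by its bound [B]: it has [M^D]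
    coefficients of modulus [1/B]. *)
Lemma sidon_word_bound (r : R) : 0 < r -> (0 < #|{: T}|)%N -> sidon nu r (prod_spectrum L) ->
  exists2 K : R, 0 <= K & forall M : nat, (0 < M)%N ->
    (M ^ #|{: T}|)%:R <= K * (4 * Num.sqrt ((#|{: T}| * M ^ q)%:R * (M ^ #|{: T}|)%:R)) `^ r.
Proof.
move=> r0 T0 /(sidon_elim r0)[K K0 hK]; exists K => // M M0.
have [s hs] := signed_sum_bound M0 T0.
set B := 4 * _ in hs *.
have B0 : 0 < B.
  by rewrite mulr_gt0// sqrtr_gt0 mulr_gt0// ltr0n ?muln_gt0 ?T0 ?expn_gt0 ?M0.
pose chi (w : {ffun T -> 'I_M}) := word_char (fun t => w t).
have cchi w : cct (chi w) by exact: dual_cct (word_char_dual _).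
have chi_inj : injective chi.
  by move=> w w' /word_char_inj h; apply/ffunP => t; apply/val_inj; exact: h.
pose f x := \sum_w (B^-1 * sign_of (s w))%:C * chi w x.
have cterm w : cct (fun x => (B^-1 * sign_of (s w))%:C * chi w x).
  by apply: cctM => //; exact: cct_cst.
have cf : cct f by exact: cct_sum.
have fip g : dual R P g -> fourier nu f g = \sum_w (B^-1 * sign_of (s w))%:C * (chi w == g)%:R.
  move=> dg; apply: etrans (ip_suml nu _ cterm (dual_cct dg)) _; apply: eq_bigr => w _.
  apply: etrans (ipZl nu _ (cchi w) (dual_cct dg)) _; congr (_ * _).
  by apply: (dual_ortho hnu); rewrite ?inE//; exact: word_char_dual.
have hf : spectrum_in nu (prod_spectrum L) f.
  move=> g dg hg; rewrite fip// big1// => w _; rewrite (_ : _ == _ = false) ?mulr0//.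
  by apply/eqP => e; apply: hg; rewrite -e; exact: word_char_spectrum.
have f1 x : normc (f x) <= 1.
  have -> : f x = (B^-1)%:C * \sum_w (sign_of (s w) : R)%:C * chi w x.
    by rewrite mulr_sumr; apply: eq_bigr => w _; rewrite rmorphM mulrA.
  rewrite normcM normcR ger0_norm ?invr_ge0 ?(ltW B0)//.
  by rewrite mulrC ler_pdivrMr// mul1r; exact: hs.
have ul : uniq [seq chi w | w <- index_enum {ffun T -> 'I_M}].
  by rewrite map_inj_uniq// index_enum_uniq.
have dl g : g \in [seq chi w | w <- index_enum {ffun T -> 'I_M}] -> dual R P g.
  by move=> /mapP[w _ ->]; exact: word_char_dual.
have h := hK f cf hf f1 _ ul dl.
have {}h : (B^-1) `^ r *+ M ^ #|{: T}| <= K.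
  apply: le_trans h; rewrite big_map le_eqVlt; apply/orP; left; apply/eqP.
  rewrite (eq_bigr (fun=> (B^-1) `^ r)); last first.
    move=> w _; rewrite fip; last exact: word_char_dual.
    rewrite (@big_only1 _ _ _ _ w)// => [|w' ww' _]; last first.
      by rewrite (_ : _ == _ = false) ?mulr0//; apply/eqP => /chi_inj ew; rewrite ew eqxx in ww'.
    rewrite eqxx mulr1 normcR normrM ger0_norm ?invr_ge0 ?(ltW B0)//.
    by rewrite /sign_of normrX normrN1 expr1n mulr1.
  by rewrite sumr_const card_ffun card_ord.
have Br : 0 < B `^ r by exact: powR_gt0.
rewrite -ler_pdivrMr//; apply: le_trans h; rewrite -[leRHS]mulr_natr mulrC.
by rewrite -(powR_inv1 (ltW B0)) -powRrM mulN1r powRN.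
Qed.

Lemma not_sidon (r : R) : 0 < r -> (0 < #|{: T}|)%N ->
  r * (#|{: T}|%:R + q%:R) < 2 * #|{: T}|%:R -> ~ sidon nu r (prod_spectrum L).
Proof.
move=> r0 T0 hr /(sidon_word_bound r0 T0)[K K0 hK].
set D := #|{: T}| in T0 hr hK.
pose c := K * (4 * Num.sqrt D%:R) `^ r.
(* The excess of the exponent [D] of [M] on the left over the exponent [r (D + q)/2] on the right;
   as it is positive, the bound fails for large [M]. *)
pose de := D%:R - (q%:R + D%:R) * (r / 2).
have de0 : 0 < de by rewrite /de; lra.
have key (M : nat) : (0 < M)%N -> M%:R `^ de <= c.
  move=> M0; have M0R : 0 < M%:R :> R by rewrite ltr0n.
  have := hK M M0.
  have -> : 4 * Num.sqrt ((D * M ^ q)%:R * (M ^ D)%:R) = 4 * Num.sqrt D%:R * M%:R `^ ((q%:R + D%:R) / 2) :> R.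
    rewrite natrM -mulrA sqrtrM// -mulrA; congr (_ * (_ * _)).
    rewrite -natrM -expnD natrX -powR12_sqrt ?exprn_ge0// -powR_mulrn// -powRrM.
    by rewrite natrD.
  rewrite powRM ?mulr_ge0 ?sqrtr_ge0 ?powR_ge0// -powRrM mulrA -/c.
  rewrite natrX -powR_mulrn// -ler_pdivrMr ?powR_gt0// => h; apply: le_trans h.
  rewrite le_eqVlt; apply/orP; left; apply/eqP.
  rewrite -powRN -powRD; last by rewrite (gt_eqF M0R) implybT.
  by congr powR; rewrite /de; field.
have c0 : 0 <= c by rewrite mulr_ge0// powR_ge0.
pose M := (Num.truncn ((c + 1) `^ de^-1)).+1.
have := key M isT; apply/negP; rewrite -ltNge.
apply: (@lt_le_trans _ _ (c + 1)); first by rewrite ltrDl.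
have -> : c + 1 = ((c + 1) `^ de^-1) `^ de.
  by rewrite -powRrM mulVf ?gt_eqF// powRr1// addr_ge0.
apply: ge0_ler_powR; rewrite ?nnegrE ?powR_ge0//; first exact: ltW.
have /truncn_itv/andP[_ /ltW] := powR_ge0 (c + 1) de^-1; exact.
Qed.

End not_sidon.

(** Subtraction in ['I_n.+1] is cyclic, so [S j] consists of the [q] positions starting at [j]; the
    two counts translate, respectively reflect, the initial segment of length [q]. *)
Lemma cyclic_system (d q : nat) : (0 < q <= d)%N -> exists S : 'I_d -> {set 'I_d},
  (forall j, #|S j| = q) /\ (forall i, #|[pred j | i \in S j]| = q).
Proof.
case: d => [|n]; first by case: q.
move=> /andP[q0 qn].
have cq : #|finset (fun i : 'I_n.+1 => (i < q)%N)| = q.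
  rewrite -sum1_card (eq_bigl (fun i : 'I_n.+1 => (i < q)%N)); last by move=> i; rewrite inE.
  by rewrite -(big_ord_widen _ (fun=> 1%N)) // sum1_card card_ord.
exists (fun j => finset (fun i : 'I_n.+1 => ((i - j)%R < q)%N)); split => [j|i].
  rewrite -[RHS]cq -[LHS](card_imset _ (can_inj (subrK j) : injective (fun i => i - j))).
  congr #|pred_of_set _|; apply/setP => k; rewrite inE; apply/imsetP/idP => [ [i iq ->]|kq].
    by move: iq; rewrite inE.
  by exists (k + j); rewrite ?inE addrK.
have inj : injective (fun j : 'I_n.+1 => i - j) by apply: (can_inj (g := fun j => i - j)) => j; rewrite subKr.
rewrite -[RHS]cq -cardsE -[LHS](card_imset _ inj).
congr #|pred_of_set _|; apply/setP => k; rewrite inE; apply/imsetP/idP => [ [j jq ->]|kq].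
  by move: jq; rewrite !inE.
by move: kq; rewrite inE => kq; exists (i - k); rewrite ?(inE, subKr).
Qed.

Lemma card_pairs m (d : 'I_m -> nat) : #|{: {k : 'I_m & 'I_(d k)}}| = (\sum_k d k)%N.
Proof.
rewrite card_tagged sumnE big_map big_enum /=.
by apply: eq_bigr => k _; rewrite card_ord.
Qed.

Section optimality.
Context {R : realType} (m : nat) (p : 'I_m -> R).
Hypotheses (m0 : (0 < m)%N) (hp : forall j, 1 <= p j < 2).
Local Notation a := (fun k => p k / (2 - p k)).

(** Rounding [q a_k] down keeps [d_k/q <= a_k], that is the third clause, and lowers the sum [D] of
    the [d_k] by at most [m]. The last clause reads [r' q < (2 - r') D]; as [D >= q A - m], it holds
    once [q (A (2 - r') - r') > m (2 - r')], which dictates [q]. *)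
Lemma dimension_choice (r' : R) : r' * (\sum_k a k + 1) < 2 * \sum_k a k -> r' < 2 ->
  exists (q : nat) (d : 'I_m -> nat), [/\ (0 < q)%N, forall k, (q <= d k)%N,
    forall k, 2 * (d k)%:R / ((d k)%:R + q%:R) <= p k &
    r' * ((\sum_k d k)%N%:R + q%:R) < 2 * (\sum_k d k)%N%:R].
Proof.
move=> hr r2; set A := \sum_k _ in hr.
have e0 : 0 < A * (2 - r') - r' by lra.
pose q := (Num.truncn (m%:R * (2 - r') / (A * (2 - r') - r'))).+1.
have a1 k : 1 <= a k.
  have /andP[h1 h2] := hp k; have h3 : 0 < 2 - p k by lra.
  by rewrite ler_pdivlMr//; lra.
have qR : 0 < q%:R :> R by rewrite ltr0n.
pose d k := Num.truncn (q%:R * a k).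
have qa0 k : 0 <= q%:R * a k by rewrite mulr_ge0// (le_trans _ (a1 k)).
have dle k : (d k)%:R <= q%:R * a k by have /truncn_itv/andP[] := qa0 k.
have dgt k : q%:R * a k < (d k)%:R + 1 by have /truncn_itv/andP[_] := qa0 k; rewrite natr1.
have hq : m%:R * (2 - r') < q%:R * (A * (2 - r') - r').
  rewrite -ltr_pdivrMr//.
  have h : 0 <= m%:R * (2 - r') / (A * (2 - r') - r').
    by apply: divr_ge0; [apply: mulr_ge0 => //; lra|exact: ltW].
  by have /truncn_itv/andP[_] := h.
have dsum : q%:R * A - m%:R <= (\sum_k d k)%N%:R.
  have -> : m%:R = \sum_(k < m) 1 :> R by rewrite sumr_const card_ord.
  rewrite natr_sum /A mulr_sumr -sumrB.
  by apply: ler_sum => k _; have := dgt k; lra.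
exists q, d; split => //.
- by move=> k; rewrite truncn_ge_nat// ler_peMr// ltW.
- move=> k; have /andP[h1 h2] := hp k; have := dle k.
  rewrite mulrA ler_pdivlMr; last by lra.
  rewrite ler_pdivrMr ?ltr_wpDl//; lra.
- have : 0 < 2 - r' by lra.
  move: dsum hq; set D := (_%:R in X in _ <= X); nra.
Qed.

Lemma not_sidon_example (r r' : R) : 1 / r = 1 / 2 + 1 / (2 * \sum_k a k) -> 1 <= r' < r ->
  exists (G : 'I_m -> compactAbGroupType)
    (mu : forall j, probability (borel (G j)) R)
    (nu : probability (borel (prod_topology G)) R)
    (L : forall j, set (G j -> R[i])),
  [/\ forall j, is_haar (mu j), is_haar nu, forall j, @L j `<=` dual R (G j),
      forall j, sidon (mu j) (p j) (@L j) /\ Lambda2 (mu j) (@L j)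
    & ~ sidon nu r' (prod_spectrum L)].
Proof.
move=> hr /andP[r1 rr]; set A := \sum_k _ in hr.
have a1 k : 1 <= a k.
  have /andP[h1 h2] := hp k; have h3 : 0 < 2 - p k by lra.
  by rewrite ler_pdivlMr//; lra.
have A0 : 0 < A.
  rewrite /A (bigD1 (Ordinal m0))//= ltr_pwDl ?sumr_ge0//; first exact: lt_le_trans (a1 _).
  by move=> j _; exact: le_trans (a1 _).
have rE : r = 2 * A / (A + 1).
  have hr' : r^-1 = 1 / 2 + 1 / (2 * A) by rewrite -hr div1r.
  by rewrite -[LHS]invrK hr'; field; rewrite !gt_eqF ?addr_gt0.
have hr2 : r' * (A + 1) < 2 * A by rewrite -ltr_pdivlMr ?addr_gt0// -rE.
have r2 : r' < 2 by rewrite -(ltr_pM2r (_ : 0 < A + 1)) ?addr_gt0//; lra.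
have [q [d [q0 qd hd hD]]] := dimension_choice hr2 r2.
have exS : forall k, exists S : 'I_(d k) -> {set 'I_(d k)},
    (forall j, #|S j| = q) /\ (forall i, #|[pred j | i \in S j]| = q).
  by move=> k; apply: cyclic_system; rewrite q0 qd.
pose S k := sval (cid (exS k)); have hS k := svalP (cid (exS k)).
have exmu : forall k, exists mu : probability (borel (cantor_power (d k))) R, is_haar mu.
  by move=> k; exact: cantor_power_haar.
pose mu k := sval (cid (exmu k)); have hmu k := svalP (cid (exmu k)).
have [nu hnu] := cantor_powers_haar (R := R) d.
exists (fun k => cantor_power (d k)), mu, nu, (fun k => @frac_set R _ (S k)); split => //.
- by move=> k; exact: frac_set_dual.
- move=> k; split; last exact: (frac_Lambda2 (S k) (hmu k)).
  apply: (frac_sidon (hmu k) _ q0) => //; last by case: (hS k).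
  exact: leq_trans (qd k).
- apply: (@not_sidon _ _ _ S q _ _ nu hnu).
  + by move=> k i; have : (0 < #|[pred j | i \in S k j]|)%N;
      [rewrite (proj2 (hS k))|case/card_gt0P => j; exists j].
  + by move=> k; case: (hS k).
  + exact: lt_le_trans r1.
  + by rewrite card_pairs (bigD1 (Ordinal m0))//= ltn_addr// (leq_trans q0).
  + by rewrite card_pairs.
Qed.

End optimality.

Unset Implicit Arguments.

Theorem theorem1p3 (R : realType) (m : nat) (p : 'I_m -> R) (r : R)
    (hm : (2 <= m)%N) (hp : forall j, 1 <= p j < 2)
    (hr : 1 / r = 1 / 2 + 1 / (2 * \sum_(k < m) p k / (2 - p k))) :
  (forall (G : 'I_m -> compactAbGroupType)
     (mu : forall j, probability (borel (G j)) R)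
     (nu : probability (borel (prod_topology G)) R)
     (L : forall j, set (G j -> R[i])),
     (forall j, is_haar (mu j)) -> is_haar nu ->
     (forall j, L j `<=` dual R (G j)) ->
     (forall j, sidon (mu j) (p j) (L j) /\ Lambda2 (mu j) (L j)) ->
     sidon nu r (prod_spectrum L)) /\
  (forall r' : R, 1 <= r' < r ->
     exists (G : 'I_m -> compactAbGroupType)
       (mu : forall j, probability (borel (G j)) R)
       (nu : probability (borel (prod_topology G)) R)
       (L : forall j, set (G j -> R[i])),
       [/\ forall j, is_haar (mu j), is_haar nu,
           forall j, L j `<=` dual R (G j),
           forall j, sidon (mu j) (p j) (L j) /\ Lambda2 (mu j) (L j)
         & ~ sidon nu r' (prod_spectrum L)]).
Proof.
have m0 : (0 < m)%N by exact: leq_trans hm.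
split=> [G mu nu L hmu hnu Ldual hL|r' hr']; last exact: (not_sidon_example m0 hp hr hr').
exact: (product_sidon (Ordinal m0) hp hr hmu hnu Ldual hL).
Qed.
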